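(* The following two assertions are equivalent. (i) For all $x,y,z,n\in\mathbb{N}$ with $n\geq 3$, $$\lim_{\tau\to\infty}\frac{1}{\tau}\int_0^{\frac{x^n+y^n}{z^n}\cdot\frac{\tau}{\ln 2\pi-2c}}\left\{\ln t-\left|\zeta\left(\tfrac12+it\right)\right|^2\right\}\,dt\neq 1 .$$ (ii) (Fermat-Wiles theorem) For all $x,y,z,n\in\mathbb{N}$ with $n\geq 3$, one has $x^n+y^n\neq z^n$.
   Context: $\zeta$ is the Riemann zeta-function, $c$ is Euler's constant ($c\approx 0.577$), $\ln$ is the natural logarithm, and $\mathbb{N}$ is the set of positive integers. Note $\ln 2\pi-2c\approx 0.68>0$. The numbers $\frac{x^n+y^n}{z^n}$ with $x,y,z,n\in\mathbb{N}$, $n\ge 3$, are called Fermat's rationals; the limit is taken with $x,y,z,n$ fixed. *)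

(* Defs.v *)
From Stdlib Require Import Reals.
From Coquelicot Require Import Coquelicot.
Open Scope R_scope.

Definition Cexp (z : C) : C :=
  (exp (Re z) * cos (Im z), exp (Re z) * sin (Im z)).

(* k^(-s), meaningful for k >= 1 *)
Definition nat_Cpow_opp (k : nat) (s : C) : C :=
  Cexp (Copp (Cmult s (RtoC (ln (INR k))))).

(* Analytic in the sense of Weierstrass: f is the sum of a power series with
   complex coefficients on some disc centred at s0. *)
Definition C_analytic_at (f : C -> C) (s0 : C) : Prop :=
  exists (a : nat -> C) (r : R), 0 < r /\
    forall s : C, Cmod (Cminus s s0) < r ->
      is_pseries (K := C_AbsRing) (V := C_NormedModule)
        a (Cminus s s0) (f s).

(* zeta is the analytic continuation to C \ {1} of the Dirichlet series
   sum_(k >= 1) k^(-s), Re s > 1.  As C \ {1} is connected, this determines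
   zeta on C \ {1}; the value at the pole 1 is left unconstrained. *)
Definition is_riemann_zeta (zeta : C -> C) : Prop :=
  (forall s : C, 1 < Re s ->
     is_series (K := C_AbsRing) (V := C_NormedModule)
       (fun k : nat => nat_Cpow_opp (S k) s) (zeta s)) /\
  (forall s : C, s <> RtoC 1 -> C_analytic_at zeta s).

(* The harmonic sum has n + 1 terms: 1 + 1/2 + ... + 1/(n + 1). *)
Definition euler_constant : R :=
  real (Lim_seq (fun n : nat =>
    sum_f_R0 (fun k : nat => / INR (S k)) n - ln (INR (S n)))).

(* The integral over (0, X] of ln t - |zeta(1/2 + i t)|^2; it is improper at 0,
   where ln is unbounded. *)
Definition zeta_ln_integral (zeta : C -> C) (X : R) : R :=
  RInt_gen (fun t : R => ln t - Cmod (zeta (1 / 2, t)) ^ 2)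
    (at_right 0) (at_point X).

(* Main.v *)
Require Import Defs.
From Stdlib Require Import ZArith Reals Lra Lia Psatz Factorial Classical.
From Coquelicot Require Import Coquelicot.
Open Scope R_scope.

(** Both assertions are statements about the number [q = (x^n + y^n) / z^n]: the
    limit in the first one exists and equals [q] ([zeta_ln_integral_limit]), so it
    differs from 1 exactly when [x^n + y^n <> z^n].

    As the integral of [ln t] from 0 to [T] is [T ln T - T], the limit amounts to the
    mean value theorem of Hardy, Littlewood and Ingham with its second term,
    [int_0^T |zeta(1/2 + it)|^2 dt = T ln T + (2 c - 1 - ln (2 PI)) T + o(T)]
    ([second_moment_asymp], [c] being Euler's constant), together with the
    positivity of [ln (2 PI) - 2 c] ([slope_constant_pos]).

    Smoothing.  The weighted moment [V(T) = int_0^T (T - t) |zeta(1/2 + it)|^2 dt] is a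
    primitive of the second moment, which is nondecreasing.  An asymptotic formula
    for [V] with an error smaller than [T^2] by a power of [T]
    ([weighted_moment_asymp]) can therefore be differenced
    ([weighted_moment_slope]).

    Approximation.  On the critical line, zeta is
    [zeta_N = sum_(n <= N) n^(-s) - N^(1-s) / (1-s)] up to [O(N^(-1/2) + t^2 N^(-3/2))]
    ([zeta_approx]); [N] will be about [T^(7/5)].  For [Re s > 1] this is the
    Euler-Maclaurin formula.  The series of errors of the trapezoidal rule,
    [trap_sum], continues it: it is shown to have local power series, and an
    identity theorem along a segment identifies it with the given continuation of
    zeta ([zeta_defect_segment]).

    Mean value of the approximation ([approx_moment_asymp]).  In the square of the
    partial sum, the weight [T - t] turns the pair [m], [n = m + h] into
    [(1 - cos (T l)) / (l^2 sqrt (m n))] with [l = ln (n / m)].  One may replace [l] by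
    [h / m] ([off_diagonal_asymp]); the sum over [h] is then the Fourier series of the
    periodic parabola [PI^2 {v} (1 - {v})] at [v = y / m], [y = T / (2 PI)]
    ([cos_sum_parabola]).  The sum over [m] of [m {y/m} (1 - {y/m})] is elementary up to
    [2 sum_(n <= y) d(n) (y - n)] ([sum_parabola]), which Dirichlet's hyperbola method
    evaluates ([riesz_sum_asymp]).  The contribution [PI T N] of large [m] is cancelled
    by the terms that involve [N^(1-s) / (1-s)] ([pole_sum], [pole_P_0_bounds]). *)

(** * Finite sums and harmonic numbers *)

Fixpoint sum1 (f : nat -> R) (N : nat) : R :=
  match N with O => 0 | S k => sum1 f k + f (S k) end.

Lemma sum1_ext f g N :
  (forall n, (1 <= n <= N)%nat -> f n = g n) -> sum1 f N = sum1 g N.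
Proof.
  induction N as [|N IH]; intros H; simpl; [reflexivity|].
  rewrite IH, (H (S N)); [reflexivity|lia|intros; apply H; lia].
Qed.

Lemma sum1_le f g N :
  (forall n, (1 <= n <= N)%nat -> f n <= g n) -> sum1 f N <= sum1 g N.
Proof.
  induction N as [|N IH]; intros H; simpl; [lra|].
  apply Rplus_le_compat; [apply IH; intros; apply H; lia|apply H; lia].
Qed.

Lemma sum1_plus f g N : sum1 (fun n => f n + g n) N = sum1 f N + sum1 g N.
Proof. induction N as [|N IH]; simpl; [ring|rewrite IH; ring]. Qed.

Lemma sum1_scal c f N : sum1 (fun n => c * f n) N = c * sum1 f N.
Proof. induction N as [|N IH]; simpl; [ring|rewrite IH; ring]. Qed.

Lemma sum1_minus f g N : sum1 (fun n => f n - g n) N = sum1 f N - sum1 g N.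
Proof. induction N as [|N IH]; simpl; [ring|rewrite IH; ring]. Qed.

Lemma sum1_const c N : sum1 (fun _ => c) N = INR N * c.
Proof.
  induction N as [|N IH]; [simpl; ring|]. rewrite S_INR; simpl; rewrite IH; ring.
Qed.

Lemma sum1_nonneg f N : (forall n, (1 <= n <= N)%nat -> 0 <= f n) -> 0 <= sum1 f N.
Proof.
  intros H. replace 0 with (sum1 (fun _ => 0) N) by (rewrite sum1_const; ring).
  apply sum1_le, H.
Qed.

Lemma sum1_Rabs f N : Rabs (sum1 f N) <= sum1 (fun n => Rabs (f n)) N.
Proof.
  induction N as [|N IH]; simpl; [rewrite Rabs_R0; lra|].
  eapply Rle_trans; [apply Rabs_triang|lra].
Qed.

Lemma sum1_dist f g e N :
  (forall n, (1 <= n <= N)%nat -> Rabs (f n - g n) <= e n) ->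
  Rabs (sum1 f N - sum1 g N) <= sum1 e N.
Proof.
  intros H. rewrite <- sum1_minus.
  eapply Rle_trans; [apply sum1_Rabs|]. apply sum1_le, H.
Qed.

Lemma sum1_add f M K :
  sum1 f (M + K) = sum1 f M + sum1 (fun k => f (M + k)%nat) K.
Proof.
  induction K as [|K IH]; simpl; [rewrite Nat.add_0_r; ring|].
  rewrite Nat.add_succ_r; simpl; rewrite IH; ring.
Qed.

Lemma sum1_split f M N : (M <= N)%nat ->
  sum1 f N = sum1 f M + sum1 (fun k => f (M + k)%nat) (N - M).
Proof. intros H. rewrite <- sum1_add. f_equal. lia. Qed.

Lemma sum1_swap f M N :
  sum1 (fun m => sum1 (fun n => f m n) N) M = sum1 (fun n => sum1 (fun m => f m n) M) N.
Proof.
  induction M as [|M IH]; simpl.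
  - rewrite sum1_const; ring.
  - rewrite IH, <- sum1_plus; reflexivity.
Qed.

(** Off the diagonal, each pair [{m, m + h}] is met in both orders. *)
Lemma sum1_symmetric f N :
  (forall m n, f m n = f n m) ->
  sum1 (fun m => sum1 (f m) N) N =
  sum1 (fun m => f m m) N + 2 * sum1 (fun m => sum1 (fun h => f m (m + h)%nat) (N - m)) N.
Proof.
  intros Hs. induction N as [|N IH]; [simpl; ring|].
  assert (E1 : sum1 (fun m => sum1 (f m) (S N)) (S N) =
    sum1 (fun m => sum1 (f m) N) N + 2 * sum1 (fun m => f m (S N)) N + f (S N) (S N)).
  { simpl. rewrite sum1_plus.
    rewrite (sum1_ext (f (S N)) (fun m => f m (S N))) by (intros; apply Hs). ring. }
  assert (E2 : sum1 (fun m => sum1 (fun h => f m (m + h)%nat) (S N - m)) (S N) =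
    sum1 (fun m => sum1 (fun h => f m (m + h)%nat) (N - m)) N + sum1 (fun m => f m (S N)) N).
  { rewrite <- sum1_plus. change (sum1 ?g (S N)) with (sum1 g N + g (S N)).
    cbv beta. replace (S N - S N)%nat with O by lia.
    change (sum1 (fun h => f (S N) (S N + h)%nat) 0) with 0. rewrite Rplus_0_r.
    apply sum1_ext. intros n Hn. replace (S N - n)%nat with (S (N - n)) by lia.
    simpl. replace (n + S (N - n))%nat with (S N) by lia. reflexivity. }
  rewrite E1, E2, IH. simpl. ring.
Qed.

Lemma sum1_id N : sum1 INR N = INR N * (INR N + 1) / 2.
Proof.
  induction N as [|N IH]; [simpl; lra|].
  change (sum1 INR (S N)) with (sum1 INR N + INR (S N)). rewrite IH, S_INR. field.
Qed.

Lemma INR_ge_1 n : (1 <= n)%nat -> 1 <= INR n.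
Proof. intros H. change 1 with (INR 1). apply le_INR, H. Qed.

Lemma sum1_inv_sq_tail M K : (1 <= M)%nat ->
  sum1 (fun k => / INR (M + k) ^ 2) K <= / INR M - / INR (M + K).
Proof.
  intros HM. induction K as [|K IH].
  - rewrite Nat.add_0_r. simpl. lra.
  - change (sum1 ?g (S K)) with (sum1 g K + g (S K)). cbv beta.
    rewrite Nat.add_succ_r, S_INR. set (x := INR (M + K)) in *.
    assert (Hx : 1 <= x) by (apply INR_ge_1; lia).
    assert (/ (x + 1) ^ 2 <= / x - / (x + 1)).
    { replace (/ x - / (x + 1)) with (/ (x * (x + 1))) by (field; lra).
      apply Rinv_le_contravar; nra. }
    lra.
Qed.

Lemma sum1_inv_sq K : sum1 (fun k => / INR k ^ 2) K <= 2.
Proof.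
  destruct K as [|K]; [simpl; lra|].
  rewrite <- (Nat.add_1_l K), sum1_add. pose proof (sum1_inv_sq_tail 1 K (le_n 1)) as H.
  assert (0 < / INR (1 + K)) by (apply Rinv_0_lt_compat, lt_0_INR; lia).
  simpl sum1 at 1. change (INR 1) with 1 in *. lra.
Qed.

Lemma sum1_inv_sqrt N : sum1 (fun n => / sqrt (INR n)) N <= 2 * sqrt (INR N).
Proof.
  induction N as [|N IH]; [simpl; rewrite sqrt_0; lra|].
  change (sum1 ?g (S N)) with (sum1 g N + g (S N)). cbv beta.
  rewrite S_INR. set (x := INR N) in *. assert (Hx : 0 <= x) by apply pos_INR.
  pose proof (sqrt_pos x) as Ha. assert (Hb : 0 < sqrt (x + 1)) by (apply sqrt_lt_R0; lra).
  pose proof (sqrt_sqrt x Hx) as Ea. pose proof (sqrt_sqrt (x+1) ltac:(lra)) as Eb.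
  set (a := sqrt x) in *. set (b := sqrt (x + 1)) in *.
  assert (/ b <= 2 * b - 2 * a).
  { apply Rmult_le_reg_r with b; [lra|]. rewrite Rinv_l by lra. nra. }
  lra.
Qed.

Definition harmonic N := sum1 (fun n => / INR n) N.

Lemma ln_succ_bounds x : 1 <= x -> / (x + 1) <= ln (x + 1) - ln x <= / x.
Proof.
  intros Hx.
  assert (K : forall a, 0 < a -> ln a <= a - 1).
  { intros a Ha. pose proof (exp_ineq1_le (ln a)) as H. rewrite exp_ln in H; lra. }
  rewrite <- ln_div by lra. split.
  - pose proof (K (x / (x + 1)) ltac:(apply Rdiv_lt_0_compat; lra)) as H.
    rewrite ln_div in H by lra. rewrite ln_div by lra.
    replace (x / (x + 1) - 1) with (- / (x + 1)) in H by (field; lra). lra.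
  - pose proof (K ((x + 1) / x) ltac:(apply Rdiv_lt_0_compat; lra)) as H.
    replace ((x + 1) / x - 1) with (/ x) in H by (field; lra). lra.
Qed.

Lemma harmonic_le N : (1 <= N)%nat -> harmonic N <= 1 + ln (INR N).
Proof.
  intros H. induction N as [|N IH]; [lia|]. destruct N as [|N].
  - unfold harmonic; simpl. rewrite ln_1. lra.
  - assert (IH' := IH ltac:(lia)). unfold harmonic in *.
    change (sum1 ?g (S (S N))) with (sum1 g (S N) + g (S (S N))). cbv beta.
    rewrite (S_INR (S N)). pose proof (ln_succ_bounds (INR (S N)) ltac:(apply INR_ge_1; lia)). lra.
Qed.

Lemma sum_f_R0_sum1 f n : sum_f_R0 (fun k => f (S k)) n = sum1 f (S n).
Proof. induction n as [|n IH]; [simpl; ring|]. rewrite tech5, IH. reflexivity. Qed.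

(** [H_N - ln N] decreases, [H_N - ln N - 1/N] increases, and they have Euler's
    constant as common limit, which is thus bracketed at every [N]. *)
Lemma harmonic_euler N : (1 <= N)%nat ->
  ln (INR N) + euler_constant <= harmonic N <= ln (INR N) + euler_constant + / INR N.
Proof.
  set (d := fun n => harmonic (S n) - ln (INR (S n))).
  set (c := fun n => d n - / INR (S n)).
  assert (Hd : forall n, d (S n) <= d n).
  { intros n. unfold d, harmonic.
    change (sum1 ?g (S (S n))) with (sum1 g (S n) + g (S (S n))). cbv beta.
    rewrite (S_INR (S n)). pose proof (ln_succ_bounds (INR (S n)) ltac:(apply INR_ge_1; lia)). lra. }
  assert (Hc : forall n, c n <= c (S n)).
  { intros n. unfold c, d, harmonic.
    change (sum1 ?g (S (S n))) with (sum1 g (S n) + g (S (S n))). cbv beta.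
    rewrite (S_INR (S n)). pose proof (ln_succ_bounds (INR (S n)) ltac:(apply INR_ge_1; lia)). lra. }
  assert (Hcd : forall n, c n <= d n).
  { intros n. unfold c. assert (0 < / INR (S n)) by (apply Rinv_0_lt_compat, lt_0_INR; lia). lra. }
  assert (Hl : is_lim_seq (fun n => / INR (S n)) 0).
  { apply (is_lim_seq_incr_1 (fun n => / INR n)).
    change (Finite 0) with (Rbar_inv p_infty). apply is_lim_seq_inv; [apply is_lim_seq_INR|easy]. }
  destruct (ex_lim_seq_adj c d Hc Hd) as (Lc & Ld & Elim).
  { apply is_lim_seq_ext with (fun n => / INR (S n)); [intros; unfold c; ring|exact Hl]. }
  assert (Eg : euler_constant = real (Lim_seq d)).
  { unfold euler_constant. f_equal. apply Lim_seq_ext. intros n. unfold d, harmonic.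
    now rewrite <- sum_f_R0_sum1. }
  destruct (ex_finite_lim_seq_correct d) as [F _]. destruct (F Ld) as [_ Fin].
  pose proof (Lim_seq_correct' d Ld) as Hgd. pose proof (Lim_seq_correct' c Lc) as Hgc.
  rewrite Elim in Hgc. rewrite <- Eg in Hgd, Hgc.
  intros HN. destruct N as [|n]; [lia|].
  pose proof (is_lim_seq_decr_compare d _ Hgd Hd n) as B1.
  pose proof (is_lim_seq_incr_compare c _ Hgc Hc n) as B2.
  unfold c in B2. unfold d in *. lra.
Qed.

(** * Dirichlet's divisor problem, smoothed *)

(** Up to the factor [PI^2], this is the sum of the series
    [sum_(h >= 1) (1 - cos (2 PI h v)) / h^2]; see [cos_sum_parabola]. *)
Definition parabola (v : R) : R := frac_part v * (1 - frac_part v).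

Lemma parabola_bounds v : 0 <= parabola v <= / 4.
Proof. unfold parabola. destruct (base_fp v) as [A B]. split; [nra|].
  pose proof (pow2_ge_0 (frac_part v - / 2)). lra. Qed.

Lemma nat_floor v : 0 <= v -> exists q : nat, v = INR q + frac_part v.
Proof.
  intros Hv. exists (Z.to_nat (Int_part v)). rewrite INR_IZR_INZ, Z2Nat.id.
  - unfold frac_part. ring.
  - destruct (base_Int_part v) as [A B]. apply Z.lt_succ_r. apply lt_IZR. rewrite succ_IZR. lra.
Qed.

(** Only the terms with [k <= floor v] count, so the sum is a quadratic polynomial
    in [floor v] and [v]; what it misses of [v^2 - v] is the periodic parabola. *)
Lemma sum_positive_parts v K : 0 <= v <= INR K ->
  sum1 (fun k => 2 * Rmax 0 (v - INR k)) K = v ^ 2 - v + parabola v.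
Proof.
  intros [Hv HK]. destruct (nat_floor v Hv) as [q Hq].
  destruct (base_fp v) as [F0 F1].
  assert (Hqk : (q <= K)%nat) by (apply INR_le; lra).
  replace K with (q + (K - q))%nat by lia. rewrite sum1_add.
  rewrite (sum1_ext _ (fun k => 2 * v - 2 * INR k)).
  2:{ intros n Hn. rewrite Rmax_right; [ring|]. assert (INR n <= INR q) by (apply le_INR; lia). lra. }
  rewrite (sum1_ext (fun k => 2 * Rmax 0 (v - INR (q + k))) (fun _ => 0)).
  2:{ intros n Hn. rewrite Rmax_left; [ring|]. rewrite plus_INR.
      assert (1 <= INR n) by (apply INR_ge_1; lia). lra. }
  rewrite sum1_minus, !sum1_const, (sum1_scal 2 INR), sum1_id. unfold parabola.
  set (f := frac_part v) in *. rewrite Hq at 1 2 3. field.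
Qed.

Lemma sum_positive_parts_mult m y K : (1 <= m)%nat -> 0 <= y -> y <= INR m * INR K ->
  sum1 (fun k => 2 * Rmax 0 (y - INR m * INR k)) K =
  y ^ 2 / INR m - y + INR m * parabola (y / INR m).
Proof.
  intros Hm Hy HK. assert (Hm' : 1 <= INR m) by (apply INR_ge_1, Hm).
  rewrite (sum1_ext _ (fun k => INR m * (2 * Rmax 0 (y / INR m - INR k)))).
  2:{ intros k _. replace (y - INR m * INR k) with (INR m * (y / INR m - INR k)) by (field; lra).
      rewrite <- (Rmult_0_r (INR m)) at 1. rewrite RmaxRmult by lra. ring. }
  rewrite sum1_scal, sum_positive_parts; [field; lra|]. split.
  - apply Rdiv_le_0_compat; lra.
  - apply Rle_div_l; lra.
Qed.

(** As [mk = n] has [d(n)] solutions, this is [2 sum_(n <= y) d(n) (y - n)] as soon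
    as [N >= y]: twice the integral of the summatory function of the divisor
    function from 0 to [y]. *)
Definition riesz_sum (y : R) (N : nat) : R :=
  sum1 (fun m => sum1 (fun k => 2 * Rmax 0 (y - INR m * INR k)) N) N.

(** Summing [sum_positive_parts_mult] over [m] exchanges the arithmetic hidden in
    the fractional parts of [y / m] for the divisor function. *)
Lemma sum_parabola y N : 0 <= y <= INR N ->
  sum1 (fun m => INR m * parabola (y / INR m)) N =
  y * INR N - y ^ 2 * harmonic N + riesz_sum y N.
Proof.
  intros [Hy HN]. unfold riesz_sum, harmonic.
  rewrite (sum1_ext (fun m => sum1 _ N)
    (fun m => (y ^ 2 * / INR m - y) + INR m * parabola (y / INR m))).
  - rewrite sum1_plus, sum1_minus, sum1_scal, sum1_const. ring.
  - intros m Hm. assert (1 <= INR m) by (apply INR_ge_1; lia).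
    rewrite sum_positive_parts_mult; [unfold Rdiv; ring|lia|lra|].
    assert (0 <= INR N) by lra. nra.
Qed.

(** Dirichlet's hyperbola method.  With [M = floor (sqrt y)], a pair of integers
    both larger than [M] has product at least [y] and contributes nothing, so the
    two strips [m <= M] and [k <= M] suffice; the square is counted twice. *)
Lemma riesz_sum_hyperbola y N M : (M <= N)%nat -> INR M ^ 2 <= y -> y <= INR (S M) ^ 2 ->
  riesz_sum y N =
  2 * sum1 (fun m => sum1 (fun k => 2 * Rmax 0 (y - INR m * INR k)) N) M
  - sum1 (fun m => sum1 (fun k => 2 * (y - INR m * INR k)) M) M.
Proof.
  intros HM H1 H2. unfold riesz_sum.
  set (F := fun m k : nat => 2 * Rmax 0 (y - INR m * INR k)).
  change (sum1 (fun m => sum1 (F m) N) N = 2 * sum1 (fun m => sum1 (F m) N) M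
   - sum1 (fun m => sum1 (fun k => 2 * (y - INR m * INR k)) M) M).
  rewrite (sum1_ext (fun m => sum1 (fun k => 2 * (y - INR m * INR k)) M) (fun m => sum1 (F m) M)).
  2:{ intros m Hm. apply sum1_ext. intros k Hk. unfold F. rewrite Rmax_right; [reflexivity|].
      assert (INR m <= INR M) by (apply le_INR; lia). assert (INR k <= INR M) by (apply le_INR; lia).
      pose proof (pos_INR m). pose proof (pos_INR k). nra. }
  rewrite (sum1_split (fun m => sum1 (F m) N) M N HM).
  assert (E : sum1 (fun j => sum1 (F (M + j)%nat) N) (N - M)
     = sum1 (fun m => sum1 (F m) N) M - sum1 (fun m => sum1 (F m) M) M).
  { rewrite (sum1_ext _ (fun j => sum1 (F (M + j)%nat) M)).
    - rewrite <- sum1_minus.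
      rewrite (sum1_ext (fun n => sum1 (F n) N - sum1 (F n) M)
        (fun m => sum1 (fun j => F m (M + j)%nat) (N - M))).
      + rewrite sum1_swap. apply sum1_ext. intros n _. apply sum1_ext. intros m _.
        unfold F. now rewrite (Rmult_comm (INR n)).
      + intros m _. rewrite (sum1_split _ M N HM). ring.
    - intros j Hj. rewrite (sum1_split _ M N HM).
      rewrite (sum1_ext (fun k => F (M + j)%nat (M + k)%nat) (fun _ => 0)).
      + rewrite sum1_const. ring.
      + intros k Hk. unfold F. rewrite Rmax_left; [ring|].
        assert (INR (S M) <= INR (M + j)) by (apply le_INR; lia).
        assert (INR (S M) <= INR (M + k)) by (apply le_INR; lia).
        pose proof (pos_INR (S M)). nra. }
  rewrite E. ring.
Qed.

(** A strip contributes [y^2 H_M - y M + O(M^2)], whence the logarithm and Euler's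
    constant; the fractional parts enter only through the [O(M^2)]. *)
Lemma riesz_sum_asymp y N : 1 <= y -> y <= INR N ->
  Rabs (riesz_sum y N - (y ^ 2 * ln y + (2 * euler_constant - 3 / 2) * y ^ 2))
    <= 20 * (y * sqrt y).
Proof.
  intros Hy HN.
  destruct (nat_floor (sqrt y) (sqrt_pos y)) as [M HM].
  destruct (base_fp (sqrt y)) as [F0 F1]. set (f := frac_part (sqrt y)) in *.
  assert (Hs : sqrt y * sqrt y = y) by (apply sqrt_sqrt; lra).
  assert (Hs1 : 1 <= sqrt y) by (rewrite <- sqrt_1; apply sqrt_le_1_alt, Hy).
  set (s := sqrt y) in *. set (x := INR M) in *.
  assert (Hx1 : (1 <= M)%nat).
  { destruct M as [|M]; [|lia]. exfalso. unfold x in HM; simpl in HM. lra. }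
  assert (Hx : 1 <= x) by (apply INR_ge_1, Hx1).
  assert (HMN : (M <= N)%nat) by (apply INR_le; fold x; nra).
  rewrite (riesz_sum_hyperbola y N M HMN); [|fold x; nra|rewrite S_INR; fold x; nra].
  rewrite (sum1_ext (fun m => sum1 (fun k => 2 * Rmax 0 (y - INR m * INR k)) N)
    (fun m => (y ^ 2 * / INR m - y) + INR m * parabola (y / INR m))).
  2:{ intros m Hm. assert (1 <= INR m) by (apply INR_ge_1; lia).
      rewrite sum_positive_parts_mult; [unfold Rdiv; ring|lia|lra|].
      assert (0 <= INR N) by lra. nra. }
  rewrite sum1_plus, sum1_minus, sum1_scal, sum1_const.
  rewrite (sum1_ext (fun m => sum1 (fun k => 2 * (y - INR m * INR k)) M)
     (fun m => 2 * x * y - (x * (x + 1)) * INR m)).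
  2:{ intros m _. rewrite sum1_scal, sum1_minus, sum1_const, sum1_scal, sum1_id. fold x. field. }
  rewrite sum1_minus, sum1_const, sum1_scal, sum1_id. fold x.
  set (P := sum1 (fun m => INR m * parabola (y / INR m)) M).
  assert (HP : 0 <= P <= x * (x + 1) / 8).
  { unfold P. split.
    - apply sum1_nonneg. intros n _. apply Rmult_le_pos; [apply pos_INR|apply parabola_bounds].
    - replace (x * (x + 1) / 8) with (/ 4 * sum1 INR M) by (rewrite sum1_id; fold x; field).
      rewrite <- sum1_scal. apply sum1_le. intros n _. pose proof (pos_INR n).
      pose proof (parabola_bounds (y / INR n)). nra. }
  pose proof (harmonic_euler M Hx1) as Hh. unfold harmonic in Hh. fold x in Hh.
  set (h := sum1 (fun n => / INR n) M) in *.
  assert (Hln : ln y = 2 * ln s) by (rewrite <- Hs, ln_mult by lra; ring).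
  assert (Hl : ln x <= ln s <= ln x + / x).
  { split; [apply ln_le; lra|].
    assert (ln s - ln x <= / x); [|lra]. rewrite <- ln_div by lra.
    pose proof (exp_ineq1_le (ln (s / x))) as E. rewrite exp_ln in E by (apply Rdiv_lt_0_compat; lra).
    assert (s / x <= 1 + / x).
    { rewrite HM. replace ((x + f) / x) with (1 + f * / x) by (field; lra).
      assert (0 < / x) by (apply Rinv_0_lt_compat; lra). nra. }
    lra. }
  rewrite Hln. set (g := euler_constant) in *. set (L := ln s) in *. set (l := ln x) in *.
  assert (Hix : / x * x = 1) by (apply Rinv_l; lra). assert (Hix0 : 0 < / x) by (apply Rinv_0_lt_compat; lra).
  assert (Hu : Rabs (h - L - g) <= / x) by (apply Rabs_le; lra).
  assert (Hsx : s <= 2 * x) by lra.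
  assert (Hyx : y * / x <= 2 * s).
  { rewrite <- Hs. replace (s * s * / x) with (s * (s * / x)) by ring.
    assert (s * / x <= 2) by nra. nra. }
  match goal with |- Rabs ?A <= _ =>
    replace A with (2 * y ^ 2 * (h - L - g) +
      (2 * P + (- 2 * x * y - 2 * x * (x * y) + x ^ 2 * (x + 1) ^ 2 / 2 + 3 / 2 * y ^ 2))) by field end.
  eapply Rle_trans; [apply Rabs_triang|].
  rewrite Rabs_mult, (Rabs_right (2 * y ^ 2)) by nra.
  assert (B1 : 2 * y ^ 2 * Rabs (h - L - g) <= 4 * (y * s)).
  { apply Rle_trans with (2 * y ^ 2 * / x); [apply Rmult_le_compat_l; nra|].
    replace (2 * y ^ 2 * / x) with (2 * y * (y * / x)) by ring. nra. }
  assert (B2 : Rabs (2 * P + (- 2 * x * y - 2 * x * (x * y) + x ^ 2 * (x + 1) ^ 2 / 2 + 3 / 2 * y ^ 2)) <= 16 * (y * s)).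
  { (* The square contributes [x^4 / 2 - 2 x^2 y], that is [- 3/2 y^2] up to the product
       [(y - x^2) (3 y - x^2) / 2], whose first factor is at most [2 s],
       and up to lower order terms. *)
    replace (- 2 * x * y - 2 * x * (x * y) + x ^ 2 * (x + 1) ^ 2 / 2 + 3 / 2 * y ^ 2)
      with ((y - x ^ 2) * (3 * y - x ^ 2) / 2 + (x ^ 3 + x ^ 2 / 2 - 2 * x * y)) by field.
    assert (Hxs : x <= s) by lra.
    assert (Hd0 : 0 <= y - x ^ 2) by nra. assert (Hd : y - x ^ 2 <= 2 * s) by nra.
    assert (x ^ 2 <= y) by nra. assert (x * y <= y * s) by nra.
    assert (0 <= x ^ 3 <= y * s) by (split; [nra|replace (x ^ 3) with (x ^ 2 * x) by ring; nra]).
    assert (y <= y * s) by nra.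
    assert (0 <= (y - x ^ 2) * (3 * y - x ^ 2) <= 2 * s * (3 * y)).
    { split; [nra|]. apply Rmult_le_compat; nra. }
    apply Rabs_le; split; nra. }
  lra.
Qed.

(** * The Fourier series of the periodic parabola *)

Lemma derive_nonneg_le f f' a b : a <= b ->
  (forall x, a <= x <= b -> is_derive f x (f' x)) ->
  (forall x, a <= x <= b -> 0 <= f' x) -> f a <= f b.
Proof.
  intros Hab Hd Hp. destruct (MVT_gen f a b f') as [c [Hc E]];
    rewrite ?Rmin_left, ?Rmax_right in * by lra.
  - intros x Hx. apply Hd. lra.
  - intros x Hx. apply continuity_pt_filterlim. apply (ex_derive_continuous f). eexists; apply Hd; lra.
  - specialize (Hp c Hc). nra.
Qed.

Lemma derive_bounded_le f f' M a b : a <= b ->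
  (forall x, a <= x <= b -> is_derive f x (f' x)) ->
  (forall x, a <= x <= b -> Rabs (f' x) <= M) -> Rabs (f b - f a) <= M * (b - a).
Proof.
  intros Hab Hd Hp. destruct (MVT_gen f a b f') as [c [Hc E]];
    rewrite ?Rmin_left, ?Rmax_right in * by lra.
  - intros x Hx. apply Hd. lra.
  - intros x Hx. apply continuity_pt_filterlim. apply (ex_derive_continuous f). eexists; apply Hd; lra.
  - rewrite E, Rabs_mult, (Rabs_right (b - a)) by lra. apply Rmult_le_compat_r; [lra|now apply Hp].
Qed.

Lemma is_derive_sum1 (f f' : nat -> R -> R) N x :
  (forall n, (1 <= n <= N)%nat -> is_derive (f n) x (f' n x)) ->
  is_derive (fun y => sum1 (fun n => f n y) N) x (sum1 (fun n => f' n x) N).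
Proof.
  induction N as [|N IH]; intros H; simpl.
  - apply (is_derive_const (K := R_AbsRing) (V := R_NormedModule) 0 x).
  - apply (is_derive_plus (fun y => sum1 (fun n => f n y) N) (f (S N)) x).
    + apply IH. intros; apply H; lia.
    + apply H; lia.
Qed.

Lemma one_minus_cos_bounds x : 0 <= 1 - cos x <= 2 /\ 1 - cos x <= x ^ 2 / 2.
Proof.
  pose proof (COS_bound x). split; [lra|].
  replace x with (2 * (x / 2)) at 1 by field. rewrite cos_2a_sin.
  assert (H1 : Rabs (sin (x / 2)) <= Rabs (x / 2)).
  { pose proof (derive_bounded_le sin cos 1) as M.
    destruct (Rle_lt_dec 0 (x / 2)) as [Hx|Hx].
    - specialize (M 0 (x / 2) Hx (fun y _ => is_derive_sin y)
        (fun y _ => Rabs_le _ _ (COS_bound y))).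
      rewrite sin_0 in M. rewrite (Rabs_right (x / 2)) by lra. replace (sin (x / 2)) with (sin (x / 2) - 0) by ring. lra.
    - specialize (M (x / 2) 0 (Rlt_le _ _ Hx) (fun y _ => is_derive_sin y)
        (fun y _ => Rabs_le _ _ (COS_bound y))).
      rewrite sin_0 in M. rewrite (Rabs_left (x / 2)) by lra.
      rewrite <- Rabs_Ropp. replace (- sin (x / 2)) with (0 - sin (x / 2)) by ring. lra. }
  apply Rsqr_le_abs_1 in H1. unfold Rsqr in H1. nra.
Qed.

Definition cos_sum (H : nat) (x : R) := sum1 (fun h => (1 - cos (INR h * x)) / INR h ^ 2) H.
Definition sin_sum (H : nat) (x : R) := sum1 (fun h => sin (INR h * x) / INR h) H.

Lemma is_derive_cos_sum H x : is_derive (cos_sum H) x (sin_sum H x).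
Proof.
  unfold cos_sum, sin_sum.
  apply (is_derive_sum1 (fun h x => (1 - cos (INR h * x)) / INR h ^ 2) (fun h x => sin (INR h * x) / INR h)).
  intros n Hn. assert (1 <= INR n) by (apply INR_ge_1; lia).
  auto_derive; [easy|]. field. lra.
Qed.

Lemma is_derive_sin_sum H x : is_derive (sin_sum H) x (sum1 (fun h => cos (INR h * x)) H).
Proof.
  unfold sin_sum.
  apply (is_derive_sum1 (fun h x => sin (INR h * x) / INR h) (fun h x => cos (INR h * x))).
  intros n Hn. assert (1 <= INR n) by (apply INR_ge_1; lia).
  auto_derive; [easy|]. field. lra.
Qed.

Lemma dirichlet_kernel H x :
  2 * sin (x / 2) * (1 / 2 + sum1 (fun h => cos (INR h * x)) H) = sin ((2 * INR H + 1) * (x / 2)).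
Proof.
  induction H as [|H IH].
  - simpl. replace ((2 * 0 + 1) * (x / 2)) with (x / 2) by ring. field.
  - change (sum1 ?g (S H)) with (sum1 g H + g (S H)). cbv beta.
    rewrite <- Rplus_assoc, Rmult_plus_distr_l, IH, !S_INR.
    replace ((2 * INR H + 1) * (x / 2)) with ((INR H + 1) * x - x / 2) by field.
    replace ((2 * (INR H + 1) + 1) * (x / 2)) with ((INR H + 1) * x + x / 2) by field.
    rewrite sin_minus, sin_plus. ring.
Qed.

(** The difference [sin_sum H x - (PI - x) / 2] vanishes at [PI] and its derivative is
    [sin (a x / 2) / (2 sin (x / 2))] with [a = 2 H + 1].  Adding
    [cos (a x / 2) / (a sin (x / 2))], as in an integration by parts, leaves a
    function [Phi] whose derivative is dominated by that of
    [Psi x = 1 / (a sin (x / 2))].  Monotonicity of [Psi - Phi] and [Psi + Phi] on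
    each side of [PI] gives [|Phi| <= Psi]. *)
Lemma sin_sum_sawtooth H x : 0 < x < 2 * PI ->
  Rabs (sin_sum H x - (PI - x) / 2) <= 2 / ((2 * INR H + 1) * sin (x / 2)).
Proof.
  intros Hx. set (a := 2 * INR H + 1). assert (Ha : 1 <= a) by (unfold a; pose proof (pos_INR H); lra).
  assert (Hs : forall y, 0 < y < 2 * PI -> 0 < sin (y / 2)) by (intros; apply sin_gt_0; lra).
  set (Phi := fun y => sin_sum H y - (PI - y) / 2 + cos (a * (y / 2)) / (a * sin (y / 2))).
  set (Psi := fun y => / (a * sin (y / 2))).
  assert (dPhi : forall y, 0 < y < 2 * PI ->
    is_derive Phi y (- (cos (a * (y / 2)) * cos (y / 2) / (2 * a * sin (y / 2) ^ 2)))).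
  { intros y Hy. specialize (Hs y Hy). unfold Phi.
    evar (l : R). assert (D : is_derive (fun y => - ((PI - y) / 2) + cos (a * (y / 2)) / (a * sin (y / 2))) y l).
    { unfold l. auto_derive; [|reflexivity]. nra. }
    pose proof (is_derive_plus _ _ y _ _ (is_derive_sin_sum H y) D) as D2.
    eapply is_derive_ext; [|replace (- (cos (a * (y / 2)) * cos (y / 2) / (2 * a * sin (y / 2) ^ 2)))
      with (plus (sum1 (fun h => cos (INR h * y)) H) l); [exact D2|]].
    - intros z. simpl. unfold plus; simpl. ring.
    - pose proof (dirichlet_kernel H y) as DK. fold a in DK. unfold plus; simpl. unfold l.
      set (C := sum1 (fun h => cos (INR h * y)) H) in *.
      assert (EC : C = sin (a * (y / 2)) / (2 * sin (y / 2)) - 1 / 2) by (rewrite <- DK; field; lra).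
      rewrite EC. change (y * / 2) with (y / 2). field. split; lra. }
  assert (dPsi : forall y, 0 < y < 2 * PI -> is_derive Psi y (- (cos (y / 2) / (2 * a * sin (y / 2) ^ 2)))).
  { intros y Hy. specialize (Hs y Hy). unfold Psi. auto_derive; [nra|].
    change (y * / 2) with (y / 2). field. split; lra. }
  assert (PhiPi : Phi PI = 0).
  { unfold Phi. replace (sin_sum H PI) with 0.
    - replace (a * (PI / 2)) with (PI / 2 + INR H * PI) by (unfold a; field).
      rewrite cos_plus, cos_PI2. replace (sin (INR H * PI)) with 0; [unfold Rdiv; ring|].
      symmetry. apply sin_eq_0_1. exists (Z.of_nat H). now rewrite <- INR_IZR_INZ.
    - symmetry. unfold sin_sum. rewrite (sum1_ext _ (fun _ => 0)), sum1_const; [ring|].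
      intros n _. replace (sin (INR n * PI)) with 0; [unfold Rdiv; ring|].
      symmetry. apply sin_eq_0_1. exists (Z.of_nat n). now rewrite <- INR_IZR_INZ. }
  assert (PsiPi : 0 < Psi PI).
  { unfold Psi. rewrite sin_PI2. apply Rinv_0_lt_compat. lra. }
  pose proof PI_RGT_0 as Hpi.
  assert (key : forall e, (e = 1 \/ e = -1) -> e * Phi x <= Psi x).
  { intros e He.
    assert (Hd : forall y, 0 < y < 2 * PI -> is_derive (fun y => Psi y - e * Phi y) y
       (- (cos (y / 2) * (1 - e * cos (a * (y / 2))) / (2 * a * sin (y / 2) ^ 2)))).
    { intros y Hy. specialize (Hs y Hy).
      pose proof (is_derive_minus Psi (fun z => e * Phi z) y _ _ (dPsi y Hy)
        (is_derive_scal Phi y e _ (dPhi y Hy))) as D.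
      eapply is_derive_ext; [|replace (- (cos (y / 2) * (1 - e * cos (a * (y / 2))) / (2 * a * sin (y / 2) ^ 2)))
        with (minus (- (cos (y / 2) / (2 * a * sin (y / 2) ^ 2))) (e * - (cos (a * (y / 2)) * cos (y / 2) / (2 * a * sin (y / 2) ^ 2))));
        [exact D|]].
      - intros z. reflexivity.
      - unfold minus, plus, opp; simpl. field. split; lra. }
    assert (Hsg : forall y, 0 < y < 2 * PI -> 0 <= (1 - e * cos (a * (y / 2))) / (2 * a * sin (y / 2) ^ 2)).
    { intros y Hy. specialize (Hs y Hy). apply Rdiv_le_0_compat.
      - pose proof (COS_bound (a * (y / 2))). destruct He; subst e; lra.
      - apply Rmult_lt_0_compat; [lra|]. now apply pow_lt. }
    assert (Psi PI - e * Phi PI <= Psi x - e * Phi x); [|rewrite PhiPi in *; lra].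
    destruct (Rle_lt_dec x PI) as [Hc|Hc].
    - pose proof (derive_nonneg_le (fun y => - (Psi y - e * Phi y))
        (fun y => - - (cos (y / 2) * (1 - e * cos (a * (y / 2))) / (2 * a * sin (y / 2) ^ 2))) x PI Hc) as M.
      assert (- (Psi x - e * Phi x) <= - (Psi PI - e * Phi PI)); [|lra]. apply M.
      + intros y Hy. apply (is_derive_opp (fun y => Psi y - e * Phi y)). apply Hd. lra.
      + intros y Hy. rewrite Ropp_involutive. unfold Rdiv in *. rewrite Rmult_assoc.
        apply Rmult_le_pos; [apply cos_ge_0; lra|apply Hsg; lra].
    - apply (derive_nonneg_le (fun y => Psi y - e * Phi y)
        (fun y => - (cos (y / 2) * (1 - e * cos (a * (y / 2))) / (2 * a * sin (y / 2) ^ 2)))); [lra| |].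
      + intros y Hy. apply Hd. lra.
      + intros y Hy. unfold Rdiv in *. rewrite Rmult_assoc, Ropp_mult_distr_l.
        apply Rmult_le_pos; [|apply Hsg; lra].
        assert (cos (y * / 2) <= 0); [apply cos_le_0; lra|lra]. }
  specialize (Hs x Hx).
  pose proof (key 1 (or_introl eq_refl)) as K1. pose proof (key (-1) (or_intror eq_refl)) as K2.
  unfold Phi in K1, K2. fold (Psi x). 
  assert (E : cos (a * (x / 2)) / (a * sin (x / 2)) = cos (a * (x / 2)) * Psi x) by reflexivity.
  rewrite E in *. replace (2 / (a * sin (x / 2))) with (2 * Psi x) by reflexivity.
  assert (0 < Psi x) by (unfold Psi; apply Rinv_0_lt_compat; nra).
  pose proof (COS_bound (a * (x / 2))). apply Rabs_le. split; nra.
Qed.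

Lemma cos_sum_tail H K x : (1 <= H)%nat ->
  0 <= cos_sum (H + K) x - cos_sum H x <= 2 / INR H.
Proof.
  intros HH. unfold cos_sum. rewrite sum1_add.
  match goal with |- 0 <= ?A + ?B - ?A <= _ => replace (A + B - A) with B by ring end.
  split.
  - apply sum1_nonneg. intros n Hn. apply Rdiv_le_0_compat; [apply one_minus_cos_bounds|].
    apply pow_lt, lt_0_INR. lia.
  - apply Rle_trans with (2 * sum1 (fun k => / INR (H + k) ^ 2) K).
    + rewrite <- sum1_scal. apply sum1_le. intros n Hn. unfold Rdiv. apply Rmult_le_compat_r.
      * apply Rlt_le, Rinv_0_lt_compat, pow_lt, lt_0_INR. lia.
      * apply one_minus_cos_bounds.
    + pose proof (sum1_inv_sq_tail H K HH).
      assert (0 < / INR (H + K)) by (apply Rinv_0_lt_compat, lt_0_INR; lia). lra.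
Qed.

Lemma cos_sum_small H x : cos_sum H x <= INR H * x ^ 2 / 2.
Proof.
  unfold cos_sum. replace (INR H * x ^ 2 / 2) with (INR H * (x ^ 2 / 2)) by field.
  rewrite <- sum1_const. apply sum1_le. intros n Hn. assert (1 <= INR n) by (apply INR_ge_1; lia).
  apply Rle_div_l; [apply pow_lt; lra|]. pose proof (one_minus_cos_bounds (INR n * x)) as [_ B].
  rewrite Rpow_mult_distr in B. lra.
Qed.

Lemma cos_sum_nonneg H x : 0 <= cos_sum H x.
Proof.
  apply sum1_nonneg. intros n Hn. apply Rdiv_le_0_compat; [apply one_minus_cos_bounds|].
  apply pow_lt, lt_0_INR. lia.
Qed.

(** The derivative of [cos_sum H] minus the parabola is the error of
    [sin_sum_sawtooth], which is small away from the multiples of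
    [2 PI]; hence the values at [x] and at a point [d] near 0 almost agree, and at [d] both functions are small. *)
Lemma cos_sum_limit x : 0 < x < 2 * PI ->
  forall eps, 0 < eps -> exists H0, forall H, (H0 <= H)%nat ->
    Rabs (cos_sum H x - (PI * x / 2 - x ^ 2 / 4)) <= eps.
Proof.
  intros Hx eps He.
  (* At [d], the first [K] terms sum to at most [K d^2 / 2] and the others to [2 / K]. *)
  destruct (nfloor_ex (16 / eps)) as [K0 HK0]; [apply Rdiv_le_0_compat; lra|].
  set (K := S K0). assert (HK : 16 / eps < INR K) by (unfold K; rewrite S_INR; lra).
  assert (HK1 : 1 <= INR K) by (apply INR_ge_1; unfold K; lia).
  set (d := Rmin (x / 2) (Rmin 1 (eps / (16 * INR K)))).
  assert (Hd : 0 < d <= x / 2 /\ d <= 1 /\ d <= eps / (16 * INR K)).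
  { unfold d. repeat split.
    - repeat apply Rmin_pos; try lra. apply Rdiv_lt_0_compat; lra.
    - apply Rmin_l.
    - eapply Rle_trans; [apply Rmin_r|apply Rmin_l].
    - eapply Rle_trans; [apply Rmin_r|apply Rmin_r]. }
  destruct Hd as [[Hd0 Hd1] [Hd2 Hd3]].
  assert (HdK : d * INR K <= eps / 16).
  { apply (Rmult_le_compat_r (INR K)) in Hd3; [|lra].
    replace (eps / (16 * INR K) * INR K) with (eps / 16) in Hd3 by (field; lra). exact Hd3. }
  assert (HKe : 2 / INR K <= eps / 8).
  { apply Rle_div_l; [lra|]. apply Rlt_le in HK. apply Rle_div_l in HK; [|lra]. lra. }
  set (c := Rmin (sin (d / 2)) (sin (x / 2))).
  assert (Hc0 : 0 < c) by (apply Rmin_pos; apply sin_gt_0; lra).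
  destruct (nfloor_ex (64 / (c * eps))) as [H1 HH1]; [apply Rdiv_le_0_compat; nra|].
  exists (Nat.max K (S H1)). intros H HH.
  assert (HHr : 64 / (c * eps) < INR H).
  { assert (INR (S H1) <= INR H) by (apply le_INR; lia). rewrite S_INR in *. lra. }
  assert (Hpi : PI <= 4) by apply PI_4. pose proof PI_RGT_0.
  set (D := fun y => cos_sum H y - (PI * y / 2 - y ^ 2 / 4)).
  assert (HD : Rabs (D x - D d) <= 2 / (INR H * c) * (x - d)).
  { apply (derive_bounded_le D (fun y => sin_sum H y - (PI - y) / 2)); [lra| |].
    - intros y Hy. unfold D.
      evar (l : R). assert (DD : is_derive (fun y => PI * y / 2 - y ^ 2 / 4) y l).
      { unfold l. auto_derive; [easy|reflexivity]. }
      pose proof (is_derive_minus _ _ y _ _ (is_derive_cos_sum H y) DD) as D2.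
      replace (sin_sum H y - (PI - y) / 2) with (minus (sin_sum H y) l); [exact D2|].
      unfold minus, plus, opp, l; simpl. field.
    - intros y Hy. eapply Rle_trans; [apply sin_sum_sawtooth; lra|].
      assert (Hcy : c <= sin (y / 2)).
      { destruct (Rle_lt_dec y PI).
        - eapply Rle_trans; [apply Rmin_l|]. apply sin_incr_1; lra.
        - eapply Rle_trans; [apply Rmin_r|]. apply sin_decr_1; lra. }
      assert (1 <= INR H) by (apply INR_ge_1; lia).
      unfold Rdiv. apply Rmult_le_compat_l; [lra|]. apply Rinv_le_contravar; nra. }
  assert (HD2 : 2 / (INR H * c) * (x - d) <= eps / 4).
  { assert (0 < INR H) by (apply lt_0_INR; lia).
    replace (2 / (INR H * c) * (x - d)) with (2 * (x - d) / (INR H * c)) by (field; lra).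
    apply Rle_div_l; [nra|]. apply Rlt_le in HHr. apply Rle_div_l in HHr; [|nra]. nra. }
  assert (HDd : Rabs (D d) <= eps / 2).
  { unfold D. replace H with (K + (H - K))%nat by lia.
    pose proof (cos_sum_tail K (H - K) d ltac:(unfold K; lia)).
    pose proof (cos_sum_small K d). pose proof (cos_sum_nonneg K d).
    assert (d <= d * INR K) by nra. assert (0 <= d ^ 2 <= d) by nra.
    assert (INR K * d ^ 2 <= eps / 16) by nra.
    apply Rabs_le. split; nra. }
  change (Rabs (D x) <= eps). replace (D x) with (D x - D d + D d) by ring.
  eapply Rle_trans; [apply Rabs_triang|]. lra.
Qed.

(** The tail of the series beyond [H] is at most [2 / H] whatever [v] is, so the
    limit alone gives a rate that is uniform in [v], although the convergence of
    the derivatives deteriorates near the integers. *)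
Lemma cos_sum_parabola v H : 0 <= v ->
  Rabs (cos_sum H (2 * PI * v) - PI ^ 2 * parabola v) <= 4 / (INR H + 1).
Proof.
  intros Hv. destruct (nat_floor v Hv) as [q Hq]. destruct (base_fp v) as [F0 F1].
  unfold parabola. set (f := frac_part v) in *. clearbody f.
  assert (Ep : cos_sum H (2 * PI * v) = cos_sum H (2 * PI * f)).
  { unfold cos_sum. apply sum1_ext. intros n _. rewrite Hq.
    replace (INR n * (2 * PI * (INR q + f))) with (INR n * (2 * PI * f) + 2 * INR (n * q) * PI)
      by (rewrite mult_INR; ring). now rewrite cos_period. }
  rewrite Ep. pose proof PI_RGT_0. pose proof PI_4. pose proof (pos_INR H) as HH.
  assert (Hq4 : 0 <= f * (1 - f) <= / 4) by (split; [nra|pose proof (pow2_ge_0 (f - / 2)); lra]).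
  destruct H as [|H].
  { unfold cos_sum; simpl. rewrite Rminus_0_l, Rabs_Ropp, Rabs_right by nra. nra. }
  destruct (Req_dec f 0) as [->|Hf].
  { replace (cos_sum (S H) (2 * PI * 0)) with 0.
    - replace (0 - PI ^ 2 * (0 * (1 - 0))) with 0 by ring. rewrite Rabs_R0. apply Rdiv_le_0_compat; lra.
    - symmetry. unfold cos_sum. rewrite (sum1_ext _ (fun _ => 0)), sum1_const; [ring|].
      intros n _. replace (INR n * (2 * PI * 0)) with 0 by ring. rewrite cos_0. unfold Rdiv. ring. }
  assert (Hx : 0 < 2 * PI * f < 2 * PI) by nra.
  apply Rle_trans with (2 / INR (S H)).
  2:{ assert (1 <= INR (S H)) by (apply INR_ge_1; lia).
      apply Rle_div_l; [lra|]. replace (4 / (INR (S H) + 1) * INR (S H)) with (4 * INR (S H) / (INR (S H) + 1)) by (field; lra).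
      apply Rle_div_r; lra. }
  apply Rnot_lt_le. intros Hlt.
  set (gap := Rabs (cos_sum (S H) (2 * PI * f) - PI ^ 2 * (f * (1 - f))) - 2 / INR (S H)).
  destruct (cos_sum_limit _ Hx (gap / 2)) as [K0 HK0]; [unfold gap; lra|].
  specialize (HK0 (S H + K0)%nat ltac:(lia)).
  replace (PI * (2 * PI * f) / 2 - (2 * PI * f) ^ 2 / 4) with (PI ^ 2 * (f * (1 - f))) in HK0 by field.
  pose proof (cos_sum_tail (S H) K0 (2 * PI * f) ltac:(lia)) as Ht.
  assert (Rabs (cos_sum (S H) (2 * PI * f) - PI ^ 2 * (f * (1 - f))) <= gap / 2 + 2 / INR (S H)).
  { eapply Rle_trans; [|apply Rplus_le_compat; [exact HK0|apply Rle_refl]].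
    unfold Rabs at 1; destruct Rcase_abs; unfold Rabs; destruct Rcase_abs; lra. }
  unfold gap in *. lra.
Qed.

(** * The off-diagonal terms *)

Lemma cos_lipschitz a b : Rabs (cos a - cos b) <= Rabs (a - b).
Proof.
  assert (K : forall u v, u <= v -> Rabs (cos v - cos u) <= v - u).
  { intros u v Huv. rewrite <- (Rmult_1_l (v - u)).
    apply (derive_bounded_le cos (fun y => - sin y)); [exact Huv| |].
    - intros; apply is_derive_cos.
    - intros. rewrite Rabs_Ropp. apply Rabs_le, SIN_bound. }
  destruct (Rle_lt_dec a b) as [H|H].
  - rewrite Rabs_minus_sym, (Rabs_minus_sym a), (Rabs_right (b - a)) by lra. now apply K.
  - rewrite (Rabs_right (a - b)) by lra. apply K. lra.
Qed.

(** [ln x = 2 artanh ((x - 1) / (x + 1))], and [artanh y >= y]. *)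
Lemma ln_ge_artanh x : 1 <= x -> 2 * (x - 1) / (x + 1) <= ln x.
Proof.
  intros Hx. pose proof (derive_nonneg_le (fun x => ln x - 2 * (x - 1) / (x + 1))
    (fun x => (x - 1) ^ 2 / (x * (x + 1) ^ 2)) 1 x Hx) as M. cbv beta in M.
  rewrite ln_1 in M.
  assert (0 - 2 * (1 - 1) / (1 + 1) <= ln x - 2 * (x - 1) / (x + 1)); [|lra]. apply M.
  - intros y Hy. auto_derive; [lra|]. field. lra.
  - intros y Hy. apply Rdiv_le_0_compat; [apply pow2_ge_0|]. nra.
Qed.

(** [ln r = arsinh ((r - 1 / r) / 2)], and [arsinh y <= y]. *)
Lemma ln_le_arsinh r : 1 <= r -> 2 * ln r <= r - / r.
Proof.
  intros Hx. pose proof (derive_nonneg_le (fun x => x - / x - 2 * ln x)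
    (fun x => (x - 1) ^ 2 / x ^ 2) 1 r Hx) as M. cbv beta in M.
  rewrite ln_1 in M.
  assert (1 - / 1 - 2 * 0 <= r - / r - 2 * ln r); [|lra]. apply M.
  - intros y Hy. auto_derive; [lra|]. field. lra.
  - intros y Hy. apply Rdiv_le_0_compat; [apply pow2_ge_0|]. nra.
Qed.

Lemma ln_1p_bounds x : 0 <= x -> x - x ^ 2 / 2 <= ln (1 + x) <= x.
Proof.
  intros Hx. split.
  - pose proof (derive_nonneg_le (fun x => ln (1 + x) - (x - x ^ 2 / 2))
      (fun x => x ^ 2 / (1 + x)) 0 x Hx) as M. cbv beta in M.
    rewrite Rplus_0_r, ln_1 in M.
    assert (0 - (0 - 0 ^ 2 / 2) <= ln (1 + x) - (x - x ^ 2 / 2)); [|lra]. apply M.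
    + intros y Hy. auto_derive; [lra|]. field. lra.
    + intros y Hy. apply Rdiv_le_0_compat; [apply pow2_ge_0|]. lra.
  - pose proof (exp_ineq1_le (ln (1 + x))) as E. rewrite exp_ln in E; lra.
Qed.

(** With [l = ln (b / a)] one has [(b - a) / sqrt (a b) = 2 sinh (l / 2)] and
    [(b - a) / (b + a) = tanh (l / 2)].  So the bounds are [sinh y >= y] and
    [tanh y <= y], and [((a + b) / 2)^2 = a b + ((b - a) / 2)^2] makes their gap
    equal to [1 / 4].  The transcendental weight [1 / l^2] can therefore be replaced
    by an arithmetic one at a bounded cost, uniformly in [a] and [b]. *)
Lemma inv_ln_sq_bounds a b : 0 < a < b ->
  0 <= / ln (b / a) ^ 2 - a * b / (b - a) ^ 2 <= / 4.
Proof.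
  intros [Ha Hab]. set (l := ln (b / a)).
  assert (Hba : 1 < b / a) by (apply Rlt_div_r; lra).
  assert (Hl : 0 < l) by (unfold l; rewrite <- ln_1; apply ln_increasing; lra).
  assert (L1 : 2 * (b - a) <= l * (b + a)).
  { pose proof (ln_ge_artanh (b / a) ltac:(lra)) as H. fold l in H.
    replace (2 * (b / a - 1) / (b / a + 1)) with (2 * (b - a) / (b + a)) in H by (field; lra).
    apply Rle_div_l in H; lra. }
  assert (L2 : l ^ 2 * (a * b) <= (b - a) ^ 2).
  { set (r := sqrt (b / a)). assert (Hr2 : r * r = b / a) by (apply sqrt_sqrt; lra).
    assert (Hr : 1 <= r) by (unfold r; rewrite <- sqrt_1; apply sqrt_le_1_alt; lra).
    pose proof (ln_le_arsinh r Hr) as H.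
    assert (E : l = 2 * ln r) by (unfold l; rewrite <- Hr2, ln_mult by lra; ring).
    rewrite <- E in H.
    assert (H2 : l ^ 2 <= (r - / r) ^ 2) by (apply pow_incr; lra).
    replace ((r - / r) ^ 2) with (r * r - 2 + / (r * r)) in H2 by (field; lra).
    rewrite Hr2 in H2. replace (b / a - 2 + / (b / a)) with ((b - a) ^ 2 / (a * b)) in H2 by (field; lra).
    apply Rle_div_r in H2; nra. }
  assert (Hl2 : 0 < l ^ 2) by (apply pow_lt, Hl). assert (Hd : 0 < (b - a) ^ 2) by (apply pow_lt; lra).
  split.
  - apply -> Rminus_le_0. apply Rle_div_l; [exact Hd|].
    apply Rmult_le_reg_l with (l ^ 2); [exact Hl2|]. replace (l ^ 2 * (/ l ^ 2 * (b - a) ^ 2)) with ((b - a) ^ 2) by (field; lra). lra.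
  - assert (H4 : 4 * (b - a) ^ 2 <= l ^ 2 * (b + a) ^ 2).
    { replace (4 * (b - a) ^ 2) with ((2 * (b - a)) ^ 2) by ring. rewrite <- Rpow_mult_distr.
      apply pow_incr. lra. }
    assert (/ l ^ 2 <= (b + a) ^ 2 / (4 * (b - a) ^ 2)).
    { apply Rle_div_r; [lra|]. rewrite Rmult_comm. apply Rle_div_l; [exact Hl2|]. lra. }
    replace (/ 4) with ((b + a) ^ 2 / (4 * (b - a) ^ 2) - a * b / (b - a) ^ 2) by (field; lra). lra.
Qed.

Lemma sum1_rev f N : sum1 (fun m => f (N - m + 1)%nat) N = sum1 f N.
Proof.
  revert f. induction N as [|N IH]; intros f; [reflexivity|].
  transitivity (sum1 f (1 + N)); [rewrite sum1_add|reflexivity].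
  change (sum1 f 1) with (0 + f 1%nat).
  change (sum1 ?g (S N)) with (sum1 g N + g (S N)). cbv beta.
  replace (S N - S N + 1)%nat with 1%nat by lia.
  rewrite <- (IH (fun k => f (1 + k)%nat)).
  rewrite (sum1_ext (fun m => f (S N - m + 1)%nat) (fun m => f (1 + (N - m + 1))%nat)).
  - ring.
  - intros n Hn. f_equal. lia.
Qed.

(** Here [a] will come from a Taylor bound and [b / h^2] from a trivial one; [H] is
    where one passes from the first to the second. *)
Lemma sum1_two_bounds e a b H K : (1 <= H)%nat -> 0 <= a -> 0 <= b ->
  (forall h, (1 <= h <= K)%nat -> e h <= a) ->
  (forall h, (1 <= h <= K)%nat -> e h <= b / INR h ^ 2) ->
  sum1 e K <= INR H * a + b / INR H.
Proof.
  intros HH Ha Hb H1 H2. assert (1 <= INR H) by (apply INR_ge_1, HH).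
  assert (0 <= b / INR H) by (apply Rdiv_le_0_compat; lra).
  destruct (le_lt_dec K H) as [C|C].
  - apply Rle_trans with (INR K * a).
    + rewrite <- sum1_const. now apply sum1_le.
    + assert (INR K <= INR H) by (apply le_INR, C). nra.
  - rewrite (sum1_split e H K) by lia. apply Rplus_le_compat.
    + rewrite <- sum1_const. apply sum1_le. intros; apply H1; lia.
    + apply Rle_trans with (b * sum1 (fun k => / INR (H + k) ^ 2) (K - H)).
      * rewrite <- sum1_scal. apply sum1_le. intros n Hn. apply H2. lia.
      * unfold Rdiv. apply Rmult_le_compat_l; [exact Hb|].
        pose proof (sum1_inv_sq_tail H (K - H) HH).
        assert (0 < / INR (H + (K - H))) by (apply Rinv_0_lt_compat, lt_0_INR; lia). lra.
Qed.

(** The terms [n^(-s)], [m^(-s)] with [n = m + h] of a squared partial sum at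
    [s = 1/2 + it], averaged in [t] with the weight [T - t]; see [is_RInt_fejer_cos]. *)
Definition off_diagonal (T : R) (N : nat) : R :=
  sum1 (fun m => sum1 (fun h =>
    / (sqrt (INR m) * sqrt (INR (m + h))) *
      ((1 - cos (T * ln (INR (m + h) / INR m))) / ln (INR (m + h) / INR m) ^ 2)) (N - m)) N.

(** For fixed [m], four replacements lead to the parabola: [1 / l^2] by
    [m (m + h) / h^2] where [l = ln ((m + h) / m)], then [sqrt (m (m + h))] by [m],
    then [T l] by [T h / m] (accurate for [h <= H], trivial beyond), and finally the
    sum over [h <= N - m] by the full Fourier series. *)
Lemma off_diagonal_asymp T N H : 0 <= T -> (1 <= N)%nat -> (1 <= H)%nat ->
  Rabs (off_diagonal T N - PI ^ 2 * sum1 (fun m => INR m * parabola (T / (2 * PI) / INR m)) N)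
  <= 2 * INR N + 5 * INR N * harmonic N + INR H * T / 2 * harmonic N + 2 * INR N ^ 2 / INR H.
Proof.
  intros HT HN HH. assert (HN1 : 1 <= INR N) by (apply INR_ge_1, HN).
  assert (HH1 : 1 <= INR H) by (apply INR_ge_1, HH). pose proof PI_RGT_0 as Hpi.
  assert (Hharm : forall K, 0 <= harmonic K).
  { intros K. apply sum1_nonneg. intros n Hn. apply Rlt_le, Rinv_0_lt_compat, lt_0_INR. lia. }
  rewrite <- sum1_scal. unfold off_diagonal.
  eapply Rle_trans.
  { apply (sum1_dist _ _ (fun m =>
      sqrt (INR N) * / sqrt (INR m) + harmonic N + (INR H * T / 2 * / INR m + 2 * INR N / INR H)
      + 4 * INR N * / INR (N - m + 1))).
    intros m Hm. assert (Hm1 : 1 <= INR m) by (apply INR_ge_1; lia).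
    assert (HmN : INR m <= INR N) by (apply le_INR; lia).
    set (K := (N - m)%nat).
    assert (Hln : forall h, (1 <= h)%nat -> let x := INR h / INR m in
       ln (INR (m + h) / INR m) = ln (1 + x)).
    { intros h Hh x. f_equal. unfold x. rewrite plus_INR. field. lra. }
    set (A1 := fun h => sqrt (INR m * INR (m + h)) * (1 - cos (T * ln (INR (m + h) / INR m))) / INR h ^ 2).
    set (A2 := fun h => INR m * (1 - cos (T * ln (INR (m + h) / INR m))) / INR h ^ 2).
    set (A3 := fun h => INR m * ((1 - cos (INR h * (T / INR m))) / INR h ^ 2)).
    set (A0 := fun h => / (sqrt (INR m) * sqrt (INR (m + h))) *
      ((1 - cos (T * ln (INR (m + h) / INR m))) / ln (INR (m + h) / INR m) ^ 2)).
    assert (D1 : Rabs (sum1 A0 K - sum1 A1 K) <= sqrt (INR N) * / sqrt (INR m)).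
    { eapply Rle_trans.
      - apply (sum1_dist _ _ (fun h => / 2 * / sqrt (INR m) * / sqrt (INR (m + h)))).
        intros h Hh. unfold A0, A1. assert (Hh1 : 1 <= INR h) by (apply INR_ge_1; lia).
        set (a := INR m) in *. assert (Eb : INR (m + h) = a + INR h) by apply plus_INR. rewrite Eb.
        set (b := a + INR h). assert (Hb : a < b) by (unfold b; lra).
        assert (Sa : sqrt a * sqrt a = a) by (apply sqrt_sqrt; lra).
        assert (Sb : sqrt b * sqrt b = b) by (apply sqrt_sqrt; lra).
        assert (Pa : 0 < sqrt a) by (apply sqrt_lt_R0; lra). assert (Pb : 0 < sqrt b) by (apply sqrt_lt_R0; lra).
        rewrite sqrt_mult by lra. pose proof (inv_ln_sq_bounds a b ltac:(lra)) as [B1 B2].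
        replace (b - a) with (INR h) in * by (unfold b; ring).
        set (c := 1 - cos (T * ln (b / a))). assert (Hc : 0 <= c <= 2) by apply one_minus_cos_bounds.
        replace (/ (sqrt a * sqrt b) * (c / ln (b / a) ^ 2) - sqrt a * sqrt b * c / INR h ^ 2)
          with (c * (/ sqrt a * / sqrt b) * (/ ln (b / a) ^ 2 - a * b / INR h ^ 2)).
        + assert (0 < / sqrt a * / sqrt b) by (apply Rmult_lt_0_compat; apply Rinv_0_lt_compat; lra).
          rewrite Rabs_right by (apply Rle_ge; apply Rmult_le_pos; [apply Rmult_le_pos|]; lra).
          rewrite Rmult_assoc. set (w := / sqrt a * / sqrt b) in *.
          replace (/ 2 * / sqrt a * / sqrt b) with (2 * (w * / 4)) by (unfold w; field; lra).
          apply Rmult_le_compat; [lra| |lra|]; [apply Rmult_le_pos; lra|apply Rmult_le_compat_l; lra].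
        + assert (Hw : ln (b / a) <> 0).
          { apply Rgt_not_eq. rewrite <- ln_1. apply ln_increasing; [lra|]. apply Rlt_div_r; lra. }
          replace (a * b) with (sqrt a * sqrt a * (sqrt b * sqrt b)) by (rewrite Sa, Sb; ring).
          clear - Hw Pa Pb Hh1. set (u := sqrt a) in *. set (v := sqrt b) in *. set (w := ln (b / a)) in *.
          field. repeat split; first [exact Hw | lra].
      - rewrite sum1_scal. pose proof (sum1_inv_sqrt N) as B. rewrite (sum1_split _ m N) in B by lia.
        fold K in B. assert (0 <= sum1 (fun n => / sqrt (INR n)) m).
        { apply sum1_nonneg. intros n Hn. apply Rlt_le, Rinv_0_lt_compat, sqrt_lt_R0, lt_0_INR. lia. }
        assert (0 < / sqrt (INR m)) by (apply Rinv_0_lt_compat, sqrt_lt_R0; lra). nra. }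
    assert (D2 : Rabs (sum1 A1 K - sum1 A2 K) <= harmonic N).
    { eapply Rle_trans.
      - apply (sum1_dist _ _ (fun h => / INR h)).
        intros h Hh. unfold A1, A2. assert (Hh1 : 1 <= INR h) by (apply INR_ge_1; lia).
        rewrite plus_INR. set (a := INR m) in *. set (x := INR h) in *.
        set (c := 1 - cos (T * ln ((a + x) / a))). assert (Hc : 0 <= c <= 2) by apply one_minus_cos_bounds.
        set (s := sqrt (a * (a + x))).
        assert (Hs : a <= s <= a + x / 2).
        { unfold s. split.
          - rewrite <- (sqrt_square a) at 1 by lra. apply sqrt_le_1_alt. nra.
          - rewrite <- (sqrt_square (a + x / 2)) by lra. apply sqrt_le_1_alt. nra. }
        replace (s * c / x ^ 2 - a * c / x ^ 2) with ((s - a) * c / x ^ 2) by (field; lra).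
        rewrite Rabs_right.
        + apply Rle_div_l; [apply pow_lt; lra|]. replace (/ x * x ^ 2) with x by (field; lra).
          apply Rle_trans with (x / 2 * 2); [apply Rmult_le_compat; lra|lra].
        + apply Rle_ge, Rdiv_le_0_compat; [nra|apply pow_lt; lra].
      - change (harmonic K <= harmonic N). unfold harmonic. rewrite (sum1_split _ K N) by (unfold K; lia).
        assert (0 <= sum1 (fun k => / INR (K + k)) (N - K)); [|lra].
        apply sum1_nonneg. intros n Hn. apply Rlt_le, Rinv_0_lt_compat, lt_0_INR. lia. }
    assert (D3 : Rabs (sum1 A2 K - sum1 A3 K) <= INR H * T / 2 * / INR m + 2 * INR N / INR H).
    { eapply Rle_trans.
      - apply (sum1_dist _ _ (fun h => Rabs (A2 h - A3 h))). intros; apply Rle_refl.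
      - apply Rle_trans with (INR H * (T / 2 * / INR m) + 2 * INR m / INR H).
        2:{ replace (INR H * (T / 2 * / INR m)) with (INR H * T / 2 * / INR m) by (field; lra).
            apply Rplus_le_compat_l. unfold Rdiv. apply Rmult_le_compat_r; [|lra].
            apply Rlt_le, Rinv_0_lt_compat; lra. }
        assert (E : forall h, (1 <= h)%nat -> A2 h - A3 h =
          INR m / INR h ^ 2 * (cos (T * (INR h / INR m)) - cos (T * ln (1 + INR h / INR m)))).
        { intros h Hh. unfold A2, A3. assert (1 <= INR h) by (apply INR_ge_1; lia).
          rewrite (Hln h Hh). replace (INR h * (T / INR m)) with (T * (INR h / INR m)) by (field; lra).
          field. lra. }
        apply sum1_two_bounds; [exact HH| |lra| |].
        + assert (0 < / INR m) by (apply Rinv_0_lt_compat; lra). nra.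
        + intros h Hh. rewrite E by lia. assert (Hh1 : 1 <= INR h) by (apply INR_ge_1; lia).
          assert (Hx : 0 <= INR h / INR m) by (apply Rdiv_le_0_compat; lra).
          pose proof (ln_1p_bounds _ Hx) as L. rewrite Rabs_mult.
          assert (P : 0 < INR m / INR h ^ 2) by (apply Rdiv_lt_0_compat; [lra|apply pow_lt; lra]).
          rewrite (Rabs_right (INR m / _)) by lra.
          apply Rle_trans with (INR m / INR h ^ 2 * (T * ((INR h / INR m) ^ 2 / 2))).
          * apply Rmult_le_compat_l; [lra|]. eapply Rle_trans; [apply cos_lipschitz|].
            rewrite <- Rmult_minus_distr_l, Rabs_mult, (Rabs_right T) by lra.
            apply Rmult_le_compat_l; [lra|]. apply Rabs_le. lra.
          * right. field. lra.
        + intros h Hh. rewrite E by lia. assert (Hh1 : 1 <= INR h) by (apply INR_ge_1; lia).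
          rewrite Rabs_mult.
          assert (P : 0 < INR m / INR h ^ 2) by (apply Rdiv_lt_0_compat; [lra|apply pow_lt; lra]).
          rewrite (Rabs_right (INR m / _)) by lra.
          replace (2 * INR m / INR h ^ 2) with (INR m / INR h ^ 2 * 2) by (field; lra).
          apply Rmult_le_compat_l; [lra|].
          pose proof (COS_bound (T * (INR h / INR m))). pose proof (COS_bound (T * ln (1 + INR h / INR m))).
          apply Rabs_le. lra. }
    assert (D4 : Rabs (sum1 A3 K - PI ^ 2 * (INR m * parabola (T / (2 * PI) / INR m)))
        <= 4 * INR N * / INR (N - m + 1)).
    { unfold A3. rewrite sum1_scal.
      pose proof (cos_sum_parabola (T / (2 * PI) / INR m) K) as B.
      replace (2 * PI * (T / (2 * PI) / INR m)) with (T / INR m) in B by (field; lra).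
      replace (sum1 (fun h => (1 - cos (INR h * (T / INR m))) / INR h ^ 2) K) with (cos_sum K (T / INR m)) by reflexivity.
      rewrite <- (Rmult_assoc (PI ^ 2)), (Rmult_comm (PI ^ 2)), (Rmult_assoc (INR m)), <- Rmult_minus_distr_l, Rabs_mult, (Rabs_right (INR m)) by lra.
      rewrite plus_INR. fold K. change (INR 1) with 1.
      assert (Hp : 0 < / (INR K + 1)) by (apply Rinv_0_lt_compat; pose proof (pos_INR K); lra).
      apply Rle_trans with (INR m * (4 / (INR K + 1))).
      - apply Rmult_le_compat_l; [lra|]. apply B. repeat apply Rdiv_le_0_compat; lra.
      - unfold Rdiv. nra. }
    replace (sum1 A0 K - PI ^ 2 * (INR m * parabola (T / (2 * PI) / INR m))) with
      ((sum1 A0 K - sum1 A1 K) + (sum1 A1 K - sum1 A2 K) + (sum1 A2 K - sum1 A3 K)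
       + (sum1 A3 K - PI ^ 2 * (INR m * parabola (T / (2 * PI) / INR m)))) by ring.
    eapply Rle_trans; [apply Rabs_triang|]. apply Rplus_le_compat; [|exact D4].
    eapply Rle_trans; [apply Rabs_triang|]. apply Rplus_le_compat; [|exact D3].
    eapply Rle_trans; [apply Rabs_triang|]. apply Rplus_le_compat; assumption. }
  rewrite !sum1_plus, !sum1_scal, !sum1_const.
  rewrite (sum1_rev (fun n => / INR n) N). fold (harmonic N).
  pose proof (sum1_inv_sqrt N) as B. pose proof (sqrt_pos (INR N)).
  pose proof (sqrt_sqrt (INR N) ltac:(lra)) as E.
  assert (sqrt (INR N) * sum1 (fun n => / sqrt (INR n)) N <= 2 * INR N) by nra.
  replace (2 * INR N ^ 2 / INR H) with (INR N * (2 * INR N / INR H)) by (field; lra). lra.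
Qed.

(** * Mean values of the partial sums and of the pole term *)

Lemma is_RInt_sum1 (f : nat -> R -> R) (I : nat -> R) a b N :
  (forall n, (1 <= n <= N)%nat -> is_RInt (f n) a b (I n)) ->
  is_RInt (fun t => sum1 (fun n => f n t) N) a b (sum1 I N).
Proof.
  induction N as [|N IH]; intros H; simpl.
  - pose proof (is_RInt_const a b 0) as K.
    unfold scal in K; simpl in K; unfold mult in K; simpl in K. now rewrite Rmult_0_r in K.
  - apply (is_RInt_plus (fun t => sum1 (fun n => f n t) N) (f (S N))).
    + apply IH. intros; apply H; lia.
    + apply H; lia.
Qed.

Lemma continuous_of_derive (f : R -> R) x : ex_derive f x -> continuous f x.
Proof. apply (ex_derive_continuous f x). Qed.

Lemma ex_RInt_of_continuous (f : R -> R) a b : (forall t, continuous f t) -> ex_RInt f a b.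
Proof. intros H. apply (ex_RInt_continuous f). intros; apply H. Qed.

Lemma ex_RInt_of_derive (f : R -> R) a b : (forall t, ex_derive f t) -> ex_RInt f a b.
Proof. intros H. apply ex_RInt_of_continuous. intros; apply continuous_of_derive, H. Qed.

Lemma is_RInt_derive_R (f df : R -> R) a b : a <= b ->
  (forall x, a <= x <= b -> is_derive f x (df x)) ->
  (forall x, a <= x <= b -> continuous df x) ->
  is_RInt df a b (f b - f a).
Proof.
  intros Hab H1 H2. apply (is_RInt_derive f df a b);
    intros x Hx; rewrite ?Rmin_left, ?Rmax_right in Hx by lra; auto.
Qed.

Lemma is_RInt_fejer_cos T l : 0 <= T -> l <> 0 ->
  is_RInt (fun t => (T - t) * cos (t * l)) 0 T ((1 - cos (T * l)) / l ^ 2).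
Proof.
  intros HT Hl.
  replace ((1 - cos (T * l)) / l ^ 2) with
    (((T - T) * sin (T * l) / l - cos (T * l) / l ^ 2) - ((T - 0) * sin (0 * l) / l - cos (0 * l) / l ^ 2)).
  - apply (is_RInt_derive_R (fun t => (T - t) * sin (t * l) / l - cos (t * l) / l ^ 2)); [exact HT| |].
    + intros x _. auto_derive; [easy|]. field. exact Hl.
    + intros x _. apply continuous_of_derive. auto_derive. easy.
  - rewrite Rmult_0_l, sin_0, cos_0. field. exact Hl.
Qed.

Lemma is_RInt_fejer T : 0 <= T -> is_RInt (fun t => T - t) 0 T (T ^ 2 / 2).
Proof.
  intros HT. replace (T ^ 2 / 2) with ((T * T - T ^ 2 / 2) - (T * 0 - 0 ^ 2 / 2)) by field.
  apply (is_RInt_derive_R (fun t => T * t - t ^ 2 / 2)); [exact HT| |].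
  - intros x _. auto_derive; [easy|]. field.
  - intros x _. apply continuous_of_derive. auto_derive. easy.
Qed.

(** [partial_re] and [partial_im] are the parts of [sum_(n <= N) n^(-1/2 - it)]. *)
Definition partial_re N t := sum1 (fun n => / sqrt (INR n) * cos (t * ln (INR n))) N.
Definition partial_im N t := - sum1 (fun n => / sqrt (INR n) * sin (t * ln (INR n))) N.

Lemma partial_sq N t :
  partial_re N t ^ 2 + partial_im N t ^ 2 =
  harmonic N + 2 * sum1 (fun m => sum1 (fun h =>
     / (sqrt (INR m) * sqrt (INR (m + h))) * cos (t * ln (INR (m + h) / INR m))) (N - m)) N.
Proof.
  set (F := fun m n => / (sqrt (INR m) * sqrt (INR n)) * cos (t * ln (INR n) - t * ln (INR m))).
  assert (Hs : forall m n, F m n = F n m).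
  { intros m n. unfold F. rewrite <- cos_neg. rewrite (Rmult_comm (sqrt (INR m))).
    f_equal. f_equal. ring. }
  transitivity (sum1 (fun m => sum1 (F m) N) N).
  - unfold partial_re, partial_im.
    rewrite <- Rsqr_pow2, <- (Rsqr_pow2 (- _)), <- Rsqr_neg. unfold Rsqr.
    rewrite <- !sum1_scal, <- sum1_plus. apply sum1_ext. intros m Hm.
    rewrite (Rmult_comm (sum1 _ _)), (Rmult_comm (sum1 (fun n => _ * sin _) _)), <- !sum1_scal, <- sum1_plus.
    apply sum1_ext. intros n Hn. unfold F. rewrite cos_minus, Rinv_mult. ring.
  - rewrite (sum1_symmetric F N Hs). f_equal; [|f_equal].
    + apply sum1_ext. intros m Hm. unfold F. rewrite Rminus_diag, cos_0, sqrt_sqrt by apply pos_INR. ring.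
    + apply sum1_ext. intros m Hm. apply sum1_ext. intros h Hh. unfold F.
      rewrite ln_div by (apply lt_0_INR; lia). f_equal. f_equal. ring.
Qed.

Lemma is_RInt_partial_sq T N : 0 <= T ->
  is_RInt (fun t => (T - t) * (partial_re N t ^ 2 + partial_im N t ^ 2)) 0 T
    (T ^ 2 / 2 * harmonic N + 2 * off_diagonal T N).
Proof.
  intros HT.
  apply is_RInt_ext with (fun t => harmonic N * (T - t) + 2 * sum1 (fun m => sum1 (fun h =>
     / (sqrt (INR m) * sqrt (INR (m + h))) * ((T - t) * cos (t * ln (INR (m + h) / INR m)))) (N - m)) N).
  - intros t _. rewrite partial_sq, Rmult_plus_distr_l. f_equal; [ring|].
    rewrite (Rmult_comm (T - t)), Rmult_assoc, (Rmult_comm _ (T - t)). f_equal.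
    rewrite <- sum1_scal. apply sum1_ext. intros m _. rewrite <- sum1_scal. apply sum1_ext. intros h _. ring.
  - apply (is_RInt_plus (fun t => harmonic N * (T - t))).
    + rewrite Rmult_comm. apply (is_RInt_scal (fun t => T - t)). now apply is_RInt_fejer.
    + apply (is_RInt_scal (fun t => sum1 (fun m => sum1 (fun h =>
       / (sqrt (INR m) * sqrt (INR (m + h))) * ((T - t) * cos (t * ln (INR (m + h) / INR m)))) (N - m)) N)).
      unfold off_diagonal. apply (is_RInt_sum1 (fun m t => sum1 _ (N - m))). intros m Hm.
      apply (is_RInt_sum1 (fun h t => / (sqrt (INR m) * sqrt (INR (m + h))) * ((T - t) * cos (t * ln (INR (m + h) / INR m))))).
      intros h Hh. apply (is_RInt_scal (fun t => (T - t) * cos (t * ln (INR (m + h) / INR m)))).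
      apply is_RInt_fejer_cos; [exact HT|]. apply Rgt_not_eq. rewrite <- ln_1. apply ln_increasing; [lra|].
      assert (0 < INR m) by (apply lt_0_INR; lia). apply Rlt_div_r; [lra|]. rewrite Rmult_1_l. apply lt_INR. lia.
Qed.

(** * The pole term *)

Lemma is_derive_RInt_param_R (f df : R -> R -> R) a b l :
  (forall l t, is_derive (fun u => f u t) l (df l t)) ->
  (forall l t, continuity_2d_pt df l t) ->
  (forall l t, continuous (f l) t) ->
  is_derive (fun u => RInt (f u) a b) l (RInt (df l) a b).
Proof.
  intros H1 H2 H3.
  assert (E : forall u v, Derive (fun z => f z v) u = df u v) by (intros; apply is_derive_unique, H1).
  replace (RInt (df l) a b) with (RInt (fun t => Derive (fun u => f u t) l) a b).
  - apply (is_derive_RInt_param (fun u t => f u t)).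
    + apply filter_forall. intros u t _. eexists. apply H1.
    + intros t _. apply continuity_2d_pt_ext with df; [intros; now rewrite E|apply H2].
    + apply filter_forall. intros u. apply (ex_RInt_continuous (f u)). intros; apply H3.
  - apply RInt_ext. intros; apply E.
Qed.

(** With [s = 1/2 + it] and [x = N exp (- l)], the integrand is [T - t] times the real
    part of [(N / x)^s / s].  For [x = n] this is the product of [n^(-s)] with the
    conjugate of the pole term [N^(1-s) / (1-s)]. *)
Definition pole_J T l := RInt (fun t => (T - t) * (exp (l / 2) * (/ 2 * cos (t * l) + t * sin (t * l)) * / (1 / 4 + t ^ 2))) 0 T.
(** The integrand is [T - t] times the real part of [N^s x^(1-s) / (s (1-s))], divided
    by [N]: a primitive in [x] of the one of [pole_J]. *)
Definition pole_P T l := RInt (fun t => (T - t) * (exp (- (l / 2)) * cos (t * l) * / (1 / 4 + t ^ 2))) 0 T.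

Ltac cont2d :=
  repeat first
   [ apply continuity_2d_pt_plus | apply continuity_2d_pt_minus | apply continuity_2d_pt_mult
   | apply continuity_2d_pt_opp
   | apply (continuity_2d_pt_const _ _)
   | apply (continuity_2d_pt_id1 _ _) | apply (continuity_2d_pt_id2 _ _)
   | apply (continuity_1d_2d_pt_comp exp); [apply derivable_continuous_pt, derivable_pt_exp|]
   | apply (continuity_1d_2d_pt_comp cos); [apply derivable_continuous_pt, derivable_pt_cos|]
   | apply (continuity_1d_2d_pt_comp sin); [apply derivable_continuous_pt, derivable_pt_sin|]
   | apply continuity_2d_pt_inv ].

Lemma quarter_sq_pos t : 0 < 1 / 4 + t ^ 2.
Proof. pose proof (pow2_ge_0 t). lra. Qed.

Lemma is_derive_pole_P T l : is_derive (pole_P T) l (- (exp (- l) * pole_J T l)).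
Proof.
  unfold pole_P, pole_J.
  set (g := fun l t => (T - t) * (exp (l / 2) * (/ 2 * cos (t * l) + t * sin (t * l)) * / (1 / 4 + t ^ 2))).
  set (df := fun l t => - ((T - t) * (exp (- (l * / 2)) * (/ 2 * cos (t * l) + t * sin (t * l)) * / (1 / 4 + t * t)))).
  change (is_derive (pole_P T) l (- (exp (- l) * RInt (g l) 0 T))). unfold pole_P.
  replace (- (exp (- l) * RInt (g l) 0 T)) with (RInt (df l) 0 T).
  - apply (is_derive_RInt_param_R
      (fun l t => (T - t) * (exp (- (l / 2)) * cos (t * l) * / (1 / 4 + t ^ 2))) df).
    + intros u t. pose proof (quarter_sq_pos t). unfold df. auto_derive; [easy|].
      replace (- (u * / 2)) with (- u / 2) by field. replace (1 / 4 + t * t) with (1 / 4 + t ^ 2) by ring. field. lra.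
    + intros u t. unfold df. cont2d. pose proof (quarter_sq_pos t). nra.
    + intros u t. apply continuous_of_derive. pose proof (quarter_sq_pos t). auto_derive. lra.
  - apply is_RInt_unique. apply is_RInt_ext with (fun t => scal (- exp (- l)) (g l t)).
    + intros t _. pose proof (quarter_sq_pos t). unfold scal; simpl; unfold mult; simpl. unfold g, df.
      replace (- (l * / 2)) with (- l + l / 2) by field. rewrite exp_plus.
      replace (1 / 4 + t * t) with (1 / 4 + t ^ 2) by ring. field. lra.
    + rewrite Ropp_mult_distr_l. apply (is_RInt_scal (g l)). apply (RInt_correct (V := R_CompleteNormedModule)).
      apply (ex_RInt_continuous (g l)). intros t _. apply continuous_of_derive.
      pose proof (quarter_sq_pos t). unfold g. auto_derive. lra.
Qed.

Lemma is_derive_pole_J T l :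
  is_derive (pole_J T) l (exp (l / 2) * RInt (fun t => (T - t) * cos (t * l)) 0 T).
Proof.
  unfold pole_J.
  set (df := fun l t => exp (l * / 2) * ((T - t) * cos (t * l))).
  replace (exp (l / 2) * RInt (fun t => (T - t) * cos (t * l)) 0 T) with (RInt (df l) 0 T).
  - apply (is_derive_RInt_param_R
      (fun l t => (T - t) * (exp (l / 2) * (/ 2 * cos (t * l) + t * sin (t * l)) * / (1 / 4 + t ^ 2))) df).
    + intros u t. pose proof (quarter_sq_pos t). unfold df. auto_derive; [easy|].
      change (u / 2) with (u * / 2). field. nra.
    + intros u t. unfold df. cont2d.
    + intros u t. apply continuous_of_derive. pose proof (quarter_sq_pos t). auto_derive. lra.
  - apply is_RInt_unique. unfold df. apply (is_RInt_scal (fun t => (T - t) * cos (t * l))). apply (RInt_correct (V := R_CompleteNormedModule)).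
    apply (ex_RInt_continuous (fun t => (T - t) * cos (t * l))). intros t _. apply continuous_of_derive.
    auto_derive. easy.
Qed.

(** The derivative is the weighted mean value of a cosine, a Fejer kernel, hence
    nonnegative.  A sharp cut-off at [T] in place of the weight [T - t] would not
    have this property. *)
Lemma pole_J_incr T a b : 0 <= T -> a <= b -> pole_J T a <= pole_J T b.
Proof.
  intros HT Hab. apply (derive_nonneg_le _ (fun l => exp (l / 2) * RInt (fun t => (T - t) * cos (t * l)) 0 T)); [exact Hab| |].
  - intros; apply is_derive_pole_J.
  - intros l _. apply Rmult_le_pos; [apply Rlt_le, exp_pos|].
    destruct (Req_dec l 0) as [->|Hl].
    + rewrite (RInt_ext _ (fun t => T - t)).
      * rewrite (is_RInt_unique _ _ _ _ (is_RInt_fejer T HT)). pose proof (pow2_ge_0 T). lra.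
      * intros t _. rewrite Rmult_0_r, cos_0. apply Rmult_1_r.
    + rewrite (is_RInt_unique _ _ _ _ (is_RInt_fejer_cos T l HT Hl)).
      apply Rdiv_le_0_compat; [apply one_minus_cos_bounds|]. now apply pow2_gt_0.
Qed.

(** [pole_P T a - pole_P T b] is the integral of the increasing function [pole_J T]
    against [exp (- l)] over [a, b]. *)
Lemma pole_P_step T a b : 0 <= T -> a <= b ->
  pole_J T a * (exp (- a) - exp (- b)) <= pole_P T a - pole_P T b <= pole_J T b * (exp (- a) - exp (- b)).
Proof.
  intros HT Hab.
  assert (D : forall c l, is_derive (fun l => c * exp (- l) - pole_P T l) l (exp (- l) * (pole_J T l - c))).
  { intros c l. evar (d : R). assert (D1 : is_derive (fun l => c * exp (- l)) l d).
    { unfold d. auto_derive; [easy|reflexivity]. }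
    pose proof (is_derive_minus _ _ l _ _ D1 (is_derive_pole_P T l)) as D2.
    replace (exp (- l) * (pole_J T l - c)) with (minus d (- (exp (- l) * pole_J T l))); [exact D2|].
    unfold minus, plus, opp, d; simpl. ring. }
  split.
  - pose proof (derive_nonneg_le (fun l => pole_J T a * exp (- l) - pole_P T l) _ a b Hab (fun l _ => D _ l)) as M.
    assert (pole_J T a * exp (- a) - pole_P T a <= pole_J T a * exp (- b) - pole_P T b); [|lra].
    apply M. intros l Hl. apply Rmult_le_pos; [apply Rlt_le, exp_pos|].
    pose proof (pole_J_incr T a l HT ltac:(lra)). lra.
  - pose proof (derive_nonneg_le (fun l => - (pole_J T b * exp (- l) - pole_P T l)) (fun l => - (exp (- l) * (pole_J T l - pole_J T b)))
       a b Hab (fun l _ => is_derive_opp _ l _ (D (pole_J T b) l))) as M.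
    assert (- (pole_J T b * exp (- a) - pole_P T a) <= - (pole_J T b * exp (- b) - pole_P T b)); [|lra].
    apply M. intros l Hl. pose proof (exp_pos (- l)).
    pose proof (pole_J_incr T l b HT ltac:(lra)). nra.
Qed.

(** As in the integral test: [pole_J] decreases in [n], so its sum is the integral over
    [x] between 1 and [N], up to the values at the end points. *)
Lemma pole_sum T N : 0 <= T -> (1 <= N)%nat ->
  INR N * (pole_P T 0 - pole_P T (ln (INR N))) + pole_J T 0
  <= sum1 (fun n => pole_J T (ln (INR N / INR n))) N
  <= INR N * (pole_P T 0 - pole_P T (ln (INR N))) + pole_J T (ln (INR N)).
Proof.
  intros HT HN. assert (HN1 : 1 <= INR N) by (apply INR_ge_1, HN).
  set (J := fun n => pole_J T (ln (INR N / INR n))).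
  set (P := fun n => pole_P T (ln (INR N / INR n))).
  assert (step : forall n, (1 <= n)%nat -> J (S n) <= INR N * (P (S n) - P n) <= J n).
  { intros n Hn. assert (Hn1 : 1 <= INR n) by (apply INR_ge_1, Hn).
    assert (Ee : forall k, (1 <= k)%nat -> exp (- ln (INR N / INR k)) = INR k / INR N).
    { intros k Hk. assert (0 < INR k) by (apply lt_0_INR; lia).
      rewrite exp_Ropp, exp_ln by (apply Rdiv_lt_0_compat; lra). field. lra. }
    pose proof (pole_P_step T (ln (INR N / INR (S n))) (ln (INR N / INR n)) HT) as M.
    rewrite !Ee in M by lia. rewrite S_INR in M.
    replace ((INR n + 1) / INR N - INR n / INR N) with (/ INR N) in M by (field; lra).
    rewrite <- S_INR in M. destruct M as [M1 M2].
    { apply ln_le; [apply Rdiv_lt_0_compat; [lra|apply lt_0_INR; lia]|].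
      apply Rmult_le_compat_l; [lra|]. apply Rinv_le_contravar; [lra|]. rewrite S_INR. lra. }
    unfold J, P. split.
    - apply Rmult_le_reg_r with (/ INR N); [apply Rinv_0_lt_compat; lra|].
      eapply Rle_trans; [exact M1|]. right. field. lra.
    - apply Rmult_le_reg_r with (/ INR N); [apply Rinv_0_lt_compat; lra|].
      eapply Rle_trans; [|exact M2]. right. field. lra. }
  assert (tele : forall K, (1 <= K)%nat ->
     INR N * (P K - P 1%nat) + J K <= sum1 J K <= INR N * (P K - P 1%nat) + J 1%nat).
  { induction K as [|K IH]; intros HK; [lia|]. destruct K as [|K].
    - simpl. lra.
    - specialize (IH ltac:(lia)). specialize (step (S K) ltac:(lia)).
      change (sum1 J (S (S K))) with (sum1 J (S K) + J (S (S K))). lra. }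
  assert (EN : INR N / INR N = 1) by (field; lra).
  assert (E1 : INR N / INR 1 = INR N) by (simpl; field).
  specialize (tele N HN). fold J. unfold J at 1 4 in tele. unfold P in tele.
  rewrite EN, E1, ln_1 in tele. exact tele.
Qed.

Lemma is_RInt_cauchy_kernel T : 0 <= T ->
  is_RInt (fun t => / (1 / 4 + t ^ 2)) 0 T (2 * atan (2 * T)).
Proof.
  intros HT. replace (2 * atan (2 * T)) with (2 * atan (2 * T) - 2 * atan (2 * 0)) by (rewrite Rmult_0_r, atan_0; ring).
  apply (is_RInt_derive_R (fun t => 2 * atan (2 * t))); [exact HT| |].
  - intros x _. auto_derive; [easy|]. pose proof (quarter_sq_pos x). field. nra.
  - intros x _. apply continuous_of_derive. pose proof (quarter_sq_pos x). auto_derive. lra.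
Qed.

Lemma is_RInt_cauchy_kernel_t T : 0 <= T ->
  is_RInt (fun t => t * / (1 / 4 + t ^ 2)) 0 T (ln (1 + 4 * T ^ 2) / 2).
Proof.
  intros HT. replace (ln (1 + 4 * T ^ 2) / 2) with (ln (1 + 4 * T ^ 2) / 2 - ln (1 + 4 * 0 ^ 2) / 2)
    by (replace (1 + 4 * 0 ^ 2) with 1 by ring; rewrite ln_1; field).
  apply (is_RInt_derive_R (fun t => ln (1 + 4 * t ^ 2) / 2)); [exact HT| |].
  - intros x _. pose proof (quarter_sq_pos x). auto_derive; [nra|]. field. nra.
  - intros x _. apply continuous_of_derive. pose proof (quarter_sq_pos x). auto_derive. lra.
Qed.

Lemma pole_P_0 T : pole_P T 0 = RInt (fun t => (T - t) * / (1 / 4 + t ^ 2)) 0 T.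
Proof.
  unfold pole_P. apply RInt_ext. intros t _.
  rewrite Rmult_0_r, cos_0. replace (- (0 / 2)) with 0 by field. rewrite exp_0.
  match goal with |- ?a = ?b => change (@eq R a b) end. ring.
Qed.

Lemma atan_ge x : 0 < x -> PI / 2 - / x <= atan x <= PI / 2.
Proof.
  intros Hx. split; [|apply Rlt_le, atan_bound].
  rewrite <- (Rinv_inv x), atan_inv by now apply Rinv_0_lt_compat.
  rewrite Rinv_inv.
  assert (0 < / x) by now apply Rinv_0_lt_compat.
  assert (atan (/ x) <= / x); [|lra].
  pose proof (derive_nonneg_le (fun y => y - atan y) (fun y => y ^ 2 / (1 + y ^ 2)) 0 (/ x) ltac:(lra)) as M.
  cbv beta in M. rewrite atan_0 in M. assert (0 - 0 <= / x - atan (/ x)); [|lra]. apply M.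
  - intros y _. auto_derive; [easy|]. field. nra.
  - intros y _. pose proof (pow2_ge_0 y). apply Rdiv_le_0_compat; lra.
Qed.

Lemma ln_1p_4sq_le T : 1 <= T -> ln (1 + 4 * T ^ 2) / 2 <= 1 + ln T.
Proof.
  intros HT. assert (H : ln (1 + 4 * T ^ 2) <= ln (exp 2 * (T * T))).
  { apply ln_le; [nra|]. pose proof (exp_ineq1_le 1). replace 2 with (1 + 1) by ring. rewrite exp_plus.
    assert (5 <= exp 1 * exp 1); [|nra].
    assert (exp 1 >= 5 / 2); [|nra].
    pose proof (exp_ineq1_le (/ 2)). replace 1 with (/ 2 + / 2) by field. rewrite exp_plus.
    assert (8 / 5 <= exp (/ 2)); [|nra].
    pose proof (exp_ineq1_le (/ 4)). pose proof (exp_ineq1_le (/ 8)). pose proof (exp_ineq1_le (/ 16)).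
    replace (/ 2) with (/ 4 + / 4) by field. replace (/ 4) with (/ 8 + / 8) by field.
    replace (/ 8) with (/ 16 + / 16) by field. rewrite !exp_plus. set (z := exp (/ 16)) in *.
    assert (1.062 <= z) by lra. assert (1.127 <= z * z) by nra. assert (1.27 <= z * z * (z * z)) by nra. nra. }
  rewrite ln_mult, ln_exp, ln_mult in H by (try apply exp_pos; nra). lra.
Qed.

Lemma pole_P_0_bounds T : 1 <= T -> PI * T - 2 - ln T <= pole_P T 0 <= PI * T.
Proof.
  intros HT. rewrite pole_P_0.
  assert (E : RInt (fun t => (T - t) * / (1 / 4 + t ^ 2)) 0 T = T * (2 * atan (2 * T)) - ln (1 + 4 * T ^ 2) / 2).
  { apply is_RInt_unique.
    apply is_RInt_ext with (fun t => minus (scal T (/ (1 / 4 + t ^ 2))) (t * / (1 / 4 + t ^ 2))).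
    - intros t _. unfold minus, plus, opp, scal; simpl; unfold mult; simpl. ring.
    - apply (is_RInt_minus (fun t => scal T (/ (1 / 4 + t ^ 2)))).
      + apply (is_RInt_scal (fun t => / (1 / 4 + t ^ 2))). apply is_RInt_cauchy_kernel. lra.
      + apply is_RInt_cauchy_kernel_t. lra. }
  rewrite E. pose proof (atan_ge (2 * T) ltac:(lra)) as [A B]. pose proof (ln_1p_4sq_le T HT).
  assert (0 <= ln (1 + 4 * T ^ 2)) by (rewrite <- ln_1; apply ln_le; nra).
  replace (/ (2 * T)) with (/ T / 2) in A by (field; lra).
  assert (T * / T = 1) by (apply Rinv_r; lra). split; nra.
Qed.

Lemma pole_P_abs T l : 0 <= T -> Rabs (pole_P T l) <= exp (- (l / 2)) * pole_P T 0.
Proof.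
  intros HT. rewrite pole_P_0. unfold pole_P.
  eapply Rle_trans; [apply abs_RInt_le; [exact HT|]|].
  - apply ex_RInt_of_derive. intros t.
    pose proof (quarter_sq_pos t). auto_derive. lra.
  - assert (E : ex_RInt (fun t => (T - t) * / (1 / 4 + t ^ 2)) 0 T).
    { apply ex_RInt_of_derive. intros t.
      pose proof (quarter_sq_pos t). auto_derive. lra. }
    replace (exp (- (l / 2)) * RInt (fun t => (T - t) * / (1 / 4 + t ^ 2)) 0 T)
      with (RInt (fun t => scal (exp (- (l / 2))) ((T - t) * / (1 / 4 + t ^ 2))) 0 T)
      by (apply (RInt_scal (fun t => (T - t) * / (1 / 4 + t ^ 2))); exact E).
    apply RInt_le; [exact HT| | |].
    + apply ex_RInt_of_continuous. intros t. apply (continuous_comp _ Rabs); [|apply continuous_Rabs].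
      apply continuous_of_derive. pose proof (quarter_sq_pos t). auto_derive. lra.
    + apply (ex_RInt_scal (fun t => (T - t) * / (1 / 4 + t ^ 2))), E.
    + intros t Ht. unfold scal; simpl; unfold mult; simpl.
      replace (t * (t * 1)) with (t ^ 2) by ring.
      pose proof (quarter_sq_pos t) as Q. pose proof (exp_pos (- (l / 2))) as Ex.
      assert (Qi : 0 < / (1 / 4 + t ^ 2)) by now apply Rinv_0_lt_compat.
      replace ((T - t) * (exp (- (l / 2)) * cos (t * l) * / (1 / 4 + t ^ 2))) with
        (exp (- (l / 2)) * ((T - t) * / (1 / 4 + t ^ 2)) * cos (t * l)) by ring.
      assert (HB : 0 <= exp (- (l / 2)) * ((T - t) * / (1 / 4 + t ^ 2))).
      { apply Rmult_le_pos; [lra|]. apply Rmult_le_pos; lra. }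
      set (B := exp (- (l / 2)) * ((T - t) * / (1 / 4 + t ^ 2))) in *.
rewrite Rabs_mult, (Rabs_right B) by (apply Rle_ge; assumption).
      pose proof (Rabs_le _ _ (COS_bound (t * l))) as Hc.
      apply Rle_trans with (B * 1); [now apply Rmult_le_compat_l|right; unfold B; ring].
Qed.

Lemma pole_J_le T l : 1 <= T -> pole_J T l <= exp (l / 2) * (T * (3 + ln T)).
Proof.
  intros HT. unfold pole_J.
  assert (HK : is_RInt (fun t => scal (exp (l / 2) * T) (plus (scal (/ 2) (/ (1 / 4 + t ^ 2))) (t * / (1 / 4 + t ^ 2)))) 0 T
     (scal (exp (l / 2) * T) (plus (scal (/ 2) (2 * atan (2 * T))) (ln (1 + 4 * T ^ 2) / 2)))).
  { apply (is_RInt_scal (fun t => plus (scal (/ 2) (/ (1 / 4 + t ^ 2))) (t * / (1 / 4 + t ^ 2)))).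
    apply (is_RInt_plus (fun t => scal (/ 2) (/ (1 / 4 + t ^ 2)))).
    - apply (is_RInt_scal (fun t => / (1 / 4 + t ^ 2))). apply is_RInt_cauchy_kernel. lra.
    - apply is_RInt_cauchy_kernel_t. lra. }
  eapply Rle_trans.
  - apply (RInt_le _ (fun t => scal (exp (l / 2) * T) (plus (scal (/ 2) (/ (1 / 4 + t ^ 2))) (t * / (1 / 4 + t ^ 2))))); [lra| | |].
    + apply ex_RInt_of_derive. intros t.
      pose proof (quarter_sq_pos t). auto_derive. lra.
    + eexists. exact HK.
    + intros t Ht. unfold plus, scal; simpl; unfold mult; simpl.
      pose proof (quarter_sq_pos t) as Q. pose proof (exp_pos (l / 2)) as Ex.
      assert (Qi : 0 < / (1 / 4 + t ^ 2)) by now apply Rinv_0_lt_compat.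
      pose proof (COS_bound (t * l)). pose proof (SIN_bound (t * l)).
      replace (t * (t * 1)) with (t ^ 2) by ring.
      set (q := / (1 / 4 + t ^ 2)) in *. set (e := exp (l / 2)) in *.
      assert (A : / 2 * cos (t * l) + t * sin (t * l) <= / 2 + t) by nra.
      assert (B : (T - t) * (/ 2 * cos (t * l) + t * sin (t * l)) <= T * (/ 2 + t)) by nra.
      assert (0 < e * q) by nra. nra.
  - rewrite (is_RInt_unique _ _ _ _ HK). unfold plus, scal; simpl; unfold mult; simpl.
    rewrite Rmult_assoc. apply Rmult_le_compat_l; [apply Rlt_le, exp_pos|].
    apply Rmult_le_compat_l; [lra|]. pose proof (ln_1p_4sq_le T HT).
    replace (T * (T * 1)) with (T ^ 2) by ring.
    pose proof (atan_bound (2 * T)). pose proof PI_4. lra.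
Qed.

Lemma pole_J_0_nonneg T : 0 <= T -> 0 <= pole_J T 0.
Proof.
  intros HT. unfold pole_J. apply RInt_ge_0; [exact HT| |].
  - apply ex_RInt_of_derive. intros t.
    pose proof (quarter_sq_pos t). auto_derive. lra.
  - intros t Ht. rewrite Rmult_0_r, cos_0, sin_0. pose proof (exp_pos (0 / 2)).
    assert (0 < / (1 / 4 + t ^ 2)) by (apply Rinv_0_lt_compat, quarter_sq_pos).
    apply Rmult_le_pos; [lra|]. apply Rmult_le_pos; [|lra]. nra.
Qed.

(** * Complex sequences and power series *)

Fixpoint csum (a : nat -> C) (n : nat) : C :=
  match n with O => RtoC 0 | S k => (csum a k + a k)%C end.

Definition rsum (b : nat -> R) (n : nat) : R := sum1 (fun k => b (pred k)) n.

Definition Ccv (u : nat -> C) (l : C) : Prop :=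
  forall eps, 0 < eps -> exists N, forall n, (N <= n)%nat -> Cmod (u n - l)%C < eps.

Lemma Cmod_minus_sym a b : Cmod (a - b)%C = Cmod (b - a)%C.
Proof. rewrite <- Cmod_opp. f_equal. ring. Qed.

Lemma Cmod_minus_triangle a b c : Cmod (a - c)%C <= Cmod (a - b)%C + Cmod (b - c)%C.
Proof. replace (a - c)%C with ((a - b) + (b - c))%C by ring. apply Cmod_triangle. Qed.

Lemma Cmod_small_eq a b : (forall eps, 0 < eps -> Cmod (a - b)%C <= eps) -> a = b.
Proof.
  intros H. assert (E : (a - b)%C = RtoC 0).
  { apply Cmod_eq_0. apply Rle_antisym; [|apply Cmod_ge_0].
    apply Rnot_lt_le. intros Hlt. specialize (H (Cmod (a - b)%C / 2) ltac:(lra)). lra. }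
  replace a with ((a - b) + b)%C by ring. rewrite E. ring.
Qed.

Lemma Ccv_unique u a b : Ccv u a -> Ccv u b -> a = b.
Proof.
  intros Ha Hb. apply Cmod_small_eq. intros eps He.
  destruct (Ha (eps / 2) ltac:(lra)) as [N1 H1]. destruct (Hb (eps / 2) ltac:(lra)) as [N2 H2].
  specialize (H1 (N1 + N2)%nat ltac:(lia)). specialize (H2 (N1 + N2)%nat ltac:(lia)).
  pose proof (Cmod_minus_triangle a (u (N1 + N2)%nat) b). rewrite (Cmod_minus_sym a (u _)) in H. lra.
Qed.

Lemma Ccv_ext u v l : (forall n, u n = v n) -> Ccv u l -> Ccv v l.
Proof. intros E H eps He. destruct (H eps He) as [N HN]. exists N. intros n Hn. rewrite <- E. auto. Qed.

Lemma Ccv_const c : Ccv (fun _ => c) c.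
Proof. intros eps He. exists 0%nat. intros. replace (c - c)%C with (RtoC 0) by ring. now rewrite Cmod_0. Qed.

Lemma Ccv_plus u v a b : Ccv u a -> Ccv v b -> Ccv (fun n => (u n + v n)%C) (a + b)%C.
Proof.
  intros Ha Hb eps He.
  destruct (Ha (eps / 2) ltac:(lra)) as [N1 H1]. destruct (Hb (eps / 2) ltac:(lra)) as [N2 H2].
  exists (N1 + N2)%nat. intros n Hn. specialize (H1 n ltac:(lia)). specialize (H2 n ltac:(lia)).
  replace ((u n + v n) - (a + b))%C with ((u n - a) + (v n - b))%C by ring.
  eapply Rle_lt_trans; [apply Cmod_triangle|]. lra.
Qed.

Lemma Ccv_scal c u a : Ccv u a -> Ccv (fun n => (c * u n)%C) (c * a)%C.
Proof.
  intros Ha eps He. pose proof (Cmod_ge_0 c) as Hc.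
  destruct (Ha (eps / (Cmod c + 1))) as [N1 H1]; [apply Rdiv_lt_0_compat; lra|].
  exists N1. intros n Hn. specialize (H1 n Hn).
  replace ((c * u n) - (c * a))%C with (c * (u n - a))%C by ring.
  rewrite Cmod_mult. apply (Rmult_lt_compat_r (Cmod c + 1)) in H1; [|lra].
  replace (eps / (Cmod c + 1) * (Cmod c + 1)) with eps in H1 by (field; lra).
  pose proof (Cmod_ge_0 (u n - a)%C). nra.
Qed.

Lemma Ccv_shift u l : Ccv u l -> Ccv (fun n => u (S n)) l.
Proof. intros H eps He. destruct (H eps He) as [N HN]. exists N. intros; apply HN; lia. Qed.

Lemma Ccv_limit_bound u l c M N0 : Ccv u l ->
  (forall n, (N0 <= n)%nat -> Cmod (u n - c)%C <= M) -> Cmod (l - c)%C <= M.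
Proof.
  intros Hu HM. apply Rle_plus_epsilon. intros eps He.
  destruct (Hu eps He) as [N HN]. specialize (HN (N + N0)%nat ltac:(lia)).
  specialize (HM (N + N0)%nat ltac:(lia)).
  pose proof (Cmod_minus_triangle l (u (N + N0)%nat) c). rewrite (Cmod_minus_sym l (u _)) in H. lra.
Qed.

Lemma csum_ext a b n : (forall k, (k < n)%nat -> a k = b k) -> csum a n = csum b n.
Proof.
  induction n as [|n IH]; intros H; simpl; [reflexivity|].
  rewrite IH, (H n); [reflexivity|lia|intros; apply H; lia].
Qed.

Lemma csum_plus a b n : csum (fun k => (a k + b k)%C) n = (csum a n + csum b n)%C.
Proof. induction n as [|n IH]; simpl; [ring|rewrite IH; ring]. Qed.

Lemma csum_scal c a n : csum (fun k => (c * a k)%C) n = (c * csum a n)%C.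
Proof. induction n as [|n IH]; simpl; [ring|rewrite IH; ring]. Qed.

Lemma csum_swap (f : nat -> nat -> C) m n :
  csum (fun i => csum (f i) n) m = csum (fun j => csum (fun i => f i j) m) n.
Proof.
  induction m as [|m IH]; simpl.
  - induction n as [|n IHn]; simpl; [reflexivity|]. rewrite <- IHn. ring.
  - rewrite IH, <- csum_plus. reflexivity.
Qed.

Lemma csum_add a m n : csum a (m + n) = (csum a m + csum (fun k => a (m + k)%nat) n)%C.
Proof.
  induction n as [|n IH]; simpl; [rewrite Nat.add_0_r; ring|].
  rewrite Nat.add_succ_r. simpl. rewrite IH. ring.
Qed.

Lemma csum_Cmod a b n : (forall k, (k < n)%nat -> Cmod (a k) <= b k) -> Cmod (csum a n) <= rsum b n.
Proof.
  induction n as [|n IH]; intros H.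
  - simpl. rewrite Cmod_0. unfold rsum; simpl; lra.
  - simpl. eapply Rle_trans; [apply Cmod_triangle|]. unfold rsum in *. simpl.
    apply Rplus_le_compat; [apply IH; intros; apply H; lia|apply H; lia].
Qed.

Lemma csum_sum_n a n : csum a (S n) = sum_n (G := C_AbelianMonoid) a n.
Proof.
  induction n as [|n IH].
  - rewrite sum_O. simpl. ring.
  - rewrite sum_Sn, <- IH. reflexivity.
Qed.

Lemma is_series_Ccv (a : nat -> C) (l : C) :
  is_series (K := C_AbsRing) (V := C_NormedModule) a l -> Ccv (csum a) l.
Proof.
  intros H eps He.
  assert (Hs : 0 < sqrt 2) by (apply sqrt_lt_R0; lra).
  assert (He2 : 0 < eps / sqrt 2) by (apply Rdiv_lt_0_compat; lra).
  destruct (H (fun y => Cmod (y - l)%C < eps)) as [N HN].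
  - exists (mkposreal _ He2). intros y Hy.
    pose proof (C_NormedModule_mixin_compat2 l y (mkposreal _ He2) Hy) as K. simpl in K.
    replace (sqrt 2 * (eps / sqrt 2)) with eps in K by (field; lra). exact K.
  - exists (S N). intros n Hn. destruct n as [|n]; [lia|]. rewrite csum_sum_n. apply HN. lia.
Qed.

Lemma Ccv_abs (a : nat -> C) (b : nat -> R) M :
  (forall k, Cmod (a k) <= b k) -> (forall n, rsum b n <= M) -> exists l, Ccv (csum a) l.
Proof.
  intros Hab Hb.
  assert (Hb0 : forall k, 0 <= b k) by (intros k; eapply Rle_trans; [apply Cmod_ge_0|apply Hab]).
  assert (Es : forall n, rsum b (S n) = sum_n b n).
  { induction n as [|n IH]; [rewrite sum_O; unfold rsum; simpl; ring|].
    rewrite sum_Sn, <- IH. reflexivity. }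
  assert (Hex : ex_series b).
  { destruct (ex_finite_lim_seq_incr (sum_n b) M) as [l Hl].
    - intros n. rewrite sum_Sn. specialize (Hb0 (S n)). unfold plus; simpl. lra.
    - intros n. rewrite <- Es. apply Hb.
    - exists l. exact Hl. }
  destruct (ex_series_le (K := C_AbsRing) (V := C_CompleteNormedModule) a b) as [l Hl].
  - intros n. apply Hab.
  - exact Hex.
  - exists l. apply is_series_Ccv, Hl.
Qed.

(** A total function; its value is meant for convergent sequences ([Ccv_Clim]). *)
Definition Clim (u : nat -> C) : C :=
  (real (Lim_seq (fun n => Re (u n))), real (Lim_seq (fun n => Im (u n)))).

Lemma im_le_Cmod z : Rabs (Im z) <= Cmod z.
Proof. eapply Rle_trans; [|apply Rmax_Cmod]. apply Rmax_r. Qed.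

Lemma Cmod_le_re_im z : Cmod z <= Rabs (Re z) + Rabs (Im z).
Proof.
  replace z with (RtoC (Re z) + (Ci * RtoC (Im z)))%C at 1.
  - eapply Rle_trans; [apply Cmod_triangle|]. rewrite Cmod_mult, Cmod_Ci, !Cmod_R. lra.
  - destruct z as [x y]. unfold Cplus, Cmult, Ci, RtoC; simpl. f_equal; ring.
Qed.

Lemma Ccv_Clim u l : Ccv u l -> Clim u = l.
Proof.
  intros H. destruct l as [x y]. unfold Clim. f_equal.
  - replace x with (real (Finite x)) by reflexivity. f_equal. apply is_lim_seq_unique.
    apply is_lim_seq_spec. intros eps. destruct (H eps (cond_pos eps)) as [N HN]. exists N. intros n Hn.
    eapply Rle_lt_trans; [|apply (HN n Hn)]. apply (re_le_Cmod (u n - (x, y))%C).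
  - replace y with (real (Finite y)) by reflexivity. f_equal. apply is_lim_seq_unique.
    apply is_lim_seq_spec. intros eps. destruct (H eps (cond_pos eps)) as [N HN]. exists N. intros n Hn.
    eapply Rle_lt_trans; [|apply (HN n Hn)]. apply (im_le_Cmod (u n - (x, y))%C).
Qed.

Lemma rsum_scal c a n : rsum (fun k => c * a k) n = c * rsum a n.
Proof. apply sum1_scal. Qed.

Lemma rsum_geom_tail K n q : 0 <= q < 1 -> rsum (fun k => q ^ (K + k)) n <= q ^ K / (1 - q).
Proof.
  intros Hq. assert (E : rsum (fun k => q ^ (K + k)) n = q ^ K * (1 - q ^ n) / (1 - q)).
  { induction n as [|n IH]; [unfold rsum; simpl; field; lra|].
    unfold rsum in *. simpl sum1. rewrite IH. simpl pred. rewrite pow_add. simpl. field. lra. }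
  rewrite E. unfold Rdiv. apply Rmult_le_compat_r; [apply Rlt_le, Rinv_0_lt_compat; lra|].
  pose proof (pow_le q K (proj1 Hq)). pose proof (pow_le q n (proj1 Hq)). nra.
Qed.

Lemma power_series_truncation c B r z l K : 0 <= r -> r * Cmod z < 1 ->
  (forall k, Cmod (c k) <= B * r ^ k) ->
  Ccv (csum (fun k => (c k * Cpow z k)%C)) l ->
  Cmod (l - csum (fun k => (c k * Cpow z k)%C) K)%C
    <= B * (r * Cmod z) ^ K / (1 - r * Cmod z).
Proof.
  intros Hr Hz Hc Hl. set (q := r * Cmod z) in *.
  assert (Hq : 0 <= q < 1) by (split; [apply Rmult_le_pos; [exact Hr|apply Cmod_ge_0]|exact Hz]).
  assert (HB : 0 <= B).
  { pose proof (Cmod_ge_0 (c 0%nat)). specialize (Hc 0%nat). simpl in Hc. lra. }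
  apply (Ccv_limit_bound _ _ _ _ K Hl). intros n Hn.
  replace n with (K + (n - K))%nat by lia. rewrite csum_add.
  match goal with |- Cmod ((?A + ?D) - ?A)%C <= _ => replace ((A + D) - A)%C with D by ring end.
  eapply Rle_trans; [apply (csum_Cmod _ (fun k => B * q ^ (K + k)))|].
  - intros k _. rewrite Cmod_mult, Cmod_pow. unfold q. rewrite Rpow_mult_distr, <- Rmult_assoc.
    apply Rmult_le_compat_r; [apply pow_le, Cmod_ge_0|apply Hc].
  - rewrite rsum_scal. unfold Rdiv. rewrite Rmult_assoc. apply Rmult_le_compat_l; [exact HB|].
    now apply rsum_geom_tail.
Qed.

(** The [n]-th power series truncated at degree [K] has error at most [2^(1-K) B n],
    which is summable in [n]; so the sum over [n] may be taken before the limit in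
    [K].  The constant [1/2] in the bound on [r |z|] makes this rate geometric. *)
Lemma series_of_power_series (c : nat -> nat -> C) (B : nat -> R) M r z (e : nat -> C) :
  0 <= r -> r * Cmod z <= / 2 ->
  (forall n k, Cmod (c n k) <= B n * r ^ k) -> (forall n, rsum B n <= M) ->
  (forall n, Ccv (csum (fun k => (c n k * Cpow z k)%C)) (e n)) ->
  exists E, Ccv (csum e) E /\
    Ccv (csum (fun k => (Clim (csum (fun n => c n k)) * Cpow z k)%C)) E.
Proof.
  intros Hr Hz Hc HB He.
  assert (HB0 : forall n, 0 <= B n).
  { intros n. pose proof (Cmod_ge_0 (c n 0%nat)). specialize (Hc n 0%nat). simpl in Hc. lra. }
  assert (Hk : forall k, exists l, Ccv (csum (fun n => c n k)) l).
  { intros k. apply (Ccv_abs _ (fun n => r ^ k * B n) (r ^ k * M)).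
    - intros n. rewrite Rmult_comm. apply Hc.
    - intros n. rewrite rsum_scal. apply Rmult_le_compat_l; [now apply pow_le|apply HB]. }
  assert (Hz0 : 0 <= r * Cmod z) by (apply Rmult_le_pos; [exact Hr|apply Cmod_ge_0]).
  assert (Ht : forall n K, Cmod (e n - csum (fun k => (c n k * Cpow z k)%C) K)%C <= 2 * (/ 2) ^ K * B n).
  { intros n K. eapply Rle_trans; [apply (power_series_truncation _ (B n) r); auto; lra|].
    apply Rle_div_l; [lra|]. specialize (HB0 n).
    assert (0 <= (r * Cmod z) ^ K <= (/ 2) ^ K) by (split; [now apply pow_le|now apply pow_incr]).
    assert (0 <= B n * (/ 2) ^ K) by nra. nra. }
  destruct (Ccv_abs e (fun n => 2 * B n) (2 * M)) as [E HE].
  - intros n. specialize (Ht n 0%nat). simpl in Ht.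
    replace (e n - RtoC 0)%C with (e n) in Ht by ring. lra.
  - intros n. rewrite rsum_scal. specialize (HB n). lra.
  - exists E. split; [exact HE|].
    intros eps Heps.
    assert (HM0 : 0 <= M) by (specialize (HB 0%nat); unfold rsum in HB; simpl in HB; exact HB).
    destruct (pow_lt_1_zero (/ 2) ltac:(rewrite Rabs_right; lra) (eps / (2 * M + 1))) as [K0 HK0].
    { apply Rdiv_lt_0_compat; lra. }
    exists K0. intros K HK. specialize (HK0 K HK). rewrite Rabs_right in HK0 by (apply Rle_ge, pow_le; lra).
    apply Rle_lt_trans with (2 * (/ 2) ^ K * M).
    + rewrite Cmod_minus_sym.
      assert (Hin : Ccv (fun N => csum (fun k => (csum (fun n => c n k) N * Cpow z k)%C) K)
        (csum (fun k => (Clim (csum (fun n => c n k)) * Cpow z k)%C) K)).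
      { clear - Hk. induction K as [|K IH]; [apply (Ccv_const (RtoC 0))|]. simpl. apply Ccv_plus; [exact IH|].
        destruct (Hk K) as [l Hl]. rewrite (Ccv_Clim _ _ Hl).
        replace (l * Cpow z K)%C with (Cpow z K * l)%C by ring.
        apply Ccv_ext with (fun N => (Cpow z K * csum (fun n => c n K) N)%C); [intros; ring|].
        now apply Ccv_scal. }
      pose proof (Ccv_plus _ _ _ _ HE (Ccv_scal (RtoC (-1)) _ _ Hin)) as Hd.
      replace (E - (csum (fun k => (Clim (csum (fun n => c n k)) * Cpow z k)%C) K))%C with
        ((E + (RtoC (-1) * (csum (fun k => (Clim (csum (fun n => c n k)) * Cpow z k)%C) K))) - RtoC 0)%C by ring.
      apply (Ccv_limit_bound _ _ _ _ 0 Hd). intros N _.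
      rewrite (csum_ext (fun k => (csum (fun n => c n k) N * Cpow z k)%C)
         (fun k => csum (fun n => (c n k * Cpow z k)%C) N)).
      2:{ intros k _. rewrite (csum_ext (fun n => (c n k * Cpow z k)%C) (fun n => (Cpow z k * c n k)%C)) by (intros; ring).
          rewrite csum_scal. ring. }
      rewrite <- csum_swap.
      match goal with |- Cmod ((?A + (_ * ?D)) - _)%C <= _ =>
        replace ((A + (RtoC (-1) * D)) - RtoC 0)%C with (A + (RtoC (-1) * D))%C by ring end.
      rewrite <- csum_scal, <- csum_plus.
      eapply Rle_trans; [apply (csum_Cmod _ (fun n => 2 * (/ 2) ^ K * B n))|].
      * intros n _. eapply Rle_trans; [|apply Ht]. right. f_equal. ring.
      * rewrite rsum_scal. apply Rmult_le_compat_l; [|apply HB]. pose proof (pow_le (/ 2) K). lra.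
    + apply (Rmult_lt_compat_r (2 * M + 1)) in HK0; [|lra].
      replace (eps / (2 * M + 1) * (2 * M + 1)) with eps in HK0 by (field; lra).
      pose proof (pow_le (/ 2) K ltac:(lra)). nra.
Qed.

(** Near the centre, the first nonzero coefficient would dominate all the others. *)
Lemma power_series_zeros (b : nat -> C) B r : 0 < r ->
  (forall k, Cmod (b k) <= B * r ^ k) ->
  (forall d, 0 < d -> exists z, 0 < Cmod z < d /\ Ccv (csum (fun k => (b k * Cpow z k)%C)) (RtoC 0)) ->
  forall k, b k = RtoC 0.
Proof.
  intros Hr Hb Hz k. induction k as [k IH] using lt_wf_ind.
  assert (HB : 0 <= B).
  { pose proof (Cmod_ge_0 (b 0%nat)). specialize (Hb 0%nat). simpl in Hb. lra. }
  apply Cmod_small_eq. intros eps He. replace (b k - RtoC 0)%C with (b k) by ring.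
  pose proof (pow_lt r (S k) Hr) as Hrk.
  set (d := Rmin (/ (2 * r)) (eps / (2 * B * r ^ S k + 1))).
  assert (Hq : 0 < 2 * B * r ^ S k + 1) by nra.
  destruct (Hz d) as [z [[Hz0 Hzd] Hs]].
  { apply Rmin_pos; [apply Rinv_0_lt_compat; lra|apply Rdiv_lt_0_compat; lra]. }
  assert (Hz1 : Cmod z < / (2 * r)) by (eapply Rlt_le_trans; [exact Hzd|apply Rmin_l]).
  assert (Hz2 : Cmod z < eps / (2 * B * r ^ S k + 1)) by (eapply Rlt_le_trans; [exact Hzd|apply Rmin_r]).
  assert (Hrz : r * Cmod z < / 2).
  { apply (Rmult_lt_compat_l r) in Hz1; [|lra]. replace (r * / (2 * r)) with (/ 2) in Hz1 by (field; lra). exact Hz1. }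
  pose proof (power_series_truncation b B r z (RtoC 0) (S k) ltac:(lra) ltac:(lra) Hb Hs) as Ht.
  assert (E : csum (fun j => (b j * Cpow z j)%C) (S k) = (b k * Cpow z k)%C).
  { simpl. rewrite (csum_ext _ (fun j => (RtoC 0 * RtoC 0)%C)).
    - rewrite csum_scal. ring.
    - intros j Hj. rewrite (IH j Hj). ring. }
  rewrite E in Ht. replace (RtoC 0 - (b k * Cpow z k))%C with (- (b k * Cpow z k))%C in Ht by ring.
  rewrite Cmod_opp, Cmod_mult, Cmod_pow in Ht.
  assert (Ht2 : Cmod (b k) * Cmod z ^ k <= 2 * B * r ^ S k * Cmod z * Cmod z ^ k).
  { eapply Rle_trans; [exact Ht|]. apply Rle_div_l; [nra|].
    rewrite Rpow_mult_distr. change (Cmod z ^ S k) with (Cmod z * Cmod z ^ k).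
    pose proof (pow_lt (Cmod z) k Hz0).
    assert (0 <= B * r ^ S k * (Cmod z * Cmod z ^ k)) by (apply Rmult_le_pos; apply Rmult_le_pos; lra). nra. }
  apply Rmult_le_reg_r in Ht2; [|now apply pow_lt].
  apply (Rmult_lt_compat_r (2 * B * r ^ S k + 1)) in Hz2; [|lra].
  replace (eps / (2 * B * r ^ S k + 1) * (2 * B * r ^ S k + 1)) with eps in Hz2 by (field; lra). nra.
Qed.

(** * Complex functions of a real variable *)

Lemma is_derive_const_R (c x : R) : is_derive (fun _ : R => c) x 0.
Proof. apply (is_derive_const (K := R_AbsRing) (V := R_NormedModule)). Qed.

Ltac eqR := match goal with |- ?a = ?b => change (@eq R a b) end.

(** Taken componentwise, so that the mean value theorem is available for each part. *)
Definition cderiv (f : R -> C) (x : R) (l : C) : Prop :=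
  is_derive (fun y => Re (f y)) x (Re l) /\ is_derive (fun y => Im (f y)) x (Im l).

Lemma cderiv_plus f g x a b : cderiv f x a -> cderiv g x b ->
  cderiv (fun y => (f y + g y)%C) x (a + b)%C.
Proof.
  intros [F1 F2] [G1 G2]. split; simpl.
  - apply (is_derive_plus (fun y => Re (f y)) (fun y => Re (g y))); assumption.
  - apply (is_derive_plus (fun y => Im (f y)) (fun y => Im (g y))); assumption.
Qed.

Lemma cderiv_eq f x a b : a = b -> cderiv f x a -> cderiv f x b.
Proof. now intros ->. Qed.

Lemma cderiv_scal c f x a : cderiv f x a -> cderiv (fun y => (c * f y)%C) x (c * a)%C.
Proof.
  intros [F1 F2]. split; simpl.
  - apply (is_derive_minus (fun y => fst c * Re (f y)) (fun y => snd c * Im (f y)));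
      apply (is_derive_scal (fun y => _)); assumption.
  - apply (is_derive_plus (fun y => fst c * Im (f y)) (fun y => snd c * Re (f y)));
      apply (is_derive_scal (fun y => _)); assumption.
Qed.

Lemma cderiv_const c x : cderiv (fun _ => c) x (RtoC 0).
Proof. split; apply is_derive_const_R. Qed.

Lemma cderiv_real_mult f f' g x g' : is_derive f x f' -> cderiv g x g' ->
  cderiv (fun y => (RtoC (f y) * g y)%C) x ((RtoC f' * g x) + (RtoC (f x) * g'))%C.
Proof.
  intros Hf [G1 G2].
  assert (K : forall h h', is_derive h x h' -> is_derive (fun y => f y * h y) x (f' * h x + f x * h')).
  { intros h h' Hh. pose proof (is_derive_mult f h x f' h' Hf Hh ltac:(intros; apply Rmult_comm)) as D. exact D. }
  split.
  - apply is_derive_ext with (fun y => f y * Re (g y)); [intros; simpl; eqR; unfold Re; ring|].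
    replace (Re _) with (f' * Re (g x) + f x * Re g') by (simpl; unfold Re; ring). now apply K.
  - apply is_derive_ext with (fun y => f y * Im (g y)); [intros; simpl; eqR; unfold Im; ring|].
    replace (Im _) with (f' * Im (g x) + f x * Im g') by (simpl; unfold Im; ring). now apply K.
Qed.

(** * The exponential series *)

Lemma exp_le x y : x <= y -> exp x <= exp y.
Proof. intros [H| ->]; [now apply Rlt_le, exp_increasing|apply Rle_refl]. Qed.

Lemma Cexp_plus a b : Cexp (a + b)%C = (Cexp a * Cexp b)%C.
Proof.
  destruct a as [x y], b as [u v]. unfold Cexp, Cmult, Cplus; simpl.
  rewrite exp_plus, cos_plus, sin_plus. f_equal; ring.
Qed.

Lemma Cmod_Cexp z : Cmod (Cexp z) = exp (Re z).
Proof.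
  unfold Cmod, Cexp; simpl.
  replace (_ + _) with (exp (Re z) * exp (Re z) * ((sin (Im z))² + (cos (Im z))²)) by (unfold Rsqr; ring).
  rewrite sin2_cos2, Rmult_1_r. apply sqrt_square, Rlt_le, exp_pos.
Qed.

Lemma cderiv_Cexp_line w r : cderiv (fun r => Cexp (RtoC r * w)%C) r (w * (Cexp (RtoC r * w)%C))%C.
Proof.
  destruct w as [a b].
  assert (E : forall y, Cexp (RtoC y * (a, b))%C = (exp (y * a) * cos (y * b), exp (y * a) * sin (y * b))).
  { intros y. unfold Cexp; simpl. replace (y * a - 0 * b) with (y * a) by ring.
    now replace (y * b + 0 * a) with (y * b) by ring. }
  split; rewrite E; (eapply is_derive_ext; [intros y; now rewrite E|]); simpl; (auto_derive; [easy|]); ring.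
Qed.

Lemma is_derive_pow_fact k r : is_derive (fun r => r ^ S k / INR (fact (S k))) r (r ^ k / INR (fact k)).
Proof.
  pose proof (INR_fact_neq_0 k). pose proof (INR_fact_neq_0 (S k)).
  assert (E : INR (fact (S k)) = INR (S k) * INR (fact k)) by (rewrite <- mult_INR; reflexivity).
  assert (INR (S k) <> 0) by (apply not_0_INR; lia).
  apply is_derive_ext with (fun r => / INR (fact (S k)) * r ^ S k); [intros; unfold Rdiv; apply Rmult_comm|].
  replace (r ^ k / INR (fact k)) with (/ INR (fact (S k)) * (INR (S k) * 1 * r ^ pred (S k))).
  - apply (is_derive_scal (fun r => r ^ S k)). apply (is_derive_pow (fun x => x)).
    apply (is_derive_id (K := R_AbsRing)).
  - rewrite E. simpl pred. field. split; assumption.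
Qed.

Definition Cexp_term (w : C) (k : nat) : C := (RtoC (/ INR (fact k)) * Cpow w k)%C.

Definition Cexp_rest (w : C) (K : nat) (r : R) : C :=
  ((Cexp (RtoC r * w)%C) + (- (csum (fun k => (RtoC (r ^ k / INR (fact k)) * Cpow w k)%C) K)))%C.

Lemma cderiv_Cexp_rest w K r : cderiv (Cexp_rest w (S K)) r (w * Cexp_rest w K r)%C.
Proof.
  induction K as [|K IH].
  - apply cderiv_eq with ((w * (Cexp (RtoC r * w)%C)) + RtoC 0)%C.
    { unfold Cexp_rest. simpl. ring. }
    unfold Cexp_rest. simpl. apply cderiv_plus; [apply cderiv_Cexp_line|apply cderiv_const].
  - apply cderiv_eq with ((w * Cexp_rest w K r) + (((RtoC (- (r ^ K / INR (fact K)))) * Cpow w (S K)) + ((RtoC (- (r ^ S K / INR (fact (S K))))) * RtoC 0)))%C.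
    { unfold Cexp_rest. rewrite RtoC_opp. cbn [csum Cpow]. ring. }
    assert (D : cderiv (fun y => (Cexp_rest w (S K) y + ((RtoC (- (y ^ S K / INR (fact (S K))))) * Cpow w (S K)))%C) r
      ((w * Cexp_rest w K r) + (((RtoC (- (r ^ K / INR (fact K)))) * Cpow w (S K)) + ((RtoC (- (r ^ S K / INR (fact (S K))))) * RtoC 0)))%C).
    { apply cderiv_plus; [exact IH|].
      apply (cderiv_real_mult (fun y => - (y ^ S K / INR (fact (S K)))) (- (r ^ K / INR (fact K))) (fun _ => Cpow w (S K))).
      - apply (is_derive_opp (fun y => y ^ S K / INR (fact (S K)))). apply is_derive_pow_fact.
      - apply cderiv_const. }
    assert (E : forall y, (Cexp_rest w (S K) y + ((RtoC (- (y ^ S K / INR (fact (S K))))) * Cpow w (S K)))%C = Cexp_rest w (S (S K)) y).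
    { intros y. unfold Cexp_rest. rewrite RtoC_opp. change (csum ?g (S (S K))) with (csum g (S K) + g (S K))%C. cbv beta. ring. }
    destruct D as [D1 D2]. split.
    + eapply is_derive_ext; [|exact D1]. intros y. cbv beta. now rewrite E.
    + eapply is_derive_ext; [|exact D2]. intros y. cbv beta. now rewrite E.
Qed.

Lemma integrate_power_bound f f' M K r : 0 <= r <= 1 -> f 0 = 0 ->
  (forall x, is_derive f x (f' x)) ->
  (forall x, 0 <= x <= 1 -> Rabs (f' x) <= M * (x ^ K / INR (fact K))) ->
  Rabs (f r) <= M * (r ^ S K / INR (fact (S K))).
Proof.
  intros Hr H0 Hd Hb.
  assert (Hz : 0 ^ S K / INR (fact (S K)) = 0) by (rewrite pow_i by lia; unfold Rdiv; ring).
  assert (DM : forall x, is_derive (fun x => M * (x ^ S K / INR (fact (S K)))) x (M * (x ^ K / INR (fact K)))).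
  { intros x. apply (is_derive_scal (fun x => x ^ S K / INR (fact (S K)))). apply is_derive_pow_fact. }
  apply Rabs_le. split.
  - pose proof (derive_nonneg_le (fun x => M * (x ^ S K / INR (fact (S K))) + f x) (fun x => M * (x ^ K / INR (fact K)) + f' x) 0 r ltac:(lra)) as D.
    cbv beta in D. rewrite Hz, H0 in D. enough (M * 0 + 0 <= M * (r ^ S K / INR (fact (S K))) + f r) by lra.
    apply D.
    + intros x _. apply (is_derive_plus (fun x => M * (x ^ S K / INR (fact (S K)))) f); auto.
    + intros x Hx. specialize (Hb x ltac:(lra)). apply Rabs_le_between in Hb. lra.
  - pose proof (derive_nonneg_le (fun x => M * (x ^ S K / INR (fact (S K))) - f x) (fun x => M * (x ^ K / INR (fact K)) - f' x) 0 r ltac:(lra)) as D.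
    cbv beta in D. rewrite Hz, H0 in D. enough (M * 0 - 0 <= M * (r ^ S K / INR (fact (S K))) - f r) by lra.
    apply D.
    + intros x _. apply (is_derive_minus (fun x => M * (x ^ S K / INR (fact (S K)))) f); auto.
    + intros x Hx. specialize (Hb x ltac:(lra)). apply Rabs_le_between in Hb. lra.
Qed.

(** The rest of order [K + 1] vanishes at 0 and has [w] times the rest of order [K] as
    derivative.  Each integration gains a factor [r / (K + 1)] and loses at most
    [2 |w|], the 2 being the price of estimating both components separately. *)
Lemma Cexp_rest_bound w K r : 0 <= r <= 1 ->
  Rabs (Re (Cexp_rest w K r)) <= exp (Cmod w) * (2 * Cmod w) ^ K * (r ^ K / INR (fact K)) /\
  Rabs (Im (Cexp_rest w K r)) <= exp (Cmod w) * (2 * Cmod w) ^ K * (r ^ K / INR (fact K)).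
Proof.
  revert r. induction K as [|K IH]; intros r Hr.
  - simpl pow. simpl fact. change (INR 1) with 1. rewrite Rdiv_1_r, !Rmult_1_r.
    assert (E : Cexp_rest w 0 r = Cexp (RtoC r * w)%C) by (unfold Cexp_rest; simpl; ring).
    rewrite E.
    assert (B : Cmod (Cexp (RtoC r * w)%C) <= exp (Cmod w)).
    { rewrite Cmod_Cexp. apply exp_le. eapply Rle_trans; [apply Rle_abs|].
      eapply Rle_trans; [apply re_le_Cmod|]. rewrite Cmod_mult, Cmod_R, Rabs_right by lra.
      pose proof (Cmod_ge_0 w). nra. }
    split; [eapply Rle_trans; [apply re_le_Cmod|exact B]|eapply Rle_trans; [apply im_le_Cmod|exact B]].
  - set (M := exp (Cmod w) * (2 * Cmod w) ^ K) in *.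
    replace (exp (Cmod w) * (2 * Cmod w) ^ S K) with (M * (2 * Cmod w)) by (unfold M; simpl; ring).
    assert (H0 : Cexp_rest w (S K) 0 = RtoC 0).
    { clear. unfold Cexp_rest. rewrite <- (Nat.add_1_l K), csum_add. simpl csum at 1.
      rewrite (csum_ext _ (fun _ => (RtoC 0 * RtoC 0)%C)).
      - rewrite csum_scal. replace (RtoC 0 * w)%C with (RtoC 0) by ring.
        unfold Cexp, RtoC; simpl. rewrite exp_0, cos_0, sin_0. change (1, 0) with (RtoC 1).
        unfold Cplus, Copp, Cmult; simpl. f_equal; field.
      - intros k _. rewrite pow_i by lia. unfold Rdiv. rewrite Rmult_0_l. ring. }
    assert (HD : forall x, 0 <= x <= 1 -> Cmod (w * Cexp_rest w K x)%C <= M * (2 * Cmod w) * (x ^ K / INR (fact K))).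
    { intros x Hx. rewrite Cmod_mult. destruct (IH x Hx) as [I1 I2].
      pose proof (Cmod_le_re_im (Cexp_rest w K x)). pose proof (Cmod_ge_0 w).
      set (T := x ^ K / INR (fact K)) in *. clearbody T.
      assert (Cmod (Cexp_rest w K x) <= 2 * (M * T)) by lra. nra. }
    split.
    + apply (integrate_power_bound (fun r => Re (Cexp_rest w (S K) r)) (fun r => Re (w * Cexp_rest w K r)%C)); [exact Hr| | |].
      * now rewrite H0.
      * intros x. apply cderiv_Cexp_rest.
      * intros x Hx. eapply Rle_trans; [apply re_le_Cmod|]. now apply HD.
    + apply (integrate_power_bound (fun r => Im (Cexp_rest w (S K) r)) (fun r => Im (w * Cexp_rest w K r)%C)); [exact Hr| | |].
      * now rewrite H0.
      * intros x. apply cderiv_Cexp_rest.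
      * intros x Hx. eapply Rle_trans; [apply im_le_Cmod|]. now apply HD.
Qed.

Lemma Cexp_series w : Ccv (csum (Cexp_term w)) (Cexp w).
Proof.
  intros eps He.
  assert (Hc : 0 < eps / (2 * exp (Cmod w))).
  { apply Rdiv_lt_0_compat; [exact He|]. pose proof (exp_pos (Cmod w)). lra. }
  destruct (cv_speed_pow_fact (2 * Cmod w) _ Hc) as [N HN].
  exists N. intros n Hn. specialize (HN n Hn). unfold R_dist in HN. rewrite Rminus_0_r in HN.
  assert (H0 : 0 <= (2 * Cmod w) ^ n / INR (fact n)).
  { apply Rdiv_le_0_compat; [apply pow_le; pose proof (Cmod_ge_0 w); lra|apply INR_fact_lt_0]. }
  rewrite Rabs_right in HN by lra.
  destruct (Cexp_rest_bound w n 1 ltac:(lra)) as [B1 B2].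
  pose proof (Cmod_le_re_im (Cexp_rest w n 1)) as B.
  rewrite Cmod_minus_sym.
  replace (Cexp w - csum (Cexp_term w) n)%C with (Cexp_rest w n 1).
  - rewrite pow1 in B1, B2.
    replace (exp (Cmod w) * (2 * Cmod w) ^ n * (1 / INR (fact n))) with
      (exp (Cmod w) * ((2 * Cmod w) ^ n / INR (fact n))) in * by (unfold Rdiv; ring).
    pose proof (exp_pos (Cmod w)) as Ep.
    apply (Rmult_lt_compat_l (2 * exp (Cmod w))) in HN; [|lra].
    replace (2 * exp (Cmod w) * (eps / (2 * exp (Cmod w)))) with eps in HN by (field; lra). lra.
  - unfold Cexp_rest, Cminus. f_equal.
    + f_equal. ring.
    + f_equal. apply csum_ext. intros k _. unfold Cexp_term. rewrite pow1. unfold Rdiv. now rewrite Rmult_1_l.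
Qed.

Lemma pow_fact_le_exp k y : 0 <= y -> y ^ k / INR (fact k) <= exp y.
Proof.
  revert y. induction k as [|k IH]; intros y Hy.
  - simpl. rewrite Rdiv_1_r. rewrite <- exp_0. now apply exp_le.
  - pose proof (derive_nonneg_le (fun x => exp x - x ^ S k / INR (fact (S k))) (fun x => exp x - x ^ k / INR (fact k)) 0 y Hy) as D.
    cbv beta in D. rewrite exp_0, pow_i in D by lia.
    assert (1 - 0 / INR (fact (S k)) <= exp y - y ^ S k / INR (fact (S k))).
    { apply D.
      - intros x _. apply (is_derive_minus exp (fun x => x ^ S k / INR (fact (S k)))); [apply is_derive_exp|apply is_derive_pow_fact].
      - intros x Hx. specialize (IH x ltac:(lra)). lra. }
    unfold Rdiv in *. rewrite Rmult_0_l in *. lra.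
Qed.

(** * Powers and their Taylor coefficients in the exponent *)

Definition cpow (x : R) (a : C) : C := Cexp (- (a * RtoC (ln x)))%C.

Lemma cpow_re_im x a : cpow x a =
  (exp (- Re a * ln x) * cos (- Im a * ln x), exp (- Re a * ln x) * sin (- Im a * ln x)).
Proof.
  destruct a as [u v]. unfold cpow, Cexp; simpl.
  replace (- (u * ln x - v * 0)) with (- u * ln x) by ring.
  replace (- (u * 0 + v * ln x)) with (- v * ln x) by ring. reflexivity.
Qed.

Lemma Cmod_cpow x a : Cmod (cpow x a) = exp (- Re a * ln x).
Proof.
  unfold cpow. rewrite Cmod_Cexp. f_equal. destruct a as [u v]; simpl. ring.
Qed.

Lemma cpow_plus x a b : cpow x (a + b)%C = (cpow x a * cpow x b)%C.
Proof. unfold cpow. rewrite <- Cexp_plus. f_equal. ring. Qed.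

Lemma cpow_real x c : cpow x (RtoC c) = RtoC (exp (- c * ln x)).
Proof. rewrite cpow_re_im. simpl. replace (- 0 * ln x) with 0 by ring. rewrite cos_0, sin_0. unfold RtoC. f_equal; ring. Qed.

Lemma cpow_succ x a : 0 < x -> cpow x (a + RtoC 1)%C = (RtoC (/ x) * cpow x a)%C.
Proof.
  intros Hx. rewrite cpow_plus, cpow_real.
  replace (exp (- (1) * ln x)) with (/ x); [ring|].
  replace (- (1) * ln x) with (- ln x) by ring. now rewrite exp_Ropp, exp_ln.
Qed.

Lemma cderiv_cpow x a : 0 < x -> cderiv (fun x => cpow x a) x (- (a * (cpow x (a + RtoC 1)%C)))%C.
Proof.
  intros Hx. rewrite cpow_succ by exact Hx.
  destruct a as [u v]. split.
  - apply is_derive_ext with (fun x => exp (- u * ln x) * cos (- v * ln x)).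
    { intros y. now rewrite cpow_re_im. }
    rewrite cpow_re_im. simpl. auto_derive; [easy|]. field. lra.
  - apply is_derive_ext with (fun x => exp (- u * ln x) * sin (- v * ln x)).
    { intros y. now rewrite cpow_re_im. }
    rewrite cpow_re_im. simpl. auto_derive; [easy|]. field. lra.
Qed.

(** The coefficient of [z^k] in [x^(- a - z)]. *)
Definition cpow_coef (a : C) (k : nat) (x : R) : C :=
  (RtoC ((- ln x) ^ k / INR (fact k)) * cpow x a)%C.

(** The [j]-th derivative in [x] of [cpow_coef a k x].  Differentiation in [x] multiplies
    [x^(- a - z)] by [- (a + z) / x]; the recursion is this rule read on the
    coefficients of the powers of [z]. *)
Fixpoint cpow_D (j : nat) (a : C) (k : nat) (x : R) : C :=
  match j with
  | O => cpow_coef a k x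
  | S i => (- ((a * (cpow_D i (a + RtoC 1)%C k x)) + (match k with O => RtoC 0 | S l => cpow_D i (a + RtoC 1)%C l x end)))%C
  end.

Lemma cderiv_cpow_D j a k x : 0 < x -> cderiv (cpow_D j a k) x (cpow_D (S j) a k x).
Proof.
  intros Hx. revert a k. induction j as [|j IH]; intros a k.
  - pose proof (cderiv_cpow x a Hx) as Dp. destruct k as [|k].
    + apply cderiv_eq with ((RtoC 0 * cpow x a) + (RtoC ((- ln x) ^ 0 / INR (fact 0)) * (- (a * (cpow x (a + RtoC 1)%C)))))%C.
      { cbn [cpow_D]. unfold cpow_coef. ring. }
      apply (cderiv_real_mult (fun x => (- ln x) ^ 0 / INR (fact 0)) 0 (fun x => cpow x a)); [|exact Dp].
      simpl. apply is_derive_const_R.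
    + apply cderiv_eq with (((RtoC (- / x * ((- ln x) ^ k / INR (fact k)))) * cpow x a) + ((RtoC ((- ln x) ^ S k / INR (fact (S k)))) * (- (a * (cpow x (a + RtoC 1)%C)))))%C.
      { cbn [cpow_D]. unfold cpow_coef. rewrite (cpow_succ x a Hx), RtoC_mult, RtoC_opp. ring. }
      apply (cderiv_real_mult (fun x => (- ln x) ^ S k / INR (fact (S k))) (- / x * ((- ln x) ^ k / INR (fact k))) (fun x => cpow x a)); [|exact Dp].
      apply (is_derive_comp (fun y => y ^ S k / INR (fact (S k))) (fun x => - ln x)).
      * apply is_derive_pow_fact.
      * auto_derive; [exact Hx|]. field. lra.
  - apply cderiv_eq with (RtoC (-1) * ((a * (cpow_D (S j) (a + RtoC 1)%C k x)) + (match k with O => RtoC 0 | S l => cpow_D (S j) (a + RtoC 1)%C l x end)))%C.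
    { change (cpow_D (S (S j)) a k x) with (- ((a * (cpow_D (S j) (a + RtoC 1)%C k x)) + (match k with O => RtoC 0 | S l => cpow_D (S j) (a + RtoC 1)%C l x end)))%C.
      set (X := (_ + _)%C). replace (RtoC (-1)) with (- RtoC 1)%C by (now rewrite <- RtoC_opp). ring. }
    assert (D : cderiv (fun y => (RtoC (-1) * ((a * (cpow_D j (a + RtoC 1)%C k y)) + (match k with O => RtoC 0 | S l => cpow_D j (a + RtoC 1)%C l y end)))%C) x
      (RtoC (-1) * ((a * (cpow_D (S j) (a + RtoC 1)%C k x)) + (match k with O => RtoC 0 | S l => cpow_D (S j) (a + RtoC 1)%C l x end)))%C).
    { apply cderiv_scal, cderiv_plus; [apply cderiv_scal, IH|].
      destruct k as [|l]; [apply cderiv_const|apply IH]. }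
    assert (E : forall y, (RtoC (-1) * ((a * (cpow_D j (a + RtoC 1)%C k y)) + (match k with O => RtoC 0 | S l => cpow_D j (a + RtoC 1)%C l y end)))%C = cpow_D (S j) a k y).
    { intros y. simpl. set (X := ((_ * _) + _)%C). replace (RtoC (-1)) with (- RtoC 1)%C by (now rewrite <- RtoC_opp). ring. }
    destruct D as [D1 D2]. split.
    + eapply is_derive_ext; [|exact D1]. intros y. cbv beta. now rewrite E.
    + eapply is_derive_ext; [|exact D2]. intros y. cbv beta. now rewrite E.
Qed.

(** [(A + 1) ... (A + j)], a majorant of the factors produced by [j] derivatives. *)
Fixpoint rising (j : nat) (A : R) : R :=
  match j with O => 1 | S i => (A + 1) * rising i (A + 1) end.

Lemma rising_le j A B : 0 <= A <= B -> 0 < rising j A <= rising j B.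
Proof.
  revert A B. induction j as [|j IH]; intros A B H; simpl; [lra|].
  destruct (IH (A + 1) (B + 1)) as [I1 I2]; [lra|]. split; [nra|]. apply Rmult_le_compat; lra.
Qed.

(** From [(ln x / 2)^k / k! <= sqrt x]: half a power of [x] is given up in order to
    have coefficients that grow only geometrically in [k]. *)
Lemma cpow_D_bound j a k x : 1 <= x ->
  Cmod (cpow_D j a k x) <= rising j (Cmod a) * 2 ^ k * exp ((/ 2 - Re a - INR j) * ln x).
Proof.
  intros Hx. assert (HL : 0 <= ln x) by (rewrite <- ln_1; apply ln_le; lra).
  revert a k. induction j as [|j IH]; intros a k.
  - simpl cpow_D. unfold cpow_coef. rewrite Cmod_mult, Cmod_R, Cmod_cpow. simpl rising. rewrite Rmult_1_l.
    replace ((/ 2 - Re a - INR 0) * ln x) with (/ 2 * ln x + - Re a * ln x) by (simpl; ring).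
    rewrite exp_plus, <- Rmult_assoc. apply Rmult_le_compat_r; [apply Rlt_le, exp_pos|].
    unfold Rdiv. rewrite Rabs_mult, <- RPow_abs, Rabs_Ropp, (Rabs_right (ln x)) by lra.
    rewrite Rabs_right by (apply Rle_ge, Rlt_le, Rinv_0_lt_compat, INR_fact_lt_0).
    pose proof (pow_fact_le_exp k (/ 2 * ln x) ltac:(lra)) as P.
    apply (Rmult_le_compat_l (2 ^ k)) in P; [|apply pow_le; lra].
    eapply Rle_trans; [|exact P]. right. rewrite Rpow_mult_distr, pow_inv. field.
    split; [apply pow_nonzero; lra|apply INR_fact_neq_0].
  - set (b := (a + RtoC 1)%C).
    assert (Hb : Cmod b <= Cmod a + 1).
    { unfold b. eapply Rle_trans; [apply Cmod_triangle|]. rewrite Cmod_1. lra. }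
    assert (Eb : (/ 2 - Re b - INR j) * ln x = (/ 2 - Re a - INR (S j)) * ln x).
    { f_equal. rewrite S_INR. unfold b, Cplus, Re; simpl. ring. }
    pose proof (Cmod_ge_0 b) as Hb0. pose proof (Cmod_ge_0 a) as Ha0.
    destruct (rising_le j (Cmod b) (Cmod a + 1)) as [R1 R2]; [lra|].
    assert (Hk : forall l, Cmod (cpow_D j b l x) <= rising j (Cmod a + 1) * (2 ^ l * exp ((/ 2 - Re a - INR (S j)) * ln x))).
    { intros l. specialize (IH b l). rewrite Eb in IH. eapply Rle_trans; [exact IH|].
      rewrite Rmult_assoc. apply Rmult_le_compat_r; [|exact R2].
      apply Rmult_le_pos; [apply pow_le; lra|apply Rlt_le, exp_pos]. }
    simpl cpow_D. fold b. rewrite Cmod_opp.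
    eapply Rle_trans; [apply Cmod_triangle|]. rewrite Cmod_mult.
    simpl rising. set (Rj := rising j (Cmod a + 1)) in *.
    set (X := exp ((/ 2 - Re a - INR (S j)) * ln x)) in *.
    assert (HX : 0 < X) by apply exp_pos.
    assert (H2 : forall l, 0 < Rj * (2 ^ l * X)).
    { intros l. apply Rmult_lt_0_compat; [lra|]. apply Rmult_lt_0_compat; [apply pow_lt; lra|exact HX]. }
    assert (Hl : Cmod (match k with O => RtoC 0 | S l => cpow_D j b l x end) <= Rj * (2 ^ k * X)).
    { destruct k as [|l]; [rewrite Cmod_0; apply Rlt_le, H2|].
      eapply Rle_trans; [apply Hk|]. specialize (H2 l). simpl pow. lra. }
    specialize (Hk k). specialize (H2 k).
    replace ((Cmod a + 1) * Rj * 2 ^ k * X) with (Cmod a * (Rj * (2 ^ k * X)) + Rj * (2 ^ k * X)) by ring.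
    apply Rplus_le_compat; [apply Rmult_le_compat_l; lra|exact Hl].
Qed.

Lemma cpow_D3_0 a x : cpow_D 3 a 0 x =
  (- (((a * (a + RtoC 1)) * (a + RtoC 2)) * (cpow x (a + RtoC 3)%C)))%C.
Proof.
  simpl. unfold cpow_coef. simpl.
  replace (((a + RtoC 1) + RtoC 1) + RtoC 1)%C with (a + RtoC 3)%C.
  - replace ((a + RtoC 1) + RtoC 1)%C with (a + RtoC 2)%C.
    + replace (RtoC (1 / 1)) with (RtoC 1) by (f_equal; field). ring.
    + replace 2 with (1 + 1) by ring. rewrite RtoC_plus. ring.
  - replace 3 with (1 + 1 + 1) by ring. rewrite !RtoC_plus. ring.
Qed.

(** * The trapezoidal rule *)

(** As a function of the upper end point [x], the error vanishes to second order at
    [n] and has second derivative [- (x - n) f3 x / 2]. *)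
Lemma trapezoid (f0 f1 f2 f3 : R -> R) n M :
  (forall x, n <= x <= n + 1 -> is_derive f0 x (f1 x)) ->
  (forall x, n <= x <= n + 1 -> is_derive f1 x (f2 x)) ->
  (forall x, n <= x <= n + 1 -> is_derive f2 x (f3 x)) ->
  (forall x, n <= x <= n + 1 -> Rabs (f3 x) <= M) ->
  Rabs (f0 (n + 1) - f0 n - (f1 n + f1 (n + 1)) / 2) <= M / 2.
Proof.
  intros D0 D1 D2 B.
  assert (HM : 0 <= M) by (eapply Rle_trans; [apply Rabs_pos|apply (B n); lra]).
  set (g1 := fun x => (f1 x - f1 n) / 2 - (x - n) * f2 x / 2).
  assert (G1 : forall y, n <= y <= n + 1 -> Rabs (g1 y) <= M / 2).
  { intros y Hy. assert (K : Rabs (g1 y - g1 n) <= M / 2 * (y - n)).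
    { apply (derive_bounded_le g1 (fun x => - ((x - n) * f3 x / 2))); [lra| |].
      - intros x Hx. unfold g1.
        assert (D : is_derive (fun x => / 2 * (f1 x - f1 n) - / 2 * ((x - n) * f2 x)) x
          (/ 2 * (f2 x - 0) - / 2 * (1 * f2 x + (x - n) * f3 x))).
        { apply (is_derive_minus (fun x => / 2 * (f1 x - f1 n)) (fun x => / 2 * ((x - n) * f2 x))).
          - apply (is_derive_scal (fun x => f1 x - f1 n)). apply (is_derive_minus f1 (fun _ => f1 n)); [apply D1; lra|].
            apply is_derive_const_R.
          - apply (is_derive_scal (fun x => (x - n) * f2 x)).
            apply (is_derive_mult (fun x => x - n) f2 x 1 (f3 x)); [auto_derive; [easy|ring]|apply D2; lra|intros; apply Rmult_comm]. }
        eapply is_derive_ext; [|replace (- ((x - n) * f3 x / 2)) with (/ 2 * (f2 x - 0) - / 2 * (1 * f2 x + (x - n) * f3 x)) by field; exact D].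
        intros z. simpl. eqR. field.
      - intros x Hx. specialize (B x ltac:(lra)). rewrite Rabs_Ropp. unfold Rdiv. rewrite !Rabs_mult.
        rewrite (Rabs_right (x - n)), (Rabs_right (/ 2)) by lra. pose proof (Rabs_pos (f3 x)). nra. }
    replace (g1 n) with 0 in K by (unfold g1; field). rewrite Rminus_0_r in K. nra. }
  set (g := fun x => f0 x - f0 n - (x - n) * (f1 n + f1 x) / 2).
  assert (K : Rabs (g (n + 1) - g n) <= M / 2 * (n + 1 - n)).
  { apply (derive_bounded_le g g1); [lra| |exact G1].
    intros x Hx. unfold g.
    assert (D : is_derive (fun x => (f0 x - f0 n) - / 2 * ((x - n) * (f1 n + f1 x))) x
       ((f1 x - 0) - / 2 * (1 * (f1 n + f1 x) + (x - n) * (0 + f2 x)))).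
    { apply (is_derive_minus (fun x => f0 x - f0 n) (fun x => / 2 * ((x - n) * (f1 n + f1 x)))).
      - apply (is_derive_minus f0 (fun _ => f0 n)); [apply D0; lra|].
        apply is_derive_const_R.
      - apply (is_derive_scal (fun x => (x - n) * (f1 n + f1 x))).
        apply (is_derive_mult (fun x => x - n) (fun x => f1 n + f1 x) x 1 (0 + f2 x)); [auto_derive; [easy|ring]| |intros; apply Rmult_comm].
        apply (is_derive_plus (fun _ => f1 n) f1); [|apply D1; lra].
        apply is_derive_const_R. }
    eapply is_derive_ext; [|replace (g1 x) with ((f1 x - 0) - / 2 * (1 * (f1 n + f1 x) + (x - n) * (0 + f2 x))) by (unfold g1; field); exact D].
    intros z. simpl. eqR. field. }
  replace (g n) with 0 in K by (unfold g; field). unfold g in K.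
  replace (f0 (n + 1) - f0 n - (f1 n + f1 (n + 1)) / 2) with
    (f0 (n + 1) - f0 n - (n + 1 - n) * (f1 n + f1 (n + 1)) / 2 - 0) by field. lra.
Qed.

(** The error of the trapezoidal rule for the derivative of [x^(- a)] on [n, n + 1],
    or rather the coefficient of [z^k] in this error for the exponent [a + z]. *)
Definition trap_coef (a : C) (n : R) (k : nat) : C :=
  ((cpow_D 0 a k (n + 1) - cpow_D 0 a k n) - (RtoC (/ 2) * (cpow_D 1 a k n + cpow_D 1 a k (n + 1))))%C.

Lemma trap_coef_bound a n k M : 1 <= n ->
  (forall x, n <= x <= n + 1 -> Cmod (cpow_D 3 a k x) <= M) -> Cmod (trap_coef a n k) <= M.
Proof.
  intros Hn HM. eapply Rle_trans; [apply Cmod_le_re_im|].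
  assert (B1 : Rabs (Re (trap_coef a n k)) <= M / 2).
  { replace (Re (trap_coef a n k)) with (Re (cpow_D 0 a k (n + 1)) - Re (cpow_D 0 a k n)
      - (Re (cpow_D 1 a k n) + Re (cpow_D 1 a k (n + 1))) / 2).
    2:{ unfold trap_coef, Cminus, Cplus, Copp, Cmult, RtoC, Re; cbn [fst snd]. field. }
    apply (trapezoid (fun x => Re (cpow_D 0 a k x)) (fun x => Re (cpow_D 1 a k x))
      (fun x => Re (cpow_D 2 a k x)) (fun x => Re (cpow_D 3 a k x))).
    1-3: intros; apply cderiv_cpow_D; lra.
    intros x Hx. eapply Rle_trans; [apply re_le_Cmod|]. now apply HM. }
  assert (B2 : Rabs (Im (trap_coef a n k)) <= M / 2).
  { replace (Im (trap_coef a n k)) with (Im (cpow_D 0 a k (n + 1)) - Im (cpow_D 0 a k n)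
      - (Im (cpow_D 1 a k n) + Im (cpow_D 1 a k (n + 1))) / 2).
    2:{ unfold trap_coef, Cminus, Cplus, Copp, Cmult, RtoC, Im; cbn [fst snd]. field. }
    apply (trapezoid (fun x => Im (cpow_D 0 a k x)) (fun x => Im (cpow_D 1 a k x))
      (fun x => Im (cpow_D 2 a k x)) (fun x => Im (cpow_D 3 a k x))).
    1-3: intros; apply cderiv_cpow_D; lra.
    intros x Hx. eapply Rle_trans; [apply im_le_Cmod|]. now apply HM. }
  lra.
Qed.

(** * Analytic continuation of zeta to the critical line *)

Lemma Ccv_unshift u l : Ccv (fun n => u (S n)) l -> Ccv u l.
Proof.
  intros H eps He. destruct (H eps He) as [N HN]. exists (S N). intros [|n] Hn; [lia|]. apply HN. lia.
Qed.

Lemma Ccv_minus u v a b : Ccv u a -> Ccv v b -> Ccv (fun n => (u n - v n)%C) (a - b)%C.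
Proof.
  intros Ha Hb. apply Ccv_ext with (fun n => (u n + (RtoC (-1) * v n))%C).
  - intros n. replace (RtoC (-1)) with (- RtoC 1)%C by (now rewrite <- RtoC_opp). ring.
  - replace (a - b)%C with (a + (RtoC (-1) * b))%C.
    + apply Ccv_plus; [exact Ha|now apply Ccv_scal].
    + replace (RtoC (-1)) with (- RtoC 1)%C by (now rewrite <- RtoC_opp). ring.
Qed.

Lemma cpow_coef_series a z x :
  Ccv (csum (fun k => (cpow_coef a k x * Cpow z k)%C)) (cpow_coef (a + z)%C 0 x).
Proof.
  set (w := (- (z * RtoC (ln x)))%C).
  replace (cpow_coef (a + z)%C 0 x) with (cpow x a * Cexp w)%C.
  - apply Ccv_ext with (fun n => (cpow x a * csum (Cexp_term w) n)%C).
    + intros n. rewrite <- csum_scal. apply csum_ext. intros k _.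
      unfold Cexp_term, cpow_coef, w.
      replace (- (z * RtoC (ln x)))%C with (RtoC (- ln x) * z)%C by (rewrite RtoC_opp; ring).
      rewrite Cpow_mult_l, <- RtoC_pow. unfold Rdiv. rewrite RtoC_mult. ring.
    + apply Ccv_scal, Cexp_series.
  - change (Cexp w) with (cpow x z). unfold cpow_coef. rewrite cpow_plus.
    replace (RtoC ((- ln x) ^ 0 / INR (fact 0))) with (RtoC 1) by (f_equal; simpl; field). ring.
Qed.

Lemma cpow_D1_series a z x :
  Ccv (csum (fun k => (cpow_D 1 a k x * Cpow z k)%C)) (cpow_D 1 (a + z)%C 0 x).
Proof.
  set (b := (a + RtoC 1)%C). set (u := csum (fun k => (cpow_coef b k x * Cpow z k)%C)).
  assert (Hu : Ccv u (cpow_coef (b + z)%C 0 x)) by apply cpow_coef_series.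
  apply Ccv_unshift.
  apply Ccv_ext with (fun n => (((- a) * u (S n)) + ((- z) * u n))%C).
  - intros n. induction n as [|n IH].
    + unfold u. cbn [csum cpow_D Cpow]. fold b. ring.
    + change (csum ?g (S (S n))) with (csum g (S n) + g (S n))%C. rewrite <- IH.
      unfold u. cbn [csum cpow_D Cpow]. fold b. ring.
  - replace (cpow_D 1 (a + z)%C 0 x) with
      (((- a) * (cpow_coef (b + z)%C 0 x)) + ((- z) * (cpow_coef (b + z)%C 0 x)))%C.
    + apply Ccv_plus; apply Ccv_scal; [now apply (Ccv_shift u)|exact Hu].
    + cbn [cpow_D]. replace ((a + z) + RtoC 1)%C with (b + z)%C by (unfold b; ring). ring.
Qed.

Lemma trap_coef_series a z n :
  Ccv (csum (fun k => (trap_coef a n k * Cpow z k)%C)) (trap_coef (a + z)%C n 0).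
Proof.
  set (D0 := fun x => csum (fun k => (cpow_D 0 a k x * Cpow z k)%C)).
  set (D1 := fun x => csum (fun k => (cpow_D 1 a k x * Cpow z k)%C)).
  assert (H0 : forall x, Ccv (D0 x) (cpow_D 0 (a + z)%C 0 x)) by (intros; apply cpow_coef_series).
  assert (H1 : forall x, Ccv (D1 x) (cpow_D 1 (a + z)%C 0 x)) by (intros; apply cpow_D1_series).
  apply Ccv_ext with (fun m => ((D0 (n + 1)%R m - D0 n m) - (RtoC (/ 2) * (D1 n m + D1 (n + 1)%R m)))%C).
  - intros m. induction m as [|m IH]; unfold D0, D1 in *.
    + cbn [csum]. ring.
    + cbn [csum]. rewrite <- IH. unfold trap_coef. ring.
  - unfold trap_coef. apply Ccv_minus; [now apply Ccv_minus|]. apply Ccv_scal. now apply Ccv_plus.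
Qed.

Definition trap_term (s : C) (i : nat) : C := trap_coef (s - RtoC 1)%C (INR (S i)) 0.
(** For [Re s > 1] this telescopes to [(s - 1) zeta s - 1 - (s - 1) / 2], but the terms
    are [O(n^(-2))] as soon as [Re s >= 1/2]: it is the analytic continuation. *)
Definition trap_sum (s : C) : C := Clim (csum (trap_term s)).

Lemma rsum_inv_sq n : rsum (fun i => / INR (S i) ^ 2) n <= 2.
Proof.
  unfold rsum. rewrite (sum1_ext _ (fun k => / INR k ^ 2)).
  - apply sum1_inv_sq.
  - intros k Hk. now replace (S (pred k)) with k by lia.
Qed.

Lemma trap_coef_decay s0 i k : / 2 <= Re s0 ->
  Cmod (trap_coef (s0 - RtoC 1)%C (INR (S i)) k)
  <= rising 3 (Cmod (s0 - RtoC 1)%C) * / INR (S i) ^ 2 * 2 ^ k.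
Proof.
  intros Hs. set (a := (s0 - RtoC 1)%C). assert (Hn : 1 <= INR (S i)) by (apply INR_ge_1; lia).
  apply trap_coef_bound; [exact Hn|]. intros x Hx.
  eapply Rle_trans; [apply cpow_D_bound; lra|].
  assert (Ra : Re a = Re s0 - 1) by (unfold a, Cminus, Cplus, Copp, Re; simpl; ring).
  destruct (rising_le 3 (Cmod a) (Cmod a)) as [R1 _]; [pose proof (Cmod_ge_0 a); lra|].
  assert (E : exp ((/ 2 - Re a - INR 3) * ln x) <= / INR (S i) ^ 2).
  { rewrite Ra. assert (L1 : 0 <= ln (INR (S i))) by (rewrite <- ln_1; apply ln_le; lra).
    assert (L2 : ln (INR (S i)) <= ln x) by (apply ln_le; lra).
    replace (/ INR (S i) ^ 2) with (exp (- (2 * ln (INR (S i))))).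
    - apply exp_le. replace (INR 3) with 3 by (simpl; ring). nra.
    - rewrite exp_Ropp. f_equal. replace (2 * ln (INR (S i))) with (ln (INR (S i)) + ln (INR (S i))) by ring.
      rewrite exp_plus, exp_ln by lra. ring. }
  pose proof (pow_lt 2 k ltac:(lra)) as P.
  replace (rising 3 (Cmod a) * / INR (S i) ^ 2 * 2 ^ k) with (rising 3 (Cmod a) * 2 ^ k * / INR (S i) ^ 2) by ring.
  apply Rmult_le_compat_l; [|exact E]. apply Rlt_le, Rmult_lt_0_compat; assumption.
Qed.

Definition trap_sum_coef (s0 : C) (k : nat) : C :=
  Clim (csum (fun i => trap_coef (s0 - RtoC 1)%C (INR (S i)) k)).

(** The coefficients inherit the decay [O(n^(-2))] of the error of the trapezoidal
    rule, with a geometric growth [2^k] in the degree; hence the radius [1/4]. *)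
Lemma trap_sum_power_series s0 z : / 2 <= Re s0 -> Cmod z <= / 4 ->
  Ccv (csum (trap_term (s0 + z)%C)) (trap_sum (s0 + z)%C) /\
  Ccv (csum (fun k => (trap_sum_coef s0 k * Cpow z k)%C)) (trap_sum (s0 + z)%C).
Proof.
  intros Hs Hz. set (a := (s0 - RtoC 1)%C).
  destruct (series_of_power_series (fun i k => trap_coef a (INR (S i)) k)
    (fun i => rising 3 (Cmod a) * / INR (S i) ^ 2) (rising 3 (Cmod a) * 2) 2 z (trap_term (s0 + z)%C))
    as [E [H1 H2]].
  - lra.
  - lra.
  - intros i k. now apply trap_coef_decay.
  - intros n. rewrite rsum_scal. apply Rmult_le_compat_l; [|apply rsum_inv_sq].
    destruct (rising_le 3 (Cmod a) (Cmod a)) as [R1 _]; [pose proof (Cmod_ge_0 a); lra|lra].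
  - intros i. unfold trap_term.
    replace ((s0 + z) - RtoC 1)%C with (a + z)%C by (unfold a; ring). apply trap_coef_series.
  - assert (ET : trap_sum (s0 + z)%C = E) by (now apply Ccv_Clim). rewrite ET. now split.
Qed.

Lemma trap_sum_cv s : / 2 <= Re s -> Ccv (csum (trap_term s)) (trap_sum s).
Proof.
  intros Hs. destruct (trap_sum_power_series s (RtoC 0) Hs) as [H _]; [rewrite Cmod_0; lra|].
  replace (s + RtoC 0)%C with s in H by ring. exact H.
Qed.

Lemma nat_Cpow_opp_cpow k s : nat_Cpow_opp k s = cpow (INR k) s.
Proof. reflexivity. Qed.

Lemma cpow_1 a : cpow 1 a = RtoC 1.
Proof.
  unfold cpow. rewrite ln_1. replace (- (a * RtoC 0))%C with (RtoC 0) by ring.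
  unfold Cexp, RtoC; simpl. rewrite exp_0, cos_0, sin_0. f_equal; ring.
Qed.

(** The increments of [x^(1-s)] telescope, and the trapezoidal means add up to the
    partial sum of the Dirichlet series with the two extreme terms halved. *)
Lemma trap_partial_sum s N :
  csum (trap_term s) N =
  (((cpow (INR (S N)) (s - RtoC 1)%C) - RtoC 1) + ((s - RtoC 1) * (csum (fun i => nat_Cpow_opp (S i) s) (S N) - (RtoC (/ 2) * (RtoC 1 + cpow (INR (S N)) s)))))%C.
Proof.
  assert (Eh : (RtoC (/ 2) + RtoC (/ 2))%C = RtoC 1) by (rewrite <- RtoC_plus; f_equal; field).
  induction N as [|N IH].
  - cbn [csum]. rewrite !nat_Cpow_opp_cpow. change (INR 1) with 1. rewrite !cpow_1.
    transitivity ((s - RtoC 1) * (RtoC 1 - (RtoC (/ 2) + RtoC (/ 2))))%C; [|ring].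
    rewrite Eh. ring.
  - change (csum (trap_term s) (S N)) with (csum (trap_term s) N + trap_term s N)%C. rewrite IH.
    change (csum (fun i => nat_Cpow_opp (S i) s) (S (S N))) with
      (csum (fun i => nat_Cpow_opp (S i) s) (S N) + nat_Cpow_opp (S (S N)) s)%C.
    set (Sg := csum (fun i => nat_Cpow_opp (S i) s) (S N)). rewrite nat_Cpow_opp_cpow.
    unfold trap_term, trap_coef. cbn [cpow_D]. unfold cpow_coef.
    replace (RtoC ((- ln (INR (S N))) ^ 0 / INR (fact 0))) with (RtoC 1) by (f_equal; simpl; field).
    replace (RtoC ((- ln (INR (S N) + 1)) ^ 0 / INR (fact 0))) with (RtoC 1) by (f_equal; simpl; field).
    rewrite <- S_INR.
    replace ((s - RtoC 1) + RtoC 1)%C with s by ring.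
    set (X := cpow (INR (S (S N))) s). set (Y := cpow (INR (S N)) s).
    set (X1 := cpow (INR (S (S N))) (s - RtoC 1)%C). set (Y1 := cpow (INR (S N)) (s - RtoC 1)%C).
    set (h := RtoC (/ 2)) in *. set (c := (s - RtoC 1)%C).
    transitivity (((X1 - RtoC 1) + (c * (Sg - (h * (RtoC 1 + Y))))) + (c * (h * (Y + X))))%C; [ring|].
    transitivity ((X1 - RtoC 1) + (c * ((Sg - (h * (RtoC 1 + X))) + ((h + h) * X))))%C; [ring|].
    rewrite Eh. ring.
Qed.

Lemma cpow_tendsto_0 a : 0 < Re a -> Ccv (fun N => cpow (INR (S N)) a) (RtoC 0).
Proof.
  intros Ha eps He.
  destruct (nfloor_ex (exp (- ln eps / Re a))) as [N0 HN0]; [apply Rlt_le, exp_pos|].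
  exists (S N0). intros N HN. replace (cpow (INR (S N)) a - RtoC 0)%C with (cpow (INR (S N)) a) by ring.
  rewrite Cmod_cpow.
  assert (H1 : exp (- ln eps / Re a) < INR (S N)).
  { assert (INR (S N0) <= INR (S N)) by (apply le_INR; lia). rewrite (S_INR N0) in *. lra. }
  apply ln_increasing in H1; [|apply exp_pos]. rewrite ln_exp in H1.
  apply Rlt_div_l in H1; [|exact Ha].
  apply Rlt_le_trans with (exp (ln eps)); [apply exp_increasing; nra|rewrite exp_ln by exact He; apply Rle_refl].
Qed.

Lemma zeta_trap_right zeta s : is_riemann_zeta zeta -> 1 < Re s ->
  ((s - RtoC 1) * zeta s)%C =
  ((RtoC 1 + (RtoC (/ 2) * (s - RtoC 1))) + trap_sum s)%C.
Proof.
  intros [Hz _] Hs. specialize (Hz s Hs). apply is_series_Ccv in Hz.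
  set (c := (s - RtoC 1)%C).
  assert (Hc : 0 < Re c) by (unfold c, Cminus, Cplus, Copp, Re in *; simpl; lra).
  pose proof (trap_sum_cv s ltac:(lra)) as H1.
  pose proof (cpow_tendsto_0 c Hc) as P1. pose proof (cpow_tendsto_0 s ltac:(lra)) as P2.
  assert (H2 : Ccv (csum (trap_term s)) ((RtoC 0 - RtoC 1) + (c * (zeta s - (RtoC (/ 2) * (RtoC 1 + RtoC 0)))))%C).
  { eapply Ccv_ext; [intros n; symmetry; apply trap_partial_sum|].
    apply Ccv_plus; [apply Ccv_minus; [exact P1|apply Ccv_const]|].
    apply Ccv_scal, Ccv_minus; [apply (Ccv_shift _ _ Hz)|].
    apply Ccv_scal, Ccv_plus; [apply Ccv_const|exact P2]. }
  rewrite (Ccv_unique _ _ _ H1 H2). ring.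
Qed.

(** * The identity theorem on a segment *)

Lemma Ccv_bounded u l : Ccv u l -> exists M, forall n, Cmod (u n) <= M.
Proof.
  intros H. destruct (H 1 Rlt_0_1) as [N HN].
  assert (K : exists M0, forall n, (n <= N)%nat -> Cmod (u n) <= M0).
  { clear HN. induction N as [|N [M0 IH]].
    - exists (Cmod (u 0%nat)). intros n Hn. replace n with 0%nat by lia. lra.
    - exists (Rmax M0 (Cmod (u (S N)))). intros n Hn. destruct (Nat.eq_dec n (S N)) as [->|Hne].
      + apply Rmax_r.
      + eapply Rle_trans; [apply IH; lia|apply Rmax_l]. }
  destruct K as [M0 HM0]. exists (Rmax M0 (Cmod l + 1)). intros n.
  destruct (le_lt_dec n N) as [C|C].
  - eapply Rle_trans; [apply HM0, C|apply Rmax_l].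
  - eapply Rle_trans; [|apply Rmax_r]. specialize (HN n ltac:(lia)).
    pose proof (Cmod_triangle (u n - l)%C l) as T.
    replace ((u n - l) + l)%C with (u n) in T by ring. lra.
Qed.

Lemma power_series_coef_bound b z l : 0 < Cmod z ->
  Ccv (csum (fun k => (b k * Cpow z k)%C)) l ->
  exists B, forall k, Cmod (b k) <= B * (/ Cmod z) ^ k.
Proof.
  intros Hz H. destruct (Ccv_bounded _ _ H) as [M HM]. exists (2 * M). intros k.
  rewrite pow_inv. apply Rle_div_r; [now apply pow_lt|].
  rewrite <- Cmod_pow, <- Cmod_mult.
  pose proof (HM (S k)) as H1. pose proof (HM k) as H2. cbn [csum] in H1.
  set (T := csum (fun k => (b k * Cpow z k)%C) k) in *.
  pose proof (Cmod_triangle (T + (b k * Cpow z k))%C (- T)%C) as H3.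
  rewrite Cmod_opp in H3.
  replace ((T + (b k * Cpow z k)) + (- T))%C with (b k * Cpow z k)%C in H3 by ring. lra.
Qed.

Lemma is_pseries_Ccv a z l :
  is_pseries (K := C_AbsRing) (V := C_NormedModule) a z l ->
  Ccv (csum (fun k => (a k * Cpow z k)%C)) l.
Proof.
  intros H. apply is_series_Ccv in H. eapply Ccv_ext; [|exact H].
  intros n. apply csum_ext. intros k _.
  assert (E : pow_n (K := C_AbsRing) z k = Cpow z k).
  { induction k as [|k IH]; [reflexivity|]. cbn [pow_n Cpow]. rewrite IH. reflexivity. }
  rewrite E. unfold scal; simpl. apply Cmult_comm.
Qed.

Definition zeta_defect (zeta : C -> C) (s : C) : C :=
  (((s - RtoC 1) * zeta s) - ((RtoC 1 + (RtoC (/ 2) * (s - RtoC 1))) + trap_sum s))%C.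

Lemma zeta_defect_power_series zeta s0 : is_riemann_zeta zeta ->
  / 2 <= Re s0 -> s0 <> RtoC 1 ->
  exists b rho, 0 < rho /\ forall z, Cmod z < rho ->
    Ccv (csum (fun k => (b k * Cpow z k)%C)) (zeta_defect zeta (s0 + z)%C).
Proof.
  intros [_ Hz] Hs Hs1. destruct (Hz s0 Hs1) as (a & r & Hr & Ha).
  set (c := (s0 - RtoC 1)%C).
  set (p := fun k => match k with O => (RtoC 1 + (RtoC (/ 2) * c))%C | S O => RtoC (/ 2) | _ => RtoC 0 end).
  set (b := fun k => (((c * a k) + (match k with O => RtoC 0 | S l => a l end)) - (p k + trap_sum_coef s0 k))%C).
  exists b, (Rmin r (/ 4)). split; [apply Rmin_pos; lra|]. intros z Hzr.
  assert (Hz1 : Cmod z < r) by (eapply Rlt_le_trans; [exact Hzr|apply Rmin_l]).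
  assert (Hz2 : Cmod z <= / 4) by (eapply Rle_trans; [apply Rlt_le, Hzr|apply Rmin_r]).
  specialize (Ha (s0 + z)%C). replace ((s0 + z) - s0)%C with z in Ha by ring.
  specialize (Ha Hz1). apply is_pseries_Ccv in Ha.
  destruct (trap_sum_power_series s0 z Hs Hz2) as [_ Ht].
  set (u := csum (fun k => (a k * Cpow z k)%C)) in *.
  assert (H1 : Ccv (csum (fun k => ((match k with O => RtoC 0 | S l => a l end) * Cpow z k)%C)) (z * (zeta (s0 + z)%C))%C).
  { apply Ccv_unshift. apply Ccv_ext with (fun n => (z * u n)%C); [|now apply Ccv_scal].
    intros n. unfold u. induction n as [|n IH]; [cbn [csum]; ring|].
    change (csum ?g (S (S n))) with (csum g (S n) + g (S n))%C. rewrite <- IH. cbn [csum Cpow]. ring. }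
  assert (H2 : Ccv (csum (fun k => (p k * Cpow z k)%C)) (RtoC 1 + (RtoC (/ 2) * (c + z)))%C).
  { apply Ccv_unshift, Ccv_unshift.
    apply Ccv_ext with (fun n => (RtoC 1 + (RtoC (/ 2) * (c + z)))%C); [|apply Ccv_const].
    intros n. induction n as [|n IH]; [cbn [csum p Cpow]; ring|].
    change (csum ?g (S (S (S n)))) with (csum g (S (S n)) + g (S (S n)))%C. rewrite <- IH. cbn [p]. ring. }
  apply Ccv_ext with (fun n => (((c * u n) + (csum (fun k => ((match k with O => RtoC 0 | S l => a l end) * Cpow z k)%C) n)) - (csum (fun k => (p k * Cpow z k)%C) n + csum (fun k => (trap_sum_coef s0 k * Cpow z k)%C) n))%C).
  - intros n. unfold u. induction n as [|n IH]; cbn [csum]; [ring|]. rewrite <- IH. unfold b. ring.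
  - unfold zeta_defect.
    replace ((s0 + z) - RtoC 1)%C with (c + z)%C by (unfold c; ring).
    replace ((c + z) * (zeta (s0 + z)%C))%C with
      ((c * (zeta (s0 + z)%C)) + (z * (zeta (s0 + z)%C)))%C by ring.
    apply Ccv_minus; [apply Ccv_plus; [now apply Ccv_scal|exact H1]|]. now apply Ccv_plus.
Qed.

(** The imaginary part is positive on the segment from [2 + i] to [1/2 + i t], except
    perhaps at the end, so the segment avoids the pole.  The defect vanishes where
    [Re s > 1].  If it vanishes up to the parameter [m], then its zeros accumulate at
    [g m], so its power series there is zero and it vanishes beyond [m]. *)
Lemma zeta_defect_segment zeta t : is_riemann_zeta zeta -> 0 <= t ->
  zeta_defect zeta (/ 2, t) = RtoC 0.
Proof.
  intros Hz Ht.
  set (d := (-3 / 2, t - 1) : C).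
  set (g := fun u : R => Cplus (2, 1) (RtoC u * d)%C).
  assert (Eg : forall u, g u = (2 - 3 / 2 * u, 1 + u * (t - 1))).
  { intros u. unfold g, d, Cplus, Cmult, RtoC; simpl. f_equal; field. }
  assert (Hd : 0 < Cmod d).
  { apply Cmod_gt_0. intros H. apply (f_equal Re) in H. simpl in H. lra. }
  assert (Hstep : forall u v, (g u + (RtoC (v - u) * d))%C = g v).
  { intros u v. unfold g. rewrite RtoC_minus. ring. }
  assert (Hh : forall u, 0 <= u <= 1 -> / 2 <= Re (g u)) by (intros u Hu; rewrite Eg; simpl; lra).
  assert (Hne : forall u, 0 <= u <= 1 -> g u <> RtoC 1).
  { intros u Hu H. rewrite Eg in H. pose proof (f_equal Re H) as H1. pose proof (f_equal Im H) as H2.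
    simpl in H1, H2. nra. }
  set (P := fun u => 0 <= u <= 1 /\ forall v, 0 <= v <= u -> zeta_defect zeta (g v) = RtoC 0).
  assert (P12 : P (1 / 2)).
  { split; [lra|]. intros v Hv. unfold zeta_defect. rewrite zeta_trap_right; [ring|exact Hz|]. rewrite Eg. simpl. lra. }
  destruct (completeness P) as [m [Hub Hlub]].
  { exists 1. intros u [Hu _]. lra. }
  { now exists (1 / 2). }
  assert (Hm : 1 / 2 <= m <= 1).
  { split; [apply Hub, P12|]. apply Hlub. intros u [Hu _]. lra. }
  assert (Hbelow : forall v, 0 <= v < m -> zeta_defect zeta (g v) = RtoC 0).
  { intros v Hv. destruct (Classical_Prop.classic (exists u, P u /\ v < u)) as [[u [[Hu1 Hu2] Hvu]]|K].
    - apply Hu2. lra.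
    - exfalso. assert (m <= v); [|lra]. apply Hlub. intros u Pu. apply Rnot_lt_le. intros Hlt. apply K. exists u. split; [exact Pu|exact Hlt]. }
  destruct (zeta_defect_power_series zeta (g m) Hz (Hh m ltac:(lra)) (Hne m ltac:(lra))) as (b & rho & Hrho & Hb).
  assert (Hb0 : forall k, b k = RtoC 0).
  { set (z1 := RtoC (rho / 2)). assert (Hz1 : Cmod z1 = rho / 2) by (unfold z1; rewrite Cmod_R, Rabs_right; lra).
    destruct (power_series_coef_bound b z1 _ ltac:(lra) (Hb z1 ltac:(lra))) as [B HB].
    apply (power_series_zeros b B (/ Cmod z1)); [apply Rinv_0_lt_compat; lra|exact HB|].
    intros dl Hdl. set (e := Rmin (1 / 4) (Rmin (dl / 2) (rho / 2) / Cmod d)).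
    assert (He0 : 0 < e) by (apply Rmin_pos; [lra|]; apply Rdiv_lt_0_compat; [apply Rmin_pos; lra|exact Hd]).
    assert (He1 : e <= 1 / 4) by apply Rmin_l.
    assert (He2 : e * Cmod d <= Rmin (dl / 2) (rho / 2)) by (apply Rle_div_r; [exact Hd|apply Rmin_r]).
    pose proof (Rmin_l (dl / 2) (rho / 2)). pose proof (Rmin_r (dl / 2) (rho / 2)).
    exists (RtoC (- e) * d)%C. rewrite Cmod_mult, Cmod_R, Rabs_Ropp, Rabs_right by lra.
    split; [split; [nra|lra]|].
    rewrite <- (Hbelow (m - e)) by lra. rewrite <- (Hstep m (m - e)).
    replace (m - e - m) with (- e) by ring. apply Hb.
    rewrite Cmod_mult, Cmod_R, Rabs_Ropp, Rabs_right by lra. lra. }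
  assert (Hdisc : forall z, Cmod z < rho -> zeta_defect zeta (g m + z)%C = RtoC 0).
  { intros z Hzr. apply (Ccv_unique (csum (fun k => (b k * Cpow z k)%C))); [now apply Hb|].
    apply Ccv_ext with (fun _ => RtoC 0); [|apply Ccv_const].
    intros n. rewrite (csum_ext _ (fun k => (RtoC 0 * RtoC 0)%C)); [rewrite csum_scal; ring|].
    intros k _. rewrite Hb0. ring. }
  (* The disc of the power series covers the parameters up to [m + e]. *)
  set (e := rho / 2 / Cmod d). assert (He : 0 < e) by (apply Rdiv_lt_0_compat; lra).
  assert (Hnear : forall v, m <= v <= m + e -> zeta_defect zeta (g v) = RtoC 0).
  { intros v Hv. rewrite <- (Hstep m v). apply Hdisc. rewrite Cmod_mult, Cmod_R, Rabs_right by lra.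
    assert (E : e * Cmod d = rho / 2) by (unfold e; field; lra). nra. }
  assert (Hall : forall v, 0 <= v <= m + e -> v <= 1 -> zeta_defect zeta (g v) = RtoC 0).
  { intros v Hv1 Hv2. destruct (Rlt_le_dec v m); [apply Hbelow; lra|apply Hnear; lra]. }
  assert (Hm1 : m = 1).
  { destruct (Rle_lt_dec 1 (m + e)) as [C|C].
    - apply Rle_antisym; [lra|]. apply Hub. split; [lra|]. intros v Hv. apply Hall; lra.
    - exfalso. assert (m + e <= m); [|lra]. apply Hub. split; [lra|]. intros v Hv. apply Hall; lra. }
  specialize (Hall 1 ltac:(lra) ltac:(lra)). rewrite Eg in Hall.
  replace (2 - 3 / 2 * 1) with (/ 2) in Hall by field. replace (1 + 1 * (t - 1)) with t in Hall by ring. exact Hall.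
Qed.

(** * Approximation of zeta on the critical line *)

(** [pole_re] and [pole_im] are the parts of [N^(1-s) / (1-s)] at [s = 1/2 + it]. *)
Definition pole_re N t := sqrt (INR N) * ((/ 2 * cos (t * ln (INR N)) + t * sin (t * ln (INR N))) * / (1 / 4 + t ^ 2)).
Definition pole_im N t := sqrt (INR N) * ((t * cos (t * ln (INR N)) - / 2 * sin (t * ln (INR N))) * / (1 / 4 + t ^ 2)).

(** The partial sum of the Dirichlet series minus the integral of [x^(-s)] from 0 to
    [N], which makes it converge to zeta as [N] grows. *)
Definition zeta_N (N : nat) (t : R) : C := (partial_re N t - pole_re N t, partial_im N t - pole_im N t).

Lemma exp_half_ln x : 0 < x -> exp (/ 2 * ln x) = sqrt x.
Proof.
  intros Hx. rewrite <- (sqrt_sqrt x) at 1 by lra.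
  rewrite ln_mult by (apply sqrt_lt_R0; lra).
  replace (/ 2 * (ln (sqrt x) + ln (sqrt x))) with (ln (sqrt x)) by field.
  apply exp_ln, sqrt_lt_R0, Hx.
Qed.

Lemma exp_neg_half_ln x : 0 < x -> exp (- / 2 * ln x) = / sqrt x.
Proof.
  intros Hx. rewrite <- exp_half_ln by exact Hx. rewrite <- exp_Ropp. f_equal. ring.
Qed.

Lemma csum_partial N t :
  csum (fun i => nat_Cpow_opp (S i) (/ 2, t)) N = (partial_re N t, partial_im N t).
Proof.
  induction N as [|N IH].
  - unfold partial_re, partial_im; simpl. unfold RtoC. f_equal. ring.
  - cbn [csum]. rewrite IH, nat_Cpow_opp_cpow, cpow_re_im. cbn [Re Im fst snd].
    rewrite exp_neg_half_ln by (apply lt_0_INR; lia).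
    unfold partial_re, partial_im, Cplus; cbn [fst snd sum1].
    replace (- t * ln (INR (S N))) with (- (t * ln (INR (S N)))) by ring.
    rewrite cos_neg, sin_neg. f_equal; ring.
Qed.

Lemma pole_cpow N t : (1 <= N)%nat ->
  (((/ 2, t)%R - RtoC 1) * (pole_re N t, pole_im N t))%C = (- cpow (INR N) (((/ 2, t)%R - RtoC 1)%C))%C.
Proof.
  intros HN. rewrite cpow_re_im. pose proof (quarter_sq_pos t).
  unfold Cminus, Cplus, Copp, RtoC, Re, Im; cbn [fst snd].
  replace (- (/ 2 + - (1)) * ln (INR N)) with (/ 2 * ln (INR N)) by field.
  rewrite exp_half_ln by (apply lt_0_INR; lia).
  replace (- (t + - 0) * ln (INR N)) with (- (t * ln (INR N))) by ring.
  rewrite cos_neg, sin_neg. unfold Cmult, pole_re, pole_im; cbn [fst snd]. f_equal; field; lra.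
Qed.

Lemma trap_term_bound t i : 0 <= t ->
  Cmod (trap_term (/ 2, t) i) <=
  Cmod (((/ 2, t)%R - RtoC 1)%C) * (2 * (1 + t) ^ 2) * (/ INR (S i) ^ 2 * / sqrt (INR (S i))).
Proof.
  intros Ht. set (a := ((/ 2, t)%R - RtoC 1)%C). assert (Hn : 1 <= INR (S i)) by (apply INR_ge_1; lia).
  assert (A1 : Cmod (a + RtoC 1)%C <= 1 + t).
  { eapply Rle_trans; [apply Cmod_le_re_im|]. unfold a; simpl. rewrite !Rabs_right by lra. lra. }
  assert (A2 : Cmod (a + RtoC 2)%C <= 2 * (1 + t)).
  { eapply Rle_trans; [apply Cmod_le_re_im|]. unfold a; simpl. rewrite !Rabs_right by lra. lra. }
  unfold trap_term. fold a. apply trap_coef_bound; [exact Hn|]. intros x Hx.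
  rewrite cpow_D3_0, Cmod_opp, !Cmod_mult, Cmod_cpow.
  assert (E : exp (- Re (a + RtoC 3)%C * ln x) <= / INR (S i) ^ 2 * / sqrt (INR (S i))).
  { replace (Re (a + RtoC 3)%C) with (5 / 2) by (unfold a; simpl; field).
    assert (L2 : ln (INR (S i)) <= ln x) by (apply ln_le; lra).
    replace (/ INR (S i) ^ 2 * / sqrt (INR (S i))) with (exp (- (5 / 2) * ln (INR (S i)))).
    - apply exp_le. nra.
    - rewrite <- exp_neg_half_ln by lra. set (L := ln (INR (S i))).
      replace (- (5 / 2) * L) with (- (L + L) + - / 2 * L) by field.
      rewrite exp_plus, exp_Ropp. f_equal. f_equal. unfold L. rewrite exp_plus, exp_ln by lra. ring. }
  pose proof (Cmod_ge_0 a). pose proof (Cmod_ge_0 (a + RtoC 1)%C). pose proof (Cmod_ge_0 (a + RtoC 2)%C).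
  apply Rmult_le_compat; [|apply Rlt_le, exp_pos| |exact E].
  - apply Rmult_le_pos; [apply Rmult_le_pos|]; assumption.
  - rewrite Rmult_assoc. apply Rmult_le_compat_l; [assumption|].
    replace (2 * (1 + t) ^ 2) with ((1 + t) * (2 * (1 + t))) by ring. apply Rmult_le_compat; assumption.
Qed.

(** [(s - 1) (zeta - zeta_N)] is the tail of [trap_sum], of order
    [|s - 1| |s| |s + 1| N^(-3/2)], minus half of [(s - 1) N^(-s)]; the factor [s - 1]
    cancels, so the estimate is not affected by the pole. *)
Lemma zeta_approx zeta t N : is_riemann_zeta zeta -> 0 <= t -> (1 <= N)%nat ->
  Cmod (zeta (/ 2, t)%R - zeta_N N t)%C
  <= / (2 * sqrt (INR N)) + 4 * (1 + t) ^ 2 * (/ INR N * / sqrt (INR N)).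
Proof.
  intros Hz Ht HN. set (s := (/ 2, t) : C). set (c := (s - RtoC 1)%C).
  assert (HN1 : 1 <= INR N) by (apply INR_ge_1, HN).
  assert (HsN : 0 < sqrt (INR N)) by (apply sqrt_lt_R0; lra).
  assert (Hc : 0 < Cmod c).
  { apply Cmod_gt_0. intros H. apply (f_equal Re) in H. unfold c, s in H. simpl in H. lra. }
  destruct N as [|M]; [lia|]. set (N := S M) in *.
  assert (Key : (c * (zeta s - zeta_N N t))%C =
    ((trap_sum s - csum (trap_term s) M) - (RtoC (/ 2) * (c * cpow (INR N) s)))%C).
  { pose proof (zeta_defect_segment zeta t Hz Ht) as D. fold s in D. unfold zeta_defect in D. fold c in D.
    assert (Ez : (c * zeta s)%C = ((RtoC 1 + (RtoC (/ 2) * c)) + trap_sum s)%C).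
    { set (X := (c * zeta s)%C) in *. set (Y := ((_ + _) + _)%C) in *.
      replace X with ((X - Y) + Y)%C by ring. rewrite D. ring. }
    pose proof (trap_partial_sum s M) as P. fold N c in P. pose proof (csum_partial N t) as CP. fold s in CP. rewrite CP in P.
    pose proof (pole_cpow N t HN) as Q. fold s c in Q.
    replace (zeta_N N t) with ((partial_re N t, partial_im N t) - (pole_re N t, pole_im N t))%C by reflexivity.
    set (Sg := (partial_re N t, partial_im N t) : C) in *. set (Pl := (pole_re N t, pole_im N t) : C) in *.
    replace (c * (zeta s - (Sg - Pl)))%C with (((c * zeta s) - (c * Sg)) + (c * Pl))%C by ring.
    rewrite Ez, Q, P. ring. }
  apply Rmult_le_reg_l with (Cmod c); [exact Hc|]. rewrite <- Cmod_mult. change (/ 2, t) with s. rewrite Key.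
  assert (B1 : Cmod (trap_sum s - csum (trap_term s) M)%C <= Cmod c * (4 * (1 + t) ^ 2 * (/ INR N * / sqrt (INR N)))).
  { assert (Hcv : Ccv (csum (trap_term s)) (trap_sum s)) by (apply trap_sum_cv; unfold s; simpl; lra).
    apply (Ccv_limit_bound _ _ _ _ M Hcv). intros n Hn.
    replace n with (M + (n - M))%nat by lia. rewrite csum_add.
    match goal with |- Cmod ((?A + ?D) - ?A)%C <= _ => replace ((A + D) - A)%C with D by ring end.
    set (W := Cmod c * (2 * (1 + t) ^ 2) * / sqrt (INR N)).
    assert (HW : 0 <= W).
    { apply Rmult_le_pos; [apply Rmult_le_pos; [lra|]|apply Rlt_le, Rinv_0_lt_compat, HsN].
      pose proof (pow2_ge_0 (1 + t)). lra. }
    eapply Rle_trans; [apply (csum_Cmod _ (fun k => W * / INR (N + k) ^ 2))|].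
    - intros k _. eapply Rle_trans; [apply trap_term_bound, Ht|]. change (S (M + k)) with (N + k)%nat. fold s c. unfold W.
      assert (Hnk : INR N <= INR (N + k)) by (apply le_INR; lia).
      assert (Hs : / sqrt (INR (N + k)) <= / sqrt (INR N)) by (apply Rinv_le_contravar; [exact HsN|now apply sqrt_le_1_alt]).
      replace (Cmod c * (2 * (1 + t) ^ 2) * / sqrt (INR N) * / INR (N + k) ^ 2) with
        (Cmod c * (2 * (1 + t) ^ 2) * (/ INR (N + k) ^ 2 * / sqrt (INR N))) by ring.
      apply Rmult_le_compat_l.
      + apply Rmult_le_pos; [lra|]. pose proof (pow2_ge_0 (1 + t)). lra.
      + apply Rmult_le_compat_l; [|exact Hs]. apply Rlt_le, Rinv_0_lt_compat, pow_lt. lra.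
    - rewrite rsum_scal.
      assert (Hr : rsum (fun k => / INR (N + k) ^ 2) (n - M) <= 2 * / INR N).
      { destruct (n - M)%nat as [|m].
        - unfold rsum; simpl sum1. assert (0 < / INR N) by (apply Rinv_0_lt_compat; lra). lra.
        - unfold rsum. rewrite <- (Nat.add_1_l m), sum1_add. simpl pred. cbn [sum1].
          pose proof (sum1_inv_sq_tail N m HN). rewrite Nat.add_0_r.
          assert (0 < / INR (N + m)) by (apply Rinv_0_lt_compat, lt_0_INR; lia).
          assert (/ INR N ^ 2 <= / INR N) by (apply Rinv_le_contravar; nra). lra. }
      apply Rle_trans with (W * (2 * / INR N)); [now apply Rmult_le_compat_l|]. right. unfold W. ring. }
  assert (B2 : Cmod (RtoC (/ 2) * (c * cpow (INR N) s))%C = Cmod c * / (2 * sqrt (INR N))).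
  { rewrite !Cmod_mult, Cmod_R, Rabs_right, Cmod_cpow by lra. unfold s; cbn [Re fst].
    rewrite exp_neg_half_ln, Rinv_mult by lra. ring. }
  eapply Rle_trans; [apply Cmod_triangle|]. rewrite Cmod_opp, B2. lra.
Qed.

(** The square of a difference, the cross term being the integrand of [pole_J]. *)
Lemma zeta_N_sq N t : (1 <= N)%nat ->
  Cmod (zeta_N N t) ^ 2 =
  (partial_re N t ^ 2 + partial_im N t ^ 2)
  - 2 * sum1 (fun n => exp (ln (INR N / INR n) / 2) * (/ 2 * cos (t * ln (INR N / INR n)) + t * sin (t * ln (INR N / INR n))) * / (1 / 4 + t ^ 2)) N
  + INR N * / (1 / 4 + t ^ 2).
Proof.
  intros HN. rewrite Cmod2_alt. unfold zeta_N; cbn [Re Im fst snd]. pose proof (quarter_sq_pos t) as Q.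
  assert (HN1 : 0 < INR N) by (apply lt_0_INR; lia).
  assert (HsN : sqrt (INR N) * sqrt (INR N) = INR N) by (apply sqrt_sqrt; lra).
  assert (E1 : pole_re N t ^ 2 + pole_im N t ^ 2 = INR N * / (1 / 4 + t ^ 2)).
  { unfold pole_re, pole_im. set (c := cos (t * ln (INR N))). set (d := sin (t * ln (INR N))).
    assert (Hcd : d * d + c * c = 1) by apply (sin2_cos2 (t * ln (INR N))).
    clearbody c d. set (q := sqrt (INR N)) in *. rewrite <- HsN. clearbody q.
    transitivity (q * q * ((d * d + c * c) * (1 / 4 + t ^ 2)) * (/ (1 / 4 + t ^ 2)) ^ 2); [field; lra|].
    rewrite Hcd. field. lra. }
  assert (E2 : partial_re N t * pole_re N t + partial_im N t * pole_im N t =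
    sum1 (fun n => exp (ln (INR N / INR n) / 2) * (/ 2 * cos (t * ln (INR N / INR n)) + t * sin (t * ln (INR N / INR n))) * / (1 / 4 + t ^ 2)) N).
  { unfold partial_re, partial_im.
    rewrite <- Ropp_mult_distr_l, Ropp_mult_distr_r, (Rmult_comm _ (pole_re N t)), (Rmult_comm _ (- pole_im N t)), <- !sum1_scal, <- sum1_plus.
    apply sum1_ext. intros n Hn. assert (Hn1 : 0 < INR n) by (apply lt_0_INR; lia).
    rewrite ln_div by assumption.
    replace ((ln (INR N) - ln (INR n)) / 2) with (/ 2 * ln (INR N) + - / 2 * ln (INR n)) by field.
    rewrite exp_plus, exp_half_ln, exp_neg_half_ln by assumption.
    rewrite Rmult_minus_distr_l, cos_minus, sin_minus. unfold pole_re, pole_im. field.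
    split; [lra|]. apply Rgt_not_eq, sqrt_lt_R0. exact Hn1. }
  replace ((partial_re N t - pole_re N t) ^ 2 + (partial_im N t - pole_im N t) ^ 2) with
    (partial_re N t ^ 2 + partial_im N t ^ 2 - 2 * (partial_re N t * pole_re N t + partial_im N t * pole_im N t)
     + (pole_re N t ^ 2 + pole_im N t ^ 2)) by ring.
  now rewrite E1, E2.
Qed.

Definition approx_moment T N : R :=
  T ^ 2 / 2 * harmonic N + 2 * off_diagonal T N - 2 * sum1 (fun n => pole_J T (ln (INR N / INR n))) N + INR N * pole_P T 0.

Lemma is_RInt_zeta_N T N : 0 <= T -> (1 <= N)%nat ->
  is_RInt (fun t => (T - t) * Cmod (zeta_N N t) ^ 2) 0 T (approx_moment T N).
Proof.
  intros HT HN.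
  set (F := fun (n : nat) (t : R) => (T - t) * (exp (ln (INR N / INR n) / 2) * (/ 2 * cos (t * ln (INR N / INR n)) + t * sin (t * ln (INR N / INR n))) * / (1 / 4 + t ^ 2))).
  apply is_RInt_ext with (fun t => ((T - t) * (partial_re N t ^ 2 + partial_im N t ^ 2) - 2 * sum1 (fun n => F n t) N) + INR N * ((T - t) * / (1 / 4 + t ^ 2))).
  - intros t _. rewrite zeta_N_sq by exact HN. unfold F. rewrite sum1_scal. eqR. ring.
  - unfold approx_moment.
    apply (is_RInt_plus (fun t => (T - t) * (partial_re N t ^ 2 + partial_im N t ^ 2) - 2 * sum1 (fun n => F n t) N)
       (fun t => INR N * ((T - t) * / (1 / 4 + t ^ 2)))).
    + apply (is_RInt_minus (fun t => (T - t) * (partial_re N t ^ 2 + partial_im N t ^ 2)) (fun t => 2 * sum1 (fun n => F n t) N)).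
      * now apply is_RInt_partial_sq.
      * apply (is_RInt_scal (fun t => sum1 (fun n => F n t) N)). apply is_RInt_sum1. intros n Hn.
        apply (RInt_correct (V := R_CompleteNormedModule)). apply ex_RInt_of_derive. intros t.
        pose proof (quarter_sq_pos t). unfold F. auto_derive. lra.
    + apply (is_RInt_scal (fun t => (T - t) * / (1 / 4 + t ^ 2))). rewrite pole_P_0.
      apply (RInt_correct (V := R_CompleteNormedModule)). apply ex_RInt_of_derive. intros t.
      pose proof (quarter_sq_pos t). auto_derive. lra.
Qed.

(** Two cancellations occur.  The diagonal term [T^2 / 2 * H_N] is compensated by the
    [- y^2 H_N] of [sum_parabola] with [y = T / (2 PI)], and the [y N] there by the pole
    term, whose mean value is close to [PI T N].  What remains is [riesz_sum y N]. *)
Lemma approx_moment_asymp T N H : 2 * PI <= T -> T <= INR N -> (1 <= H)%nat ->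
  Rabs (approx_moment T N - T ^ 2 / 2 * (ln T - ln (2 * PI) + 2 * euler_constant - 3 / 2))
  <= 2 * (2 * INR N + 5 * INR N * harmonic N + INR H * T / 2 * harmonic N + 2 * INR N ^ 2 / INR H)
     + 640 * (T * sqrt T) + 2 * (sqrt (INR N) * (T * (7 + ln T))) + INR N * (2 + ln T).
Proof.
  intros HT HTN HH. pose proof PI_RGT_0 as Hpi. pose proof PI_4 as Hpi4. pose proof PI2_3_2 as Hpi3.
  assert (HN1 : 1 <= INR N) by lra.
  assert (HN : (1 <= N)%nat) by (apply INR_le; exact HN1).
  set (y := T / (2 * PI)).
  assert (ETy : T = 2 * PI * y) by (unfold y; field; lra).
  assert (Hy1 : 1 <= y) by (apply Rle_div_r; lra).
  assert (HyT : y <= T) by nra.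
  pose proof (off_diagonal_asymp T N H ltac:(lra) HN HH) as O. fold y in O.
  rewrite (sum_parabola y N) in O by lra.
  pose proof (riesz_sum_asymp y N Hy1 ltac:(lra)) as W.
  pose proof (pole_sum T N ltac:(lra) HN) as S1.
  pose proof (pole_P_0_bounds T ltac:(lra)) as P0.
  pose proof (pole_P_abs T (ln (INR N)) ltac:(lra)) as PN.
  pose proof (pole_J_le T (ln (INR N)) ltac:(lra)) as JN.
  pose proof (pole_J_0_nonneg T ltac:(lra)) as J0.
  replace (- (ln (INR N) / 2)) with (- / 2 * ln (INR N)) in PN by field.
  replace (ln (INR N) / 2) with (/ 2 * ln (INR N)) in JN by field.
  rewrite exp_neg_half_ln in PN by lra. rewrite exp_half_ln in JN by lra.
  set (B := 2 * INR N + 5 * INR N * harmonic N + INR H * T / 2 * harmonic N + 2 * INR N ^ 2 / INR H) in *.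
  set (q := sqrt (INR N)) in *. assert (Hq : 0 < q) by (apply sqrt_lt_R0; lra).
  assert (Hqq : q * q = INR N) by (apply sqrt_sqrt; lra).
  assert (HlT : 0 <= ln T) by (rewrite <- ln_1; apply ln_le; lra).
  assert (SJ : Rabs (sum1 (fun n => pole_J T (ln (INR N / INR n))) N - INR N * pole_P T 0) <= q * (T * (7 + ln T))).
  { assert (PN2 : Rabs (INR N * pole_P T (ln (INR N))) <= q * (4 * T)).
    { rewrite Rabs_mult, Rabs_right by lra.
      apply Rle_trans with (INR N * (/ q * (PI * T))).
      - apply Rmult_le_compat_l; [lra|]. eapply Rle_trans; [exact PN|].
        apply Rmult_le_compat_l; [apply Rlt_le, Rinv_0_lt_compat, Hq|lra].
      - rewrite <- Hqq. replace (q * q * (/ q * (PI * T))) with (q * (PI * T)) by (field; lra). nra. }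
    apply Rabs_le_between in PN2. apply Rabs_le.
    replace (q * (T * (7 + ln T))) with (q * (T * (3 + ln T)) + q * (4 * T)) by ring.
    assert (0 <= q * (T * (3 + ln T))) by (repeat apply Rmult_le_pos; lra).
    split; lra. }
  assert (P0N : Rabs (INR N * pole_P T 0 - PI * T * INR N) <= INR N * (2 + ln T)).
  { replace (INR N * pole_P T 0 - PI * T * INR N) with (INR N * (pole_P T 0 - PI * T)) by ring.
    rewrite Rabs_mult, Rabs_right by lra. apply Rmult_le_compat_l; [lra|]. apply Rabs_le. lra. }
  assert (Hly : ln T - ln (2 * PI) = ln y) by (unfold y; rewrite ln_div by lra; reflexivity).
  assert (Wb : 2 * PI ^ 2 * (20 * (y * sqrt y)) <= 640 * (T * sqrt T)).
  { assert (Hs : sqrt y <= sqrt T) by (now apply sqrt_le_1_alt). pose proof (sqrt_pos y).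
    assert (y * sqrt y <= T * sqrt T) by (apply Rmult_le_compat; lra).
    assert (0 <= y * sqrt y) by (apply Rmult_le_pos; lra).
    assert (PI ^ 2 <= 16) by nra. nra. }
  replace (ln T - ln (2 * PI) + 2 * euler_constant - 3 / 2) with (ln y + 2 * euler_constant - 3 / 2) by lra.
  set (SJs := sum1 (fun n => pole_J T (ln (INR N / INR n))) N) in *.
  unfold approx_moment. fold SJs.
  set (h := harmonic N) in *. set (Wy := riesz_sum y N) in *. set (Of := off_diagonal T N) in *.
  set (g := euler_constant) in *.
  replace (T ^ 2 / 2 * h + 2 * Of - 2 * SJs + INR N * pole_P T 0 - T ^ 2 / 2 * (ln y + 2 * g - 3 / 2)) with
    (2 * (Of - PI ^ 2 * (y * INR N - y ^ 2 * h + Wy))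
     + 2 * PI ^ 2 * (Wy - (y ^ 2 * ln y + (2 * g - 3 / 2) * y ^ 2))
     + - 2 * (SJs - INR N * pole_P T 0) + - (INR N * pole_P T 0 - PI * T * INR N))
    by (rewrite ETy; field).
  eapply Rle_trans; [apply Rabs_triang|]. apply Rplus_le_compat; [|rewrite Rabs_Ropp; exact P0N].
  eapply Rle_trans; [apply Rabs_triang|]. apply Rplus_le_compat.
  2:{ rewrite Rabs_mult, (Rabs_left (- 2)) by lra. lra. }
  eapply Rle_trans; [apply Rabs_triang|]. apply Rplus_le_compat.
  - rewrite Rabs_mult, (Rabs_right 2) by lra. lra.
  - rewrite Rabs_mult, (Rabs_right (2 * PI ^ 2)) by nra. eapply Rle_trans; [|exact Wb].
    apply Rmult_le_compat_l; [nra|exact W].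
Qed.

(** * The weighted second moment *)

Lemma Cmod_reverse_triangle a b : Rabs (Cmod a - Cmod b) <= Cmod (a - b)%C.
Proof.
  pose proof (Cmod_triangle (a - b)%C b) as H1. pose proof (Cmod_triangle (b - a)%C a) as H2.
  replace ((a - b) + b)%C with a in H1 by ring. replace ((b - a) + a)%C with b in H2 by ring.
  rewrite (Cmod_minus_sym b a) in H2. apply Rabs_le. lra.
Qed.

Lemma vertical_shift (x t y : R) : (x, y) = ((x, t) + (Ci * RtoC (y - t)))%C.
Proof. unfold Cplus, Cmult, Ci, RtoC; simpl. f_equal; ring. Qed.

Definition zeta_sq (zeta : C -> C) (t : R) : R := Cmod (zeta (/ 2, t)) ^ 2.

Lemma zeta_sq_continuous zeta t : is_riemann_zeta zeta -> continuous (zeta_sq zeta) t.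
Proof.
  intros [_ Hz].
  assert (Hs : (/ 2, t) <> RtoC 1) by (intros H; apply (f_equal Re) in H; simpl in H; lra).
  destruct (Hz _ Hs) as (a & r & Hr & Ha). set (s0 := (/ 2, t) : C) in *.
  assert (Hp : forall z, Cmod z < r -> Ccv (csum (fun k => (a k * Cpow z k)%C)) (zeta (s0 + z)%C)).
  { intros z Hzr. apply is_pseries_Ccv. specialize (Ha (s0 + z)%C).
    replace ((s0 + z) - s0)%C with z in Ha by ring. now apply Ha. }
  set (z1 := RtoC (r / 2)). assert (Hz1 : Cmod z1 = r / 2) by (unfold z1; rewrite Cmod_R, Rabs_right; lra).
  destruct (power_series_coef_bound a z1 _ ltac:(lra) (Hp z1 ltac:(lra))) as [B HB].
  set (q := / Cmod z1) in *. assert (Hq : 0 < q) by (apply Rinv_0_lt_compat; lra).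
  assert (HB0 : 0 <= B) by (pose proof (Cmod_ge_0 (a 0%nat)); specialize (HB 0%nat); simpl in HB; lra).
  assert (Hlip : forall z, Cmod z < r -> q * Cmod z <= / 2 -> Cmod ((zeta (s0 + z)%C) - (a 0%nat))%C <= 2 * B * q * Cmod z).
  { intros z H1 H2. pose proof (power_series_truncation a B q z _ 1 ltac:(lra) ltac:(lra) HB (Hp z H1)) as T.
    cbn [csum Cpow] in T. replace (RtoC 0 + ((a 0%nat) * RtoC 1))%C with (a 0%nat) in T by ring.
    eapply Rle_trans; [exact T|]. assert (0 <= q * Cmod z) by (apply Rmult_le_pos; [lra|apply Cmod_ge_0]).
    apply Rle_div_l; [lra|]. simpl pow. rewrite Rmult_1_r.
    assert (0 <= B * (q * Cmod z)) by (now apply Rmult_le_pos). nra. }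
  assert (E0 : zeta s0 = a 0%nat).
  { apply Cmod_small_eq. intros eps He. specialize (Hlip (RtoC 0)). rewrite Cmod_0 in Hlip.
    replace (s0 + RtoC 0)%C with s0 in Hlip by ring. specialize (Hlip Hr ltac:(lra)). lra. }
  assert (Hc : continuous (fun y => Cmod (zeta (/ 2, y))) t).
  { apply filterlim_locally. intros eps.
    set (d := Rmin (r / 2) (Rmin (/ (2 * q)) (eps / (2 * B * q + 1)))).
    assert (HBq : 0 <= 2 * B * q) by (apply Rmult_le_pos; lra).
    assert (Hd : 0 < d).
    { repeat apply Rmin_pos; [lra|apply Rinv_0_lt_compat; lra|]. apply Rdiv_lt_0_compat; [apply cond_pos|lra]. }
    exists (mkposreal d Hd). intros y Hy. change (Rabs (y - t) < d) in Hy.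
    change (Rabs (Cmod (zeta (/ 2, y)) - Cmod (zeta (/ 2, t))) < eps).
    eapply Rle_lt_trans; [apply Cmod_reverse_triangle|].
    set (z := (Ci * RtoC (y - t))%C).
    assert (Ey : (/ 2, y) = (s0 + z)%C).
    { apply vertical_shift. }
    assert (Hzm : Cmod z = Rabs (y - t)) by (unfold z; rewrite Cmod_mult, Cmod_Ci, Cmod_R; apply Rmult_1_l).
    change (/ 2, t) with s0. rewrite Ey, E0.
    assert (D1 : d <= r / 2) by apply Rmin_l.
    assert (D2 : d <= / (2 * q)) by (eapply Rle_trans; [apply Rmin_r|apply Rmin_l]).
    assert (D3 : d <= eps / (2 * B * q + 1)) by (eapply Rle_trans; [apply Rmin_r|apply Rmin_r]).
    eapply Rle_lt_trans; [apply Hlip|].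
    - lra.
    - apply Rle_trans with (q * / (2 * q)); [apply Rmult_le_compat_l; lra|]. right. field. lra.
    - rewrite Hzm. pose proof (Rabs_pos (y - t)).
      assert (Hy2 : Rabs (y - t) < eps / (2 * B * q + 1)) by lra.
      apply Rlt_div_r in Hy2; [|lra]. nra. }
  unfold zeta_sq. apply (continuous_comp (fun y => Cmod (zeta (/ 2, y))) (fun x => x ^ 2)); [exact Hc|].
  apply continuous_of_derive. auto_derive. easy.
Qed.

Definition weighted_moment zeta T : R := RInt (fun t => (T - t) * zeta_sq zeta t) 0 T.

Lemma ex_RInt_zeta_sq zeta a b : is_riemann_zeta zeta -> ex_RInt (zeta_sq zeta) a b.
Proof. intros Hz. apply ex_RInt_of_continuous. intros; now apply zeta_sq_continuous. Qed.

Lemma ex_RInt_weighted zeta c a b : is_riemann_zeta zeta -> ex_RInt (fun t => (c - t) * zeta_sq zeta t) a b.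
Proof.
  intros Hz. apply ex_RInt_of_continuous. intros t.
  apply (continuous_mult (fun t => c - t) (zeta_sq zeta)); [|now apply zeta_sq_continuous].
  apply continuous_of_derive. auto_derive. easy.
Qed.

(** The mixed term is split by the inequality of arithmetic and geometric means with
    parameter [e], so that the bound can be integrated against any weight. *)
Lemma Cmod_sq_perturb z w e r : 0 < e <= 1 -> Cmod (z - w)%C <= r ->
  Rabs (Cmod z ^ 2 - Cmod w ^ 2) <= e * Cmod w ^ 2 + (1 + / e) * r ^ 2.
Proof.
  intros He Hr. pose proof (Cmod_reverse_triangle z w) as H. apply Rabs_le_between in H.
  pose proof (Cmod_ge_0 z). pose proof (Cmod_ge_0 w). pose proof (Cmod_ge_0 (z - w)%C).
  set (a := Cmod z) in *. set (b := Cmod w) in *.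
  assert (Hie : 0 < / e) by (apply Rinv_0_lt_compat; lra). assert (Hee : / e * e = 1) by (apply Rinv_l; lra).
  assert (AM : 2 * b * r <= e * b ^ 2 + / e * r ^ 2).
  { pose proof (pow2_ge_0 (e * b - r)) as S. assert (0 <= / e * (e * b - r) ^ 2) by (apply Rmult_le_pos; lra).
    replace (/ e * (e * b - r) ^ 2) with (/ e * e * (e * b ^ 2) - 2 * (/ e * e) * b * r + / e * r ^ 2) in H3 by ring.
    rewrite Hee in H3. lra. }
  apply Rabs_le. split; nra.
Qed.

Lemma weighted_moment_approx zeta T N e r : is_riemann_zeta zeta -> 0 <= T -> (1 <= N)%nat -> 0 < e <= 1 ->
  (forall t, 0 <= t <= T -> Cmod (zeta (/ 2, t)%R - zeta_N N t)%C <= r) ->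
  Rabs (weighted_moment zeta T - approx_moment T N) <= e * approx_moment T N + (1 + / e) * r ^ 2 * (T ^ 2 / 2).
Proof.
  intros Hz HT HN He Hr.
  pose proof (is_RInt_zeta_N T N HT HN) as HI. pose proof (is_RInt_fejer T HT) as HF.
  pose proof (RInt_correct (V := R_CompleteNormedModule) _ _ _ (ex_RInt_weighted zeta T 0 T Hz)) as HV.
  fold (weighted_moment zeta T) in HV.
  pose proof (is_RInt_minus _ _ _ _ _ _ HV HI) as HD.
  pose proof (is_RInt_plus _ _ _ _ _ _ (is_RInt_scal _ _ _ e _ HI) (is_RInt_scal _ _ _ ((1 + / e) * r ^ 2) _ HF)) as HB.
  match type of HD with is_RInt ?f _ _ _ => set (fD := f) in HD end.
  match type of HB with is_RInt ?f _ _ _ => set (fB := f) in HB end.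
  assert (E1 : RInt fD 0 T = weighted_moment zeta T - approx_moment T N) by (apply is_RInt_unique; exact HD).
  assert (E2 : RInt fB 0 T = e * approx_moment T N + (1 + / e) * r ^ 2 * (T ^ 2 / 2)) by (apply is_RInt_unique; exact HB).
  rewrite <- E1, <- E2.
  eapply Rle_trans; [apply abs_RInt_le; [exact HT|eexists; exact HD]|].
  apply RInt_le; [exact HT| |eexists; exact HB|].
  - apply (ex_RInt_norm _ 0 T). eexists; exact HD.
  - intros t Ht. unfold fD, fB, minus, plus, opp, scal; cbn -[pow]. unfold mult; cbn -[pow].
    pose proof (Cmod_sq_perturb _ _ e r He (Hr t ltac:(lra))) as P.
    replace ((T - t) * zeta_sq zeta t + - ((T - t) * Cmod (zeta_N N t) ^ 2)) with
      ((T - t) * (Cmod (zeta (/ 2, t)) ^ 2 - Cmod (zeta_N N t) ^ 2)) by (unfold zeta_sq; ring).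
    rewrite Rabs_mult, (Rabs_right (T - t)) by lra.
    replace (e * ((T - t) * Cmod (zeta_N N t) ^ 2) + (1 + / e) * r ^ 2 * (T - t)) with
      ((T - t) * (e * Cmod (zeta_N N t) ^ 2 + (1 + / e) * r ^ 2)) by ring.
    apply Rmult_le_compat_l; [lra|exact P].
Qed.

Lemma nat_near x : 1 <= x -> exists n : nat, (1 <= n)%nat /\ x <= INR n <= 2 * x.
Proof.
  intros Hx. destruct (nfloor_ex x) as [n Hn]; [lra|]. exists (S n). rewrite S_INR. split; [lia|lra].
Qed.

Lemma ln_le_self x : 0 < x -> ln x <= x.
Proof. intros Hx. pose proof (exp_ineq1_le (ln x)) as E. rewrite exp_ln in E; lra. Qed.

Lemma ln_pow_nat x n : 0 < x -> ln (x ^ n) = INR n * ln x.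
Proof.
  intros Hx. induction n as [|n IH]; [simpl; rewrite ln_1; ring|].
  rewrite S_INR. simpl. rewrite ln_mult, IH by (try apply pow_lt; exact Hx). ring.
Qed.

Definition moment_constant : R := 2 * euler_constant - 3 / 2 - ln (2 * PI).

(** Put [T = u^40].  The length [N ~ u^56] exceeds [T^(4/3)], so that [zeta_approx] has
    error [O(u^(-4))], but it stays below [T^(3/2)]: with [H ~ u^36] both [H T] and
    [N^2 / H] are [O(u^76)] in [off_diagonal_asymp].  The parameter of
    [Cmod_sq_perturb] is [u^(-3)].  All errors are then [O(u^78) = O(T^2 u^(-2))]. *)
Lemma weighted_moment_asymp zeta : is_riemann_zeta zeta ->
  exists K, 0 <= K /\ forall u, 2 <= u ->
  Rabs (weighted_moment zeta (u ^ 40) - (u ^ 40) ^ 2 / 2 * (ln (u ^ 40) + moment_constant)) <= K * u ^ 78.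
Proof.
  intros Hz. set (k := Rabs moment_constant). assert (Hk : 0 <= k) by apply Rabs_pos.
  exists (7000 + k). split; [lra|]. intros u Hu.
  assert (Hmono : forall i j, (i <= j)%nat -> u ^ i <= u ^ j) by (intros; apply Rle_pow; [lra|assumption]).
  assert (Hpos : forall i, 0 < u ^ i) by (intros; apply pow_lt; lra).
  assert (Hge1 : forall i, 1 <= u ^ i) by (intros i; rewrite <- (pow_O u); apply Hmono; lia).
  destruct (nat_near (u ^ 56) (Hge1 56%nat)) as [N [HN1 HN]].
  destruct (nat_near (u ^ 36) (Hge1 36%nat)) as [H [HH1 HH]].
  set (T := u ^ 40) in *.
  assert (HT : 2 * PI <= T).
  { pose proof PI_4. assert (2 ^ 3 <= T); [|simpl in *; lra]. unfold T.
    apply Rle_trans with (u ^ 3); [apply pow_incr; lra|apply Hmono; lia]. }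
  pose proof PI2_3_2 as Hpi. assert (HT1 : 1 <= T) by lra.
  assert (HTN : T <= INR N) by (eapply Rle_trans; [apply (Hmono 40%nat 56%nat); lia|lra]).
  assert (Hlu : 0 <= ln u <= u).
  { split; [rewrite <- ln_1; apply ln_le; lra|apply ln_le_self; lra]. }
  assert (HlT : 0 <= ln T <= 40 * u).
  { unfold T. rewrite ln_pow_nat by lra. replace (INR 40) with 40 by (simpl; ring). lra. }
  assert (Hharm : 0 <= harmonic N <= 58 * u).
  { split.
    - apply sum1_nonneg. intros n Hn. apply Rlt_le, Rinv_0_lt_compat, lt_0_INR. lia.
    - eapply Rle_trans; [now apply harmonic_le|].
      assert (ln (INR N) <= ln (2 * u ^ 56)) by (apply ln_le; [apply lt_0_INR; lia|lra]).
      rewrite ln_mult, ln_pow_nat in H0 by (try apply Hpos; lra).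
      replace (INR 56) with 56 in H0 by (simpl; ring).
      pose proof (ln_le_self 2 ltac:(lra)). assert (ln 2 < 1).
      { rewrite <- (ln_exp 1). apply ln_increasing; [lra|]. pose proof (exp_ineq1 1). lra. }
      lra. }
  set (q := sqrt (INR N)). assert (Hqq : q * q = INR N) by (apply sqrt_sqrt; lra).
  assert (Hq : u ^ 28 <= q <= 2 * u ^ 28).
  { assert (E : u ^ 56 = u ^ 28 * u ^ 28) by (rewrite <- pow_add; reflexivity).
    unfold q. pose proof (Hpos 28%nat). split.
    - rewrite <- (sqrt_square (u ^ 28)) by lra. apply sqrt_le_1_alt. lra.
    - rewrite <- (sqrt_square (2 * u ^ 28)) by lra. apply sqrt_le_1_alt. nra. }
  assert (HsT : sqrt T = u ^ 20).
  { unfold T. replace (u ^ 40) with (u ^ 20 * u ^ 20) by (rewrite <- pow_add; reflexivity).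
    apply sqrt_square. apply Rlt_le, Hpos. }
  assert (P1 : forall i j, u ^ i * u ^ j = u ^ (i + j)) by (intros; now rewrite pow_add).
  assert (Pu : forall i, u ^ i * u = u ^ (i + 1)) by (intros; rewrite pow_add, pow_1; ring).
  set (Z := u ^ 77).
  assert (HZ : 0 < Z) by apply Hpos.
  pose proof (approx_moment_asymp T N H HT HTN HH1) as A.
  fold q in A. set (h := harmonic N) in *.
  assert (BoundA : 2 * (2 * INR N + 5 * INR N * h + INR H * T / 2 * h + 2 * INR N ^ 2 / INR H)
     + 640 * (T * sqrt T) + 2 * (q * (T * (7 + ln T))) + INR N * (2 + ln T) <= 2300 * Z).
  { assert (B1 : INR N <= 2 * Z) by (pose proof (Hmono 56%nat 77%nat ltac:(lia)); unfold Z; lra).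
    assert (B2 : INR N * h <= 116 * Z).
    { apply Rle_trans with ((2 * u ^ 56) * (58 * u)); [apply Rmult_le_compat; try lra|].
      replace (2 * u ^ 56 * (58 * u)) with (116 * (u ^ 56 * u)) by ring. rewrite Pu.
      pose proof (Hmono (56 + 1)%nat 77%nat ltac:(lia)). unfold Z. lra. }
    assert (B3 : INR H * T * h <= 116 * Z).
    { apply Rle_trans with ((2 * u ^ 36 * u ^ 40) * (58 * u)).
      - apply Rmult_le_compat; try lra.
        + apply Rmult_le_pos; [apply pos_INR|lra].
        + apply Rmult_le_compat; [apply pos_INR|lra|lra|unfold T; lra].
      - replace (2 * u ^ 36 * u ^ 40 * (58 * u)) with (116 * (u ^ 36 * u ^ 40 * u)) by ring. rewrite P1, Pu.
        unfold Z. simpl Nat.add. lra. }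
    assert (B4 : INR N ^ 2 / INR H <= 4 * Z).
    { apply Rle_div_l; [pose proof (Hpos 36%nat); lra|].
      apply Rle_trans with ((2 * u ^ 56) ^ 2); [apply pow_incr; pose proof (Hpos 56%nat); lra|].
      replace ((2 * u ^ 56) ^ 2) with (4 * (u ^ 56 * u ^ 56)) by ring. rewrite P1.
      apply Rle_trans with (4 * Z * u ^ 36); [|apply Rmult_le_compat_l; lra].
      unfold Z. rewrite Rmult_assoc, P1. apply Rmult_le_compat_l; [lra|]. apply Hmono. lia. }
    assert (B5 : T * sqrt T <= Z).
    { rewrite HsT. unfold T. rewrite P1. apply Hmono. lia. }
    assert (B6 : q * (T * (7 + ln T)) <= 94 * Z).
    { apply Rle_trans with (2 * u ^ 28 * (u ^ 40 * (47 * u))).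
      - apply Rmult_le_compat; [pose proof (Hpos 28%nat); lra|apply Rmult_le_pos; lra|lra|].
        apply Rmult_le_compat; [lra|lra|unfold T; lra|lra].
      - replace (2 * u ^ 28 * (u ^ 40 * (47 * u))) with (94 * (u ^ 28 * u ^ 40 * u)) by ring. rewrite P1, Pu.
        apply Rmult_le_compat_l; [lra|]. apply Hmono. lia. }
    assert (B7 : INR N * (2 + ln T) <= 84 * Z).
    { apply Rle_trans with ((2 * u ^ 56) * (42 * u)); [apply Rmult_le_compat; lra|].
      replace (2 * u ^ 56 * (42 * u)) with (84 * (u ^ 56 * u)) by ring. rewrite Pu.
      apply Rmult_le_compat_l; [lra|]. apply Hmono. lia. }
    replace (INR H * T / 2 * h) with (INR H * T * h / 2) by field.
    replace (2 * INR N ^ 2 / INR H) with (2 * (INR N ^ 2 / INR H)) by (unfold Rdiv; ring).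
    replace (5 * INR N * h) with (5 * (INR N * h)) by ring. lra. }
  assert (A2 : Rabs (approx_moment T N - T ^ 2 / 2 * (ln T + moment_constant)) <= 2300 * Z).
  { eapply Rle_trans; [|exact BoundA]. replace (ln T + moment_constant) with
      (ln T - ln (2 * PI) + 2 * euler_constant - 3 / 2) by (unfold moment_constant; ring). exact A. }
  assert (HT2 : T ^ 2 = u ^ 80) by (unfold T; rewrite <- pow_mult; reflexivity).
  assert (A3 : approx_moment T N <= (2320 + k) * u ^ 81).
  { apply Rabs_le_between in A2.
    assert (M1 : moment_constant <= k) by apply Rle_abs.
    assert (M2 : T ^ 2 / 2 * (ln T + moment_constant) <= (20 + k) * u ^ 81).
    { apply Rle_trans with (u ^ 80 / 2 * ((40 + k) * u)).
      - rewrite HT2. pose proof (Hpos 80%nat). apply Rmult_le_compat_l; [lra|]. nra.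
      - replace (u ^ 80 / 2 * ((40 + k) * u)) with ((20 + k / 2) * (u ^ 80 * u)) by field. rewrite Pu.
        pose proof (Hpos 81%nat). simpl Nat.add. nra. }
    assert (Z <= u ^ 81) by (apply Hmono; lia). lra. }
  set (r := 17 / u ^ 4).
  assert (Hr : forall t, 0 <= t <= T -> Cmod (zeta (/ 2, t)%R - zeta_N N t)%C <= r).
  { intros t Ht. eapply Rle_trans; [apply zeta_approx; [exact Hz|lra|exact HN1]|]. fold q.
    pose proof (Hpos 28%nat) as Q28. pose proof (Hpos 4%nat) as Q4.
    assert (R1 : / (2 * q) <= / u ^ 4).
    { apply Rinv_le_contravar; [exact Q4|]. pose proof (Hmono 4%nat 28%nat ltac:(lia)). lra. }
    assert (R2 : 4 * (1 + t) ^ 2 * (/ INR N * / q) <= 16 / u ^ 4).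
    { rewrite <- Rinv_mult. apply Rle_trans with (16 * u ^ 80 * / u ^ 84).
      - apply Rmult_le_compat.
        + pose proof (pow2_ge_0 (1 + t)). lra.
        + apply Rlt_le, Rinv_0_lt_compat. pose proof (Hpos 56%nat). nra.
        + rewrite <- HT2. nra.
        + apply Rinv_le_contravar; [apply Hpos|]. replace (u ^ 84) with (u ^ 56 * u ^ 28) by (rewrite P1; reflexivity).
          apply Rmult_le_compat; try (apply Rlt_le, Hpos); lra.
      - right. replace (u ^ 84) with (u ^ 80 * u ^ 4) by (rewrite P1; reflexivity).
        pose proof (Hpos 80%nat). field. lra. }
    unfold r. unfold Rdiv in *. lra. }
  assert (He : 0 < / u ^ 3 <= 1).
  { split; [apply Rinv_0_lt_compat, Hpos|]. rewrite <- Rinv_1. apply Rinv_le_contravar; [lra|apply Hge1]. }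
  pose proof (weighted_moment_approx zeta T N (/ u ^ 3) r Hz ltac:(lra) HN1 He Hr) as W.
  rewrite Rinv_inv in W.
  assert (W1 : / u ^ 3 * approx_moment T N <= (2320 + k) * u ^ 78).
  { apply Rle_trans with (/ u ^ 3 * ((2320 + k) * u ^ 81)); [apply Rmult_le_compat_l; lra|].
    right. replace (u ^ 81) with (u ^ 78 * u ^ 3) by (rewrite P1; reflexivity).
    pose proof (Hpos 3%nat). field. lra. }
  assert (W2 : (1 + u ^ 3) * r ^ 2 * (T ^ 2 / 2) <= 289 * u ^ 78).
  { unfold r. rewrite HT2. apply Rle_trans with (2 * u ^ 3 * (17 / u ^ 4) ^ 2 * (u ^ 80 / 2)).
    - pose proof (Hpos 80%nat). pose proof (Hge1 3%nat). apply Rmult_le_compat_r; [lra|].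
      apply Rmult_le_compat_r; [apply pow2_ge_0|lra].
    - apply Rle_trans with (289 * u ^ 75); [|apply Rmult_le_compat_l; [lra|apply Hmono; lia]].
      right. replace (u ^ 80) with (u ^ 72 * u ^ 4 * u ^ 4) by (rewrite !P1; reflexivity).
      replace (u ^ 75) with (u ^ 72 * u ^ 3) by (rewrite P1; reflexivity).
      pose proof (Hpos 4%nat). field. lra. }
  replace (weighted_moment zeta T - T ^ 2 / 2 * (ln T + moment_constant)) with
    ((weighted_moment zeta T - approx_moment T N) + (approx_moment T N - T ^ 2 / 2 * (ln T + moment_constant))) by ring.
  eapply Rle_trans; [apply Rabs_triang|].
  assert (Z <= u ^ 78) by (apply Hmono; lia). pose proof (Hpos 78%nat). nra.
Qed.

(** * The second moment *)

Lemma pow_lt_base x y n : 0 <= x < y -> x ^ S n < y ^ S n.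
Proof.
  intros H. induction n as [|n IH]; [simpl; lra|].
  change (x * x ^ S n < y * y ^ S n). apply Rmult_le_0_lt_compat; try lra. apply pow_le. lra.
Qed.

Definition second_moment zeta T : R := RInt (zeta_sq zeta) 0 T.

Lemma zeta_sq_nonneg zeta t : 0 <= zeta_sq zeta t.
Proof. apply pow2_ge_0. Qed.

(** The weighted moment is a primitive of the second moment, which is nondecreasing. *)
Lemma weighted_moment_slope zeta T U : is_riemann_zeta zeta -> 0 <= T -> 0 <= U ->
  U * second_moment zeta T <= weighted_moment zeta (T + U) - weighted_moment zeta T
    <= U * second_moment zeta (T + U).
Proof.
  intros Hz HT HU. unfold second_moment, weighted_moment. set (g := zeta_sq zeta).
  assert (Eg : forall a b, ex_RInt g a b) by (intros; now apply ex_RInt_zeta_sq).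
  assert (Ew : forall c a b, ex_RInt (fun t => (c - t) * g t) a b) by (intros; now apply ex_RInt_weighted).
  assert (C1 : RInt (fun t => (T + U - t) * g t) 0 (T + U) =
     RInt (fun t => (T + U - t) * g t) 0 T + RInt (fun t => (T + U - t) * g t) T (T + U)).
  { symmetry. apply (RInt_Chasles (fun t => (T + U - t) * g t)); apply Ew. }
  assert (C2 : RInt g 0 (T + U) = RInt g 0 T + RInt g T (T + U)).
  { symmetry. apply (RInt_Chasles g); apply Eg. }
  assert (C3 : RInt (fun t => (T + U - t) * g t) 0 T = RInt (fun t => (T - t) * g t) 0 T + U * RInt g 0 T).
  { apply is_RInt_unique. apply is_RInt_ext with (fun t => plus ((T - t) * g t) (scal U (g t))).
    - intros t _. unfold plus, scal; simpl; unfold mult; simpl. eqR. ring.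
    - apply (is_RInt_plus (fun t => (T - t) * g t) (fun t => scal U (g t))).
      + apply (RInt_correct (V := R_CompleteNormedModule)), Ew.
      + apply (is_RInt_scal g). apply (RInt_correct (V := R_CompleteNormedModule)), Eg. }
  assert (C4 : 0 <= RInt (fun t => (T + U - t) * g t) T (T + U)).
  { apply RInt_ge_0; [lra|apply Ew|]. intros t Ht. apply Rmult_le_pos; [lra|apply zeta_sq_nonneg]. }
  assert (C5 : RInt (fun t => (T + U - t) * g t) T (T + U) <= U * RInt g T (T + U)).
  { assert (E : U * RInt g T (T + U) = RInt (fun t => scal U (g t)) T (T + U)).
    { symmetry. apply (RInt_scal g). apply Eg. }
    rewrite E. apply RInt_le; [lra|apply Ew|apply (ex_RInt_scal g), Eg|].
    intros t Ht. unfold scal; simpl; unfold mult; simpl.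
    apply Rmult_le_compat_r; [apply zeta_sq_nonneg|lra]. }
  rewrite C1, C2, C3. lra.
Qed.

Lemma main_term_secant c a b : 1 <= a <= b ->
  let M := fun T => T ^ 2 / 2 * (ln T + c) in
  M b - M a <= (b - a) * (a * (ln a + c + / 2) + (b - a) * (ln b + Rabs c + 2)) /\
  (b - a) * (b * (ln b + c + / 2) - (b - a) * (ln b + Rabs c + 2)) <= M b - M a.
Proof.
  intros Hab M. set (m := fun T => T * (ln T + c + / 2)).
  set (S := ln b + Rabs c + 2).
  assert (Dm : forall x y, a <= x <= y -> y <= b -> Rabs (m y - m x) <= S * (y - x)).
  { intros x y Hx Hy. apply (derive_bounded_le m (fun T => ln T + c + 3 / 2)); [lra| |].
    - intros T HT. unfold m. auto_derive; [lra|]. field. lra.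
    - intros T HT. pose proof (Rabs_le_between c (Rabs c)) as [K _]. specialize (K (Rle_refl _)).
      assert (0 <= ln T) by (rewrite <- ln_1; apply ln_le; lra). assert (ln T <= ln b) by (apply ln_le; lra).
      apply Rabs_le. unfold S. lra. }
  destruct (MVT_gen M a b m) as [x [Hx E]]; rewrite ?Rmin_left, ?Rmax_right in * by lra.
  - intros T HT. unfold M, m. auto_derive; [lra|]. field. lra.
  - intros T HT. apply continuity_pt_filterlim. apply (ex_derive_continuous M). unfold M. auto_derive. lra.
  - assert (HS : 0 <= S).
    { unfold S. pose proof (Rabs_pos c). assert (0 <= ln b) by (rewrite <- ln_1; apply ln_le; lra). lra. }
    pose proof (Dm a x ltac:(lra) ltac:(lra)) as D1. pose proof (Dm x b ltac:(lra) ltac:(lra)) as D2.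
    apply Rabs_le_between in D1, D2. rewrite E. fold (m a) (m b). fold S.
    assert (S * (x - a) <= (b - a) * S) by nra. assert (S * (b - x) <= (b - a) * S) by nra.
    rewrite (Rmult_comm (m x)).
    split; apply Rmult_le_compat_l; lra.
Qed.

(** By convexity the slopes of secants of length [U] bracket the second moment.  With
    [U = T / (2 u)], [u = T^(1/40)], the error [O(T^2 / u^2)] of the weighted moment
    becomes [O(T / u)] after division by [U], while the slope of the main term moves
    by [O(U ln T)] only; as [ln T] is [O(v)] for [v = sqrt u], both are [O(T / v)]. *)
Lemma second_moment_asymp zeta : is_riemann_zeta zeta ->
  exists D T0, 1 <= T0 /\ forall T, T0 <= T ->
  Rabs (second_moment zeta T - T * (ln T + moment_constant + / 2)) <= D * T / exp (ln T / 80).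
Proof.
  intros Hz. destruct (weighted_moment_asymp zeta Hz) as [K [HK HV]].
  set (c := moment_constant) in *. set (V := weighted_moment zeta) in *.
  set (M := fun T => T ^ 2 / 2 * (ln T + c)) in *.
  set (k := Rabs c). assert (Hk : 0 <= k) by apply Rabs_pos.
  assert (Herr : forall T, 2 ^ 40 <= T -> Rabs (V T - M T) <= K * T ^ 2 / exp (ln T / 40) ^ 2).
  { intros T HT. assert (HT0 : 0 < T) by (pose proof (pow_lt 2 40); lra).
    set (u := exp (ln T / 40)). assert (Hu0 : 0 < u) by apply exp_pos.
    assert (Eu : u ^ 40 = T).
    { rewrite <- (exp_ln (u ^ 40)) by (apply pow_lt, Hu0). rewrite ln_pow_nat by exact Hu0.
      unfold u. rewrite ln_exp. replace (INR 40) with 40 by (simpl; ring).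
      replace (40 * (ln T / 40)) with (ln T) by field. apply exp_ln, HT0. }
    assert (Hu2 : 2 <= u).
    { apply Rnot_lt_le. intros Hlt. assert (u ^ 40 < 2 ^ 40); [|lra].
      apply pow_lt_base; lra. }
    specialize (HV u Hu2). rewrite Eu in HV. unfold M. eapply Rle_trans; [exact HV|].
    right. rewrite <- Eu at 1. replace ((u ^ 40) ^ 2) with (u ^ 78 * u ^ 2) by (rewrite <- pow_mult, <- pow_add; reflexivity).
    field. lra. }
  exists (16 * K + 2 * (80 + k + 4)), (2 ^ 42). split; [apply pow_R1_Rle; lra|]. intros T HT.
  assert (H40 : 1 <= 2 ^ 40) by (apply pow_R1_Rle; lra).
  assert (HT4 : 4 * 2 ^ 40 <= T) by (simpl pow in *; lra).
  assert (HT0 : 4 <= T) by lra.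
  set (v := exp (ln T / 80)). set (u := exp (ln T / 40)).
  assert (Euv : u = v * v) by (unfold u, v; rewrite <- exp_plus; f_equal; field).
  assert (HlT : 0 < ln T) by (rewrite <- ln_1; apply ln_increasing; lra).
  assert (Hv1 : 1 < v) by (unfold v; rewrite <- exp_0; apply exp_increasing; lra).
  assert (Hlv : ln T = 80 * ln v) by (unfold v; rewrite ln_exp; field).
  assert (Hlv2 : ln v <= v) by (apply ln_le_self; lra).
  set (U := T / (2 * u)). assert (Hu1 : 1 < u) by nra.
  assert (EU : U * u = T / 2) by (unfold U; field; lra).
  assert (HU : 0 < U <= T / 2).
  { split; [unfold U; apply Rdiv_lt_0_compat; lra|]. nra. }
  assert (Hup : forall T', T <= T' -> u <= exp (ln T' / 40)).
  { intros T' H'. apply exp_le. assert (ln T <= ln T') by (apply ln_le; lra). lra. }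
  assert (E0 : Rabs (V T - M T) <= K * T ^ 2 / u ^ 2) by (apply Herr; lra).
  assert (Hu2 : 0 < u ^ 2) by (apply pow_lt; lra).
  assert (E1 : Rabs (V (T + U) - M (T + U)) <= 3 * (K * T ^ 2 / u ^ 2)).
  { eapply Rle_trans; [apply Herr; lra|]. apply Rle_trans with (K * (T + U) ^ 2 / u ^ 2).
    - unfold Rdiv. apply Rmult_le_compat_l; [apply Rmult_le_pos; [lra|apply pow2_ge_0]|].
      apply Rinv_le_contravar; [exact Hu2|]. apply pow_incr. split; [lra|]. apply Hup. lra.
    - replace (3 * (K * T ^ 2 / u ^ 2)) with (K * (3 * T ^ 2) / u ^ 2) by (unfold Rdiv; ring).
      unfold Rdiv. apply Rmult_le_compat_r; [apply Rlt_le, Rinv_0_lt_compat, Hu2|]. apply Rmult_le_compat_l; [lra|]. nra. }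
  assert (E2 : Rabs (V (T - U) - M (T - U)) <= 4 * (K * T ^ 2 / u ^ 2)).
  { eapply Rle_trans; [apply Herr; lra|]. apply Rle_trans with (K * T ^ 2 / (u / 2) ^ 2).
    (* [T - U >= T / 2], and [2^(-1/40) >= 1/2]. *)
    - assert (Hh : u / 2 <= exp (ln (T - U) / 40)).
      { assert (Hl : ln T - ln 2 <= ln (T - U)) by (rewrite <- ln_div by lra; apply ln_le; lra).
        apply Rle_trans with (exp (ln T / 40 - ln 2)).
        - unfold Rminus. rewrite exp_plus, exp_Ropp, exp_ln by lra. fold u. unfold Rdiv. lra.
        - apply exp_le. assert (0 < ln 2) by (rewrite <- ln_1; apply ln_increasing; lra). lra. }
      unfold Rdiv at 1. apply Rle_trans with (K * T ^ 2 * / exp (ln (T - U) / 40) ^ 2).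
      + apply Rmult_le_compat_r; [apply Rlt_le, Rinv_0_lt_compat, pow_lt, exp_pos|]. apply Rmult_le_compat_l; [lra|]. apply pow_incr. lra.
      + unfold Rdiv at 2. apply Rmult_le_compat_l; [apply Rmult_le_pos; [lra|apply pow2_ge_0]|].
        apply Rinv_le_contravar; [apply pow_lt; lra|]. apply pow_incr. lra.
    - right. field. lra. }
  set (e := K * T ^ 2 / u ^ 2) in *.
  assert (He : e = 2 * U * (K * T / u)) by (unfold e, U; field; lra).
  pose proof (weighted_moment_slope zeta T U Hz ltac:(lra) ltac:(lra)) as [S1 _].
  pose proof (weighted_moment_slope zeta (T - U) U Hz ltac:(lra) ltac:(lra)) as [_ S2].
  replace (T - U + U) with T in S2 by ring. fold V in S1, S2.
  destruct (main_term_secant c T (T + U) ltac:(lra)) as [M1 _].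
  destruct (main_term_secant c (T - U) T ltac:(lra)) as [_ M2].
  fold (M T) (M (T + U)) (M (T - U)) in M1, M2. fold k in M1, M2.
  replace (T + U - T) with U in M1 by ring. replace (T - (T - U)) with U in M2 by ring.
  assert (Hl2 : ln (T + U) <= ln T + 1).
  { replace (T + U) with (T * (1 + U / T)) by (field; lra).
    assert (0 < U / T) by (apply Rdiv_lt_0_compat; lra).
    assert (U / T <= 1) by (apply Rle_div_l; lra).
    rewrite ln_mult by lra. pose proof (ln_1p_bounds (U / T) ltac:(lra)). lra. }
  set (G := second_moment zeta T) in *. set (m := T * (ln T + c + / 2)) in *.
  apply Rabs_le_between in E0, E1, E2.
  assert (Up : G <= m + U * (ln T + k + 3) + 8 * (K * T / u)).
  { apply Rmult_le_reg_l with U; [lra|]. 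
    assert (U * (U * (ln (T + U) + k + 2)) <= U * (U * (ln T + k + 3))).
    { apply Rmult_le_compat_l; [lra|]. apply Rmult_le_compat_l; lra. }
    lra. }
  assert (Lo : m - U * (ln T + k + 2) - 10 * (K * T / u) <= G).
  { apply Rmult_le_reg_l with U; [lra|]. lra. }
  assert (Hb : U * (ln T + k + 3) + 10 * (K * T / u) <= (16 * K + 2 * (80 + k + 4)) * T / v).
  { assert (Ki : K * T / u <= K * T / v).
    { unfold Rdiv. apply Rmult_le_compat_l; [apply Rmult_le_pos; lra|]. apply Rinv_le_contravar; nra. }
    assert (Ui : U * (ln T + k + 3) <= (80 + k + 3) * T / v).
    { unfold U. rewrite Euv. rewrite Hlv.
      replace (T / (2 * (v * v)) * (80 * ln v + k + 3)) with (T / v * ((80 * ln v + k + 3) / (2 * v))) by (field; lra).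
      replace ((80 + k + 3) * T / v) with (T / v * (80 + k + 3)) by (field; lra).
      apply Rmult_le_compat_l; [apply Rdiv_le_0_compat; lra|]. apply Rle_div_l; nra. }
    assert (0 < T / v) by (apply Rdiv_lt_0_compat; lra).
    replace (K * T / v) with (K * (T / v)) in Ki by (field; lra).
    replace ((80 + k + 3) * T / v) with ((80 + k + 3) * (T / v)) in Ui by (field; lra).
    replace ((16 * K + 2 * (80 + k + 4)) * T / v) with ((16 * K + 2 * (80 + k + 4)) * (T / v)) by (field; lra). nra. }
  assert (0 <= K * T / u) by (apply Rdiv_le_0_compat; [apply Rmult_le_pos|]; lra).
  apply Rabs_le. fold v. lra.
Qed.

(** * The limit and the theorem *)

(** Euler's constant is at most [H_4 - ln 4], so it is enough that
    [25 / 6 < ln (32 * PI)], which follows from [exp (1/12) <= 12 / 11] and [PI > 3]. *)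
Lemma slope_constant_pos : 0 < ln (2 * PI) - 2 * euler_constant.
Proof.
  pose proof (harmonic_euler 4 ltac:(lia)) as [H _].
  assert (E : harmonic 4 = 25 / 12) by (unfold harmonic; simpl; field).
  rewrite E in H. replace (INR 4) with (2 * 2) in H by (simpl; ring).
  rewrite ln_mult in H by lra.
  pose proof PI2_3_2 as Hpi.
  assert (H1 : ln (2 * 3) <= ln (2 * PI)) by (apply ln_le; lra).
  assert (H2 : 25 / 6 < ln (2 * 3 * 2 ^ 4)).
  { rewrite <- (ln_exp (25 / 6)). apply ln_increasing; [apply exp_pos|].
    (* [exp x <= 1 / (1 - x)] at [x = 1/12], where the 50th power of the bound is below 96. *)
    assert (Hx : exp (/ 12) <= 12 / 11).
    { pose proof (exp_ineq1_le (- / 12)) as K. rewrite exp_Ropp in K.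
      pose proof (exp_pos (/ 12)) as P. set (x := exp (/ 12)) in *.
      assert (/ x * x = 1) by (apply Rinv_l; lra). nra. }
    assert (Hp : exp (25 / 6) = exp (/ 12) ^ 50).
    { rewrite <- (exp_ln (exp (/ 12) ^ 50)) by (apply pow_lt, exp_pos).
      rewrite ln_pow_nat, ln_exp by apply exp_pos. f_equal. simpl INR. field. }
    rewrite Hp. apply Rle_lt_trans with ((12 / 11) ^ 50); [apply pow_incr; split; [apply Rlt_le, exp_pos|exact Hx]|].
    lra. }
  rewrite ln_mult, ln_pow_nat in H2 by lra. replace (INR 4) with 4 in H2 by (simpl; ring). lra.
Qed.

Lemma second_moment_small zeta : is_riemann_zeta zeta ->
  forall eps, 0 < eps -> exists d, 0 < d /\ forall a, 0 < a < d -> Rabs (second_moment zeta a) < eps.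
Proof.
  intros Hz eps He.
  assert (Hc : continuous (second_moment zeta) 0).
  { apply continuous_of_derive. exists (zeta_sq zeta 0). apply (is_derive_RInt (zeta_sq zeta) _ 0 0).
    - apply filter_forall. intros x. apply (RInt_correct (V := R_CompleteNormedModule)). now apply ex_RInt_zeta_sq.
    - now apply zeta_sq_continuous. }
  destruct (proj1 (filterlim_locally _ _) Hc (mkposreal eps He)) as [d Hd].
  exists d. split; [apply cond_pos|]. intros a Ha.
  specialize (Hd a). assert (Hb : ball 0 d a).
  { change (Rabs (a - 0) < d). rewrite Rabs_right; lra. }
  specialize (Hd Hb). change (Rabs (second_moment zeta a - second_moment zeta 0) < eps) in Hd.
  replace (second_moment zeta 0) with 0 in Hd by (symmetry; apply (RInt_point 0 (zeta_sq zeta))).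
  now rewrite Rminus_0_r in Hd.
Qed.

Lemma x_ln_x_small x : 0 < x <= 1 -> Rabs (x * ln x - x) <= 3 * sqrt x.
Proof.
  intros Hx. assert (Hs : 0 < sqrt x) by (apply sqrt_lt_R0; lra).
  assert (Hss : sqrt x * sqrt x = x) by (apply sqrt_sqrt; lra).
  assert (Hs1 : sqrt x <= 1) by (rewrite <- sqrt_1; apply sqrt_le_1_alt; lra).
  assert (Hl : ln x <= 0) by (rewrite <- ln_1; apply ln_le; lra).
  assert (Hl2 : - ln (sqrt x) <= / sqrt x).
  { rewrite <- ln_Rinv by exact Hs. apply ln_le_self, Rinv_0_lt_compat, Hs. }
  assert (El : ln x = 2 * ln (sqrt x)) by (rewrite <- Hss at 1; rewrite ln_mult by exact Hs; ring).
  set (s := sqrt x) in *.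
  assert (H1 : s * - ln s <= 1).
  { apply Rle_trans with (s * / s); [apply Rmult_le_compat_l; lra|]. rewrite Rinv_r; lra. }
  apply Rabs_le. rewrite El, <- Hss. split; [|nra].
  assert (s * (s * - ln s) <= s * 1) by (apply Rmult_le_compat_l; lra). nra.
Qed.

(** A primitive of the integrand is [t ln t - t] minus the second moment; it tends
    to 0 at 0. *)
Lemma zeta_ln_integral_eq zeta X : is_riemann_zeta zeta -> 0 < X ->
  zeta_ln_integral zeta X = X * ln X - X - second_moment zeta X.
Proof.
  intros Hz HX. unfold zeta_ln_integral. set (g := zeta_sq zeta). set (G := second_moment zeta).
  apply is_RInt_gen_unique.
  assert (HI : forall a, 0 < a <= X -> is_RInt (fun t => ln t - Cmod (zeta (1 / 2, t)) ^ 2) a X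
     ((X * ln X - X - G X) - (a * ln a - a - G a))).
  { intros a Ha. apply is_RInt_ext with (fun t => minus (ln t) (g t)).
    - intros t _. unfold g, zeta_sq. now replace (1 / 2) with (/ 2) by field.
    - replace (X * ln X - X - G X - (a * ln a - a - G a)) with
        (minus ((X * ln X - X) - (a * ln a - a)) (RInt g a X)).
      + apply (is_RInt_minus ln g).
        * apply (is_RInt_derive_R (fun t => t * ln t - t)); [lra| |].
          -- intros t Ht. auto_derive; [lra|]. field. lra.
          -- intros t Ht. apply continuous_of_derive. auto_derive. lra.
        * apply (RInt_correct (V := R_CompleteNormedModule)). now apply ex_RInt_zeta_sq.
      + assert (C : G X = G a + RInt g a X).
        { symmetry. apply (RInt_Chasles g); now apply ex_RInt_zeta_sq. }
        rewrite C. unfold minus, plus, opp; simpl. ring. }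
  intros P [eps HP].
  destruct (second_moment_small zeta Hz (eps / 2)) as [d [Hd HG]]; [pose proof (cond_pos eps); lra|].
  (* [3 sqrt a < eps / 2] for [a < b^2]. *)
  set (b := eps / 6). assert (Hb : 0 < b) by (unfold b; pose proof (cond_pos eps); lra).
  assert (Hdel : 0 < Rmin (Rmin d X) (Rmin 1 (b * b))) by (repeat apply Rmin_pos; nra).
  apply (Filter_prod _ _ _ (fun a => 0 < a < Rmin (Rmin d X) (Rmin 1 (b * b))) (fun y => y = X)).
  - exists (mkposreal _ Hdel). intros y Hy Hy0. change (Rabs (y - 0) < Rmin (Rmin d X) (Rmin 1 (b * b))) in Hy.
    rewrite Rminus_0_r, Rabs_right in Hy by lra. lra.
  - reflexivity.
  - intros a y [Ha0 Ha] ->. exists ((X * ln X - X - G X) - (a * ln a - a - G a)).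
    assert (A1 : a < d) by (eapply Rlt_le_trans; [exact Ha|]; eapply Rle_trans; [apply Rmin_l|apply Rmin_l]).
    assert (A2 : a < X) by (eapply Rlt_le_trans; [exact Ha|]; eapply Rle_trans; [apply Rmin_l|apply Rmin_r]).
    assert (A3 : a < 1) by (eapply Rlt_le_trans; [exact Ha|]; eapply Rle_trans; [apply Rmin_r|apply Rmin_l]).
    assert (A4 : a < b * b) by (eapply Rlt_le_trans; [exact Ha|]; eapply Rle_trans; [apply Rmin_r|apply Rmin_r]).
    split; [simpl; apply HI; lra|]. apply HP.
    change (Rabs (X * ln X - X - G X - (a * ln a - a - G a) - (X * ln X - X - G X)) < eps).
    replace (X * ln X - X - G X - (a * ln a - a - G a) - (X * ln X - X - G X)) with
      (G a - (a * ln a - a)) by ring.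
    specialize (HG a ltac:(lra)). fold G in HG. pose proof (x_ln_x_small a ltac:(lra)) as Hx.
    assert (Hs : sqrt a < b) by (rewrite <- (sqrt_square b) by lra; apply sqrt_lt_1_alt; lra).
    apply Rabs_def2 in HG. apply Rabs_le_between in Hx. unfold b in *. apply Rabs_def1; lra.
Qed.

(** In [X ln X - X - second_moment zeta X] the logarithms cancel and a multiple of [X]
    by [ln (2 PI) - 2 euler_constant] remains, up to [o(X)]. *)
Lemma zeta_ln_integral_limit zeta q : is_riemann_zeta zeta -> 0 < q ->
  is_lim (fun tau => 1 / tau * zeta_ln_integral zeta (q * (tau / (ln (2 * PI) - 2 * euler_constant)))) p_infty q.
Proof.
  intros Hz Hq. set (k := ln (2 * PI) - 2 * euler_constant).
  assert (Hk : 0 < k) by apply slope_constant_pos.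
  destruct (second_moment_asymp zeta Hz) as (D & T0 & HT0 & HD).
  set (c := q / k). assert (Hc : 0 < c) by (now apply Rdiv_lt_0_compat).
  apply is_lim_spec. intros eps. pose proof (cond_pos eps) as He.
  set (D' := Rabs D + 1). assert (HD' : D <= D' /\ 0 < D') by (unfold D'; pose proof (Rle_abs D); pose proof (Rabs_pos D); lra).
  set (w := c * D' / eps). assert (Hw : 0 < w) by (apply Rdiv_lt_0_compat; [apply Rmult_lt_0_compat|]; lra).
  exists (Rmax (T0 / c) (exp (80 * ln w) / c)). intros tau Htau.
  assert (H1 : T0 / c < tau) by (eapply Rle_lt_trans; [apply Rmax_l|exact Htau]).
  assert (H2 : exp (80 * ln w) / c < tau) by (eapply Rle_lt_trans; [apply Rmax_r|exact Htau]).
  apply Rlt_div_l in H1; [|exact Hc]. apply Rlt_div_l in H2; [|exact Hc].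
  assert (Ht : 0 < tau) by nra.
  replace (q * (tau / k)) with (tau * c) by (unfold c; field; lra).
  set (X := tau * c) in *. assert (HX : 0 < X) by (unfold X; nra).
  rewrite zeta_ln_integral_eq by assumption.
  specialize (HD X ltac:(lra)). set (v := exp (ln X / 80)) in *.
  assert (Hv : w < v).
  { rewrite <- (exp_ln w Hw). unfold v. apply exp_increasing.
    apply ln_increasing in H2; [|apply exp_pos]. rewrite ln_exp in H2. lra. }
  set (E := second_moment zeta X - X * (ln X + moment_constant + / 2)) in *.
  replace (1 / tau * (X * ln X - X - second_moment zeta X) - q) with (- (E / tau)).
  - rewrite Rabs_Ropp. unfold Rdiv. rewrite Rabs_mult, (Rabs_right (/ tau)) by (apply Rle_ge, Rlt_le, Rinv_0_lt_compat, Ht).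
    apply Rle_lt_trans with (c * D' / v).
    + apply Rle_trans with (D * X / v * / tau).
      * apply Rmult_le_compat_r; [apply Rlt_le, Rinv_0_lt_compat, Ht|exact HD].
      * unfold X. replace (D * (tau * c) / v * / tau) with (c * D / v) by (field; lra).
        unfold Rdiv. apply Rmult_le_compat_r; [apply Rlt_le, Rinv_0_lt_compat; lra|]. apply Rmult_le_compat_l; lra.
    + apply Rlt_div_l; [lra|]. unfold w in Hv. apply Rlt_div_l in Hv; [|exact He]. lra.
  - unfold E, moment_constant. replace q with (c * k) by (unfold c; field; lra). unfold k, X. field. lra.
Qed.

Theorem theorem1 (zeta : C -> C) (Hzeta : is_riemann_zeta zeta) :
  (forall x y z n : nat,
     (0 < x)%nat -> (0 < y)%nat -> (0 < z)%nat -> (3 <= n)%nat ->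
     exists l : R,
       is_lim (fun tau : R =>
           1 / tau *
           zeta_ln_integral zeta
             ((INR x ^ n + INR y ^ n) / INR z ^ n *
              (tau / (ln (2 * PI) - 2 * euler_constant))))
         p_infty l /\
       l <> 1)
  <->
  (forall x y z n : nat,
     (0 < x)%nat -> (0 < y)%nat -> (0 < z)%nat -> (3 <= n)%nat ->
     (x ^ n + y ^ n <> z ^ n)%nat).
Proof.
  assert (Hlim : forall x y z n : nat, (0 < x)%nat -> (0 < y)%nat -> (0 < z)%nat ->
    is_lim (fun tau : R => 1 / tau * zeta_ln_integral zeta
       ((INR x ^ n + INR y ^ n) / INR z ^ n * (tau / (ln (2 * PI) - 2 * euler_constant))))
      p_infty ((INR x ^ n + INR y ^ n) / INR z ^ n)).
  { intros x y z n Hx Hy Hz. apply zeta_ln_integral_limit; [exact Hzeta|].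
    assert (0 < INR x ^ n) by (apply pow_lt, lt_0_INR, Hx). assert (0 < INR y ^ n) by (apply pow_lt, lt_0_INR, Hy).
    assert (0 < INR z ^ n) by (apply pow_lt, lt_0_INR, Hz). apply Rdiv_lt_0_compat; lra. }
  assert (Hone : forall x y z n : nat, (0 < z)%nat ->
    ((INR x ^ n + INR y ^ n) / INR z ^ n = 1 <-> (x ^ n + y ^ n = z ^ n)%nat)).
  { intros x y z n Hz. assert (Hzn : 0 < INR z ^ n) by (apply pow_lt, lt_0_INR, Hz). split; intros H.
    - apply INR_eq. rewrite plus_INR, !pow_INR.
      replace (INR x ^ n + INR y ^ n) with ((INR x ^ n + INR y ^ n) / INR z ^ n * INR z ^ n) by (field; lra).
      rewrite H. ring.
    - rewrite <- !pow_INR, <- plus_INR, H, pow_INR. field. lra. }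
  split.
  - intros H x y z n Hx Hy Hz Hn Heq. destruct (H x y z n Hx Hy Hz Hn) as [l [Hl Hl1]].
    apply Hl1. pose proof (is_lim_unique _ _ _ Hl) as L1. pose proof (is_lim_unique _ _ _ (Hlim x y z n Hx Hy Hz)) as L2.
    rewrite L1 in L2. injection L2 as L2. rewrite L2. now apply Hone.
  - intros H x y z n Hx Hy Hz Hn. exists ((INR x ^ n + INR y ^ n) / INR z ^ n). split; [now apply Hlim|].
    intros E. apply (H x y z n Hx Hy Hz Hn). now apply Hone in E.
Qed.
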